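(* Let $\mu \ge 0$ and let $S:\mathbb{Z}^3\to\mathbb{C}$ be a kernel satisfying: (i) $S(k,m,n)=0$ if $kmn=0$; (ii) $S(k,m,n)=S^\ast(-k,-m,-n)$; (iii) $S(k,m,n)=S(k,n,m)$; (iv) $S(k,m,n)=S(m,n,k)$; (v) $S(\eta k,\eta m,\eta n)=\eta^\mu S(k,m,n)$ for $\eta>0$; (vi) for some constant $C$ and all $k,m,n\in\mathbb{Z}$, $|S(k,m,n)|\le C\min\{|k|^\mu,|m|^\mu,|n|^\mu\}$. Let the bilinear form $a$ be defined by $$\widehat{a(u,v)}(k)=\sum_{n=-\infty}^{\infty}S(-k,k-n,n)\,\widehat{u}(k-n)\,\widehat{v}(n),\qquad k\in\mathbb{Z},$$ and suppose that $s>\mu+3/2$. Then, for any $f\in\dot H^s(\mathbb{T})$, the initial value problem $$u_t+a(u,u)_x=0,\qquad u(x,0)=f(x),$$ has a unique local solution $$u\in C\left(I;\dot H^s(\mathbb{T})\right)\cap C^1\left(I;\dot H^{s-1}(\mathbb{T})\right)$$ defined on the time interval $I=(-t_\ast,t_\ast)$, where $$t_\ast=\frac{1}{K_s\|f\|_s},\qquad K_s=C\,C_s\,M_{s-\mu-1}.$$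
   Context: $\mathbb{T}$ is the circle of length $2\pi$. Fourier coefficients are $\widehat f(k)=\frac{1}{2\pi}\int_{\mathbb{T}}f(x)e^{-ikx}\,dx$, so $f(x)=\sum_{k\in\mathbb{Z}}\widehat f(k)e^{ikx}$; for functions $u(x,t)$, the transform is taken in $x$ at each fixed $t$. A star denotes complex conjugation. $\dot H^s(\mathbb{T})$ is the Hilbert space of real-valued periodic $f$ with $\widehat f(0)=0$ and $\|f\|_s=\left(\sum_{k\in\mathbb{Z}}|k|^{2s}|\widehat f(k)|^2\right)^{1/2}<\infty$. The homogeneity condition (v) is required whenever both $(k,m,n)$ and $(\eta k,\eta m,\eta n)$ lie in $\mathbb{Z}^3$. Constants: $C$ is the constant in (vi). $C_s$ is a constant, depending only on $s$, such that $$\left|k|k|^{2s}+m|m|^{2s}+n|n|^{2s}\right|\le C_s\left\{|k|^s|m|^s|n|+|n|^s|k|^s|m|+|m|^s|n|^s|k|\right\}$$ for all $k,m,n\in\mathbb{R}$ with $k+m+n=0$ (such a constant exists for every $s>0$). For $r>1/2$, $M_r=\left(2\sum_{n=1}^\infty n^{-2r}\right)^{1/2}$. If $K_s\|f\|_s=0$, then $t_\ast$ is understood as $+\infty$. *)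

(* Defs.v *)
From HB Require Import structures.
From mathcomp Require Export all_boot all_order all_algebra.
From mathcomp Require Export all_classical all_reals all_analysis.
From mathcomp Require Export complex.

Set Implicit Arguments.
Unset Strict Implicit.
Unset Printing Implicit Defensive.

Export Order.TTheory GRing.Theory Num.Theory.
Export numFieldNormedType.Exports.

Local Open Scope classical_set_scope.
Local Open Scope ring_scope.
Local Open Scope complex_scope.

Section Circle.
Variable R : realType.
Implicit Types (f g w : R -> R) (k : int) (s t : R) (I : set R).

Local Notation leb := (@lebesgue_measure R).

(* A function on the circle is a 2pi-periodic function on the line; elements of
   the function spaces below are such functions up to [eqT]. *)
Definition circle : set R := `[0, 2 * pi].

Definition integrableT f : Prop :=
  periodic f (2 * pi) /\ leb.-integrable circle (EFin \o f).

Definition eqT f g : Prop := {ae leb, forall x, f x = g x}.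

Definition expi (x : R) : R[i] := cos x +i* sin x.

Definition Cintegral (F : R -> R[i]) : R[i] :=
  (\int[leb]_(x in circle) complex.Re (F x))
  +i* (\int[leb]_(x in circle) complex.Im (F x)).

Definition fourier f k : R[i] :=
  ((2 * pi)^-1)%:C * Cintegral (fun x => (f x)%:C * expi (- (k%:~R * x))).

Definition sobolev_sum s f : \bar R :=
  (\esum_(k in [set: int])
     ((`|k|%:~R `^ (2 * s)) * (ComplexField.Normc.normc (fourier f k)) ^+ 2)%:E)%E.

(* [fine] sends +oo to 0, so this is the norm only on members of [Hdot s]. *)
Definition sobolev_norm s f : R := Num.sqrt (fine (sobolev_sum s f)).

(* Meant for s >= 0, where every element of the Sobolev space is a function. *)
Definition Hdot s : set (R -> R) :=
  [set f | [/\ integrableT f, fourier f 0 = 0 & (sobolev_sum s f < +oo)%E]].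

(* The series over all integers, as the limit of its symmetric partial sums;
   those in [bilin] converge absolutely when u, v belong to [Hdot s] with
   s > mu + 3/2. *)
Definition zsum (F : int -> R[i]) (l : R[i]) : Prop :=
  ComplexField.Normc.normc (\sum_(0 <= j < (2 * N).+1) F (j%:Z - N%:Z) - l)
    @[N --> \oo] --> (0 : R).

(* [bilin S u v w] : the function w is a(u, v).  Fourier coefficients determine
   w up to [eqT]. *)
Definition bilin (S : int -> int -> int -> R[i]) (u v w : R -> R) : Prop :=
  integrableT w /\
  forall k, zsum (fun n => S (- k) (k - n) n * fourier u (k - n) * fourier v n)
                 (fourier w k).

(* [wx] is the distributional derivative of [w] on the circle. *)
Definition weak_deriv w (wx : R -> R) : Prop :=
  [/\ integrableT w, integrableT wx &
      forall phi : R -> R, periodic phi (2 * pi) ->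
        (forall n x, derivable (derive1n n phi) x 1) ->
        \int[leb]_(x in circle) (w x * derive1 phi x)
        = - \int[leb]_(x in circle) (wx x * phi x)].

(* In the following, [u t] is the spatial function at time [t]. *)

Definition C0_Hdot s I (u : R -> R -> R) : Prop :=
  (forall t, I t -> Hdot s (u t)) /\
  (forall t0, I t0 ->
     sobolev_norm s (u t \- u t0) @[t --> within I (nbhs t0)] --> (0 : R)).

(* [u] is C^1 on the open set [I], with time derivative [ut]. *)
Definition C1_Hdot s I (u ut : R -> R -> R) : Prop :=
  [/\ forall t, I t -> Hdot s (u t),
      C0_Hdot s I ut &
      forall t, I t ->
        sobolev_norm s (fun x => h^-1 * (u (t + h) x - u t x) - ut t x)
          @[h --> (0 : R)^'] --> (0 : R)].

Definition is_solution (S : int -> int -> int -> R[i]) s I f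
    (u : R -> R -> R) : Prop :=
  C0_Hdot s I u /\
  exists ut : R -> R -> R,
    [/\ C1_Hdot (s - 1) I u ut,
        eqT (u 0) f &
        forall t, I t -> exists w wx : R -> R,
          [/\ bilin S (u t) (u t) w, weak_deriv w wx &
              eqT (fun x => ut t x + wx x) (fun=> 0)]].

Definition symbol_bound s (Cs : R) : Prop :=
  forall k m n : R, k + m + n = 0 ->
    `|k * `|k| `^ (2 * s) + m * `|m| `^ (2 * s) + n * `|n| `^ (2 * s)|
    <= Cs * (`|k| `^ s * `|m| `^ s * `|n| + `|n| `^ s * `|k| `^ s * `|m|
             + `|m| `^ s * `|n| `^ s * `|k|).

Definition Mconst (r : R) : R :=
  Num.sqrt (2 * fine (\sum_(1 <= n <oo) ((n%:R `^ (- (2 * r)))%:E))%E).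

Definition lifespan (a : R) : \bar R := if a == 0 then +oo%E else (a^-1)%:E.

Definition time_interval (T : \bar R) : set R := [set t | (`|t|%:E < T)%E].

End Circle.

(* Main.v *)
Require Import Defs.
From mathcomp Require Import measurable_realfun ring lra zify.

Set Implicit Arguments.
Unset Strict Implicit.
Unset Printing Implicit Defensive.

Local Open Scope classical_set_scope.
Local Open Scope ring_scope.
Local Open Scope complex_scope.

(** The equation lives on Fourier coefficients. Writing [c t k] for the
    coefficients of [u t], it is the infinite system [c' = burgers S c] for
    Hermitian sequences of mean zero, and nearly all of the proof concerns this
    system.

    The key is an a priori estimate. In the derivative of the squared Sobolev norm
    the kernel multiplies a cubic expression in which the three frequencies sum to
    zero. The symmetries of [S] allow the average over cyclic permutations of the
    frequencies, and then the bound on the symbol distributes the derivatives so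
    that the third factor carries [1 + mu] of them, few enough to be summable
    since [s > mu + 3/2]. Hence [r' <= K * r ^+ 2] for the norm [r], with the
    constant [K] of the theorem ([energy_estimate]). If [r] is [rho] at time zero,
    it is at most [rho / (1 - K * rho * `|t|)] as long as this makes sense: that is
    the lifespan.

    For uniqueness, the same kind of symmetrisation gives an estimate of the
    difference of two solutions in [l2] ([difference_estimate]), to which
    Gronwall's lemma applies on finitely many modes with an error that vanishes
    as their number grows ([bounded_ode_unique]).

    Existence comes from the explicit Euler scheme for the truncated system. The
    scheme obeys the a priori bound up to a second order error, absorbed by a small
    step ([euler_step], [euler_bound]). At a fixed frequency the right-hand side
    is Lipschitz, so the polygons satisfy a Taylor inequality with a quadratic
    remainder ([euler_taylor]); both the bound and the inequality pass to the limit
    along an ultrafilter, and give a solution ([coef_existence]).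

    Continuity in time for the Sobolev norm follows from weak continuity and
    convergence of norms: restarting the flow at any time shows, by uniqueness,
    that the norm cannot jump up ([flow_restart], [strong_convergence]). The time
    derivative then exists in the norm of order [s - 1] by the mean value
    inequality ([flow_derivable]).

    Finally sequences and functions are exchanged: summable Hermitian sequences
    are the coefficients of the sum of their Fourier series ([fourier_synth]),
    weak derivatives multiply the coefficients by [i k] ([fourier_weak_deriv]), and
    the coefficients determine an integrable function almost everywhere
    ([fourier_unique]), because trigonometric polynomials approximate the indicator
    functions of arcs. *)

Notation cj := conjc.
Notation nc := ComplexField.Normc.normc.
Notation Rez := complex.Re.
Notation Imz := complex.Im.

(** * Complex modulus and sums over the integers *)

Section ComplexNorm.
Variable R : realType.
Implicit Types z w : R[i].

Lemma le_of_eq (x y : R) : x = y -> x <= y. Proof. by move=> ->. Qed.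

Lemma nc_ge0 z : 0 <= nc z.
Proof. by case: z => a b; exact: sqrtr_ge0. Qed.

Lemma nc_sqr z : nc z ^+ 2 = Rez z ^+ 2 + Imz z ^+ 2.
Proof. by case: z => a b /=; rewrite sqr_sqrtr// addr_ge0// sqr_ge0. Qed.

Lemma ncD z w : nc (z + w) <= nc z + nc w.
Proof. exact: le_normcD. Qed.

Lemma ncN z : nc (- z) = nc z.
Proof. exact: normcN. Qed.

Lemma ncB z w : nc (z - w) = nc (w - z).
Proof. by rewrite -ncN opprB. Qed.

Lemma ncM z w : nc (z * w) = nc z * nc w.
Proof. exact: ComplexField.Normc.normcM. Qed.

Lemma nc0 : nc (0 : R[i]) = 0.
Proof. exact: ComplexField.Normc.normc0. Qed.

Lemma nc_conj z : nc (cj z) = nc z.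
Proof. by case: z => a b /=; rewrite sqrrN. Qed.

Lemma nc_real (x : R) : nc (x%:C) = `|x|.
Proof. by rewrite /= expr0n/= addr0 sqrtr_sqr. Qed.

Lemma nc_i : nc ('i : R[i]) = 1.
Proof. by rewrite /= expr0n/= expr1n add0r sqrtr1. Qed.

Lemma nc_int (k : int) : nc (k%:~R : R[i]) = `|k|%:~R.
Proof.
rewrite -[X in nc X](rmorph_int (real_complex R)) nc_real.
by rewrite intr_norm.
Qed.

Lemma normRe_le z : `|Rez z| <= nc z.
Proof.
rewrite -(ler_pXn2r (n := 2)) ?nnegrE ?nc_ge0// nc_sqr -normrX ger0_norm ?sqr_ge0//.
by rewrite lerDl sqr_ge0.
Qed.

Lemma normIm_le z : `|Imz z| <= nc z.
Proof.
rewrite -(ler_pXn2r (n := 2)) ?nnegrE ?nc_ge0// nc_sqr -normrX ger0_norm ?sqr_ge0//.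
by rewrite lerDr sqr_ge0.
Qed.

Lemma nc_leReIm z : nc z <= `|Rez z| + `|Imz z|.
Proof.
rewrite -(ler_pXn2r (n := 2)) ?nnegrE ?nc_ge0 ?addr_ge0// nc_sqr.
rewrite -[Rez z ^+ 2]real_normK ?num_real// -[Imz z ^+ 2]real_normK ?num_real//.
by rewrite sqrrD; have := normr_ge0 (Rez z); have := normr_ge0 (Imz z); nra.
Qed.

Lemma nc_sum (I : Type) (s : seq I) (F : I -> R[i]) :
  nc (\sum_(i <- s) F i) <= \sum_(i <- s) nc (F i).
Proof.
elim: s => [|a s IH]; first by rewrite !big_nil nc0.
rewrite !big_cons; apply: (le_trans (ncD _ _)); by rewrite lerD2l.
Qed.

Lemma nc_dist z w : `|nc z - nc w| <= nc (z - w).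
Proof.
have h (u v : R[i]) : nc u - nc v <= nc (u - v).
  by rewrite lerBlDr; apply: le_trans (ncD _ _); rewrite subrK.
by rewrite ler_norml lerNl opprB h andbT ncB; exact: h.
Qed.

Lemma nc_eq0 z : nc z = 0 -> z = 0.
Proof. exact: ComplexField.Normc.eq0_normc. Qed.

Lemma RezD z w : Rez (z + w) = Rez z + Rez w.
Proof. by case: z; case: w. Qed.
Lemma ImzD z w : Imz (z + w) = Imz z + Imz w.
Proof. by case: z; case: w. Qed.
Lemma RezN z : Rez (- z) = - Rez z. Proof. by case: z. Qed.
Lemma ImzN z : Imz (- z) = - Imz z. Proof. by case: z. Qed.
Lemma Rez_sum (I : Type) (s : seq I) (F : I -> R[i]) :
  Rez (\sum_(i <- s) F i) = \sum_(i <- s) Rez (F i).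
Proof. by elim: s => [|a s IH]; rewrite ?big_nil// !big_cons RezD IH. Qed.
Lemma Imz_sum (I : Type) (s : seq I) (F : I -> R[i]) :
  Imz (\sum_(i <- s) F i) = \sum_(i <- s) Imz (F i).
Proof. by elim: s => [|a s IH]; rewrite ?big_nil// !big_cons ImzD IH. Qed.
Lemma RezM z w : Rez (z * w) = Rez z * Rez w - Imz z * Imz w.
Proof. by case: z; case: w. Qed.
Lemma ImzM z w : Imz (z * w) = Rez z * Imz w + Imz z * Rez w.
Proof. by case: z; case: w. Qed.
Lemma RezC z : Rez (cj z) = Rez z. Proof. by case: z. Qed.
Lemma ImzC z : Imz (cj z) = - Imz z. Proof. by case: z. Qed.
Lemma complex_ext z w : Rez z = Rez w -> Imz z = Imz w -> z = w.
Proof. by case: z; case: w => a b c d /= -> ->. Qed.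
Lemma RezZ (a : R) z : Rez (a%:C * z) = a * Rez z.
Proof. by rewrite RezM mul0r subr0. Qed.
Lemma ImzZ (a : R) z : Imz (a%:C * z) = a * Imz z.
Proof. by rewrite ImzM mul0r addr0. Qed.
Lemma conjcD z w : cj (z + w) = cj z + cj w.
Proof. by apply: complex_ext; rewrite !(RezC, ImzC, RezD, ImzD)// opprD. Qed.
Lemma conjcB z w : cj (z - w) = cj z - cj w.
Proof. by apply: complex_ext; rewrite !(RezC, ImzC, RezN, ImzN, RezD, ImzD) ?opprD. Qed.
Lemma conjcM z w : cj (z * w) = cj z * cj w.
Proof.
by apply: complex_ext; rewrite !(RezC, ImzC, RezM, ImzM); ring.
Qed.
Lemma conjcK' z : cj (cj z) = z.
Proof. by apply: complex_ext; rewrite !(RezC, ImzC)// opprK. Qed.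
Lemma conjc_sum (I : Type) (s : seq I) (F : I -> R[i]) :
  cj (\sum_(i <- s) F i) = \sum_(i <- s) cj (F i).
Proof.
elim: s => [|a s IH]; last first.
  by rewrite big_cons conjcD [X in _ + X]IH [in RHS]big_cons.
by rewrite !big_nil; apply: complex_ext; rewrite ?(RezC, ImzC)//= oppr0.
Qed.

Lemma nc_sqrD z w :
  nc (z + w) ^+ 2 = nc z ^+ 2 + 2 * Rez (cj z * w) + nc w ^+ 2.
Proof. rewrite !nc_sqr RezD ImzD RezM RezC ImzC; ring. Qed.

End ComplexNorm.

Section Box.

Definition box (N : nat) : seq int :=
  [seq j%:Z - N%:Z | j <- index_iota 0 (2 * N).+1].

Global Arguments box : simpl never.

Lemma mem_box N k : (k \in box N) = (`|k| <= N)%N.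
Proof.
apply/mapP/idP => [[j]|hk].
  by rewrite mem_index_iota => hj ->; lia.
exists (absz (k + N%:Z)%R); first by rewrite mem_index_iota; lia.
lia.
Qed.

Lemma uniq_box N : uniq (box N).
Proof.
rewrite map_inj_uniq ?iota_uniq// => i j; lia.
Qed.

Lemma box_opp N : perm_eq (box N) (map -%R (box N)).
Proof.
apply: uniq_perm; first exact: uniq_box.
  by rewrite map_inj_uniq ?uniq_box//; exact: oppr_inj.
move=> k; rewrite -[k in RHS]opprK mem_map; last exact: oppr_inj.
by rewrite !mem_box abszN.
Qed.

Lemma sum_boxN (V : nmodType) N (F : int -> V) :
  \sum_(k <- box N) F (- k) = \sum_(k <- box N) F k.
Proof. by rewrite [RHS](perm_big _ (box_opp N)) [RHS]big_map. Qed.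

Lemma sum_box_delta (V : nmodType) (s : seq int) (a : int) (F : int -> V) :
  uniq s ->
  \sum_(k <- s) (if k == a then F k else 0) = if a \in s then F a else 0.
Proof.
move=> us; case: ifPn => ha.
  rewrite (bigD1_seq a)//= eqxx big1 ?addr0// => i /negbTE ->//.
rewrite -big_mkcond/= big1_seq// => k /andP[/eqP ->]; by rewrite (negbTE ha).
Qed.

Lemma box_sub N M : (N <= M)%N -> {subset box N <= box M}.
Proof. by move=> NM k; rewrite !mem_box => /leq_trans; apply. Qed.

Lemma sum_box_restr (V : nmodType) L M (F : int -> V) : (L <= M)%N ->
  \sum_(k <- box L) F k = \sum_(k <- box M) (if k \in box L then F k else 0).
Proof.
move=> LM; rewrite -[RHS]big_mkcond/= -[RHS]big_filter; apply: perm_big.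
apply: uniq_perm; rewrite ?filter_uniq ?uniq_box// => k.
by rewrite mem_filter; case: (boolP (k \in box L)) => //= /(box_sub LM).
Qed.

Variable R : realType.
Implicit Types x y : int -> R.

Lemma le_sum_sub (s t : seq int) x : uniq s -> {subset s <= t} ->
  (forall k, 0 <= x k) -> \sum_(k <- s) x k <= \sum_(k <- t) x k.
Proof.
move=> us st x0.
have hp : perm_eq s [seq k <- undup t | k \in s].
  apply: uniq_perm => //; first by rewrite filter_uniq ?undup_uniq.
  move=> k; rewrite mem_filter mem_undup.
  by case: (boolP (k \in s)) => // /st ->.
have uu : uniq (undup t) by exact: undup_uniq.
rewrite (perm_big _ hp) big_filter big_mkcond/=.
apply: (@le_trans _ _ (\sum_(k <- undup t) x k)).
  by apply: ler_sum => k _; case: ifP.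
elim: t {st uu hp} => //= a t IH; case: ifP => _; rewrite !big_cons ?lerD2l//.
by rewrite (le_trans IH)// lerDr.
Qed.

Lemma sub_box_of (s : seq int) : exists N, {subset s <= box N}.
Proof.
elim: s => [|a s [N IH]]; first by exists 0%N.
exists (maxn `|a|%N N) => k; rewrite in_cons => /orP[/eqP->|/IH].
  by rewrite mem_box leq_maxl.
by rewrite !mem_box => /leq_trans; apply; rewrite leq_maxr.
Qed.

(** For a nonnegative family this bounds all finite subsums, so that the bound is
    inherited by injective reindexings of the integers. *)
Definition sumle x (B : R) := forall N, \sum_(k <- box N) x k <= B.

Lemma sumle_seq x B (s : seq int) : sumle x B -> (forall k, 0 <= x k) ->
  uniq s -> \sum_(k <- s) x k <= B.
Proof.
move=> xB x0 us; have [N sN] := sub_box_of s.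
by apply: le_trans (xB N); apply: le_sum_sub.
Qed.

Lemma sumle_inj x B (s : seq int) (h : int -> int) :
  sumle x B -> (forall k, 0 <= x k) ->
  uniq s -> injective h -> \sum_(k <- s) x (h k) <= B.
Proof.
move=> xB x0 us hi; have := sumle_seq (s := map h s) xB x0.
by rewrite big_map map_inj_uniq//; apply.
Qed.

Lemma sumle_reflect x B k : sumle x B -> (forall k, 0 <= x k) ->
  sumle (fun n => x (k - n)) B.
Proof.
move=> xB x0 N; apply: (sumle_inj xB x0 (uniq_box N)) => a b.
by move=> /addrI/oppr_inj.
Qed.

Lemma sumle_ge0 x B : sumle x B -> (forall k, 0 <= x k) -> 0 <= B.
Proof. by move=> xB x0; apply: le_trans (xB 0%N); apply: sumr_ge0. Qed.

Lemma sumle_term x B k : sumle x B -> (forall k, 0 <= x k) -> x k <= B.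
Proof.
by move=> xB x0; have := sumle_seq (s := [:: k]) xB x0 isT; rewrite big_seq1.
Qed.

Lemma le_sumle x y B : (forall k, x k <= y k) -> sumle y B -> sumle x B.
Proof. by move=> xy yB N; apply: le_trans (yB N); apply: ler_sum. Qed.

Lemma sumleZ x B a : 0 <= a -> sumle x B -> sumle (fun k => a * x k) (a * B).
Proof. by move=> a0 xB N; rewrite -mulr_sumr ler_wpM2l. Qed.

Lemma sumleD x y A B : sumle x A -> sumle y B ->
  sumle (fun k => x k + y k) (A + B).
Proof. by move=> xB yB N; rewrite big_split/= lerD. Qed.

Lemma sumle_le x A B : A <= B -> sumle x A -> sumle x B.
Proof. by move=> AB xA N; apply: le_trans AB. Qed.

(** Cauchy--Schwarz without square roots. Having [p] and [q] as data allows
    weighted versions: Young's inequality uses [c = a * b] with [p = a ^+ 2 * b]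
    and [q = b]. *)
Lemma cauchy_schwarz (I : Type) (s : seq I) (c p q : I -> R) :
  (forall i, 0 <= p i) -> (forall i, 0 <= q i) ->
  (forall i, c i ^+ 2 <= p i * q i) ->
  (\sum_(i <- s) c i) ^+ 2 <= (\sum_(i <- s) p i) * (\sum_(i <- s) q i).
Proof.
move=> p0 q0 cpq; elim: s => [|a s IH]; first by rewrite !big_nil mul0r expr0n.
rewrite !big_cons.
set c1 := c a; set p1 := p a; set q1 := q a.
have hp1 : 0 <= p1 := p0 a. have hq1 : 0 <= q1 := q0 a.
have hc1 : c1 ^+ 2 <= p1 * q1 := cpq a.
set X := \sum_(j <- s) c j in IH *; set P := \sum_(j <- s) p j in IH *.
set Q := \sum_(j <- s) q j in IH *.
have hP : 0 <= P by apply: sumr_ge0.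
have hQ : 0 <= Q by apply: sumr_ge0.
have key : 2 * (c1 * X) <= p1 * Q + P * q1.
  have h0 : 0 <= p1 * Q + P * q1 by rewrite addr_ge0// mulr_ge0.
  apply: le_trans (ler_norm _) _.
  rewrite -(ler_pXn2r (n := 2)) ?nnegrE// -normrX ger0_norm ?sqr_ge0//.
  have : (c1 * X) ^+ 2 <= (p1 * q1) * (P * Q).
    by rewrite exprMn ler_pM// sqr_ge0.
  have : 0 <= (p1 * Q - P * q1) ^+ 2 by exact: sqr_ge0.
  nra.
nra.
Qed.

End Box.

(** * Complex limits and bilateral series *)

Section ComplexLimits.
Variable R : realType.

Definition ccvg (T : Type) (F : set_system T) (z : T -> R[i]) (l : R[i]) : Prop :=
  nc (z x - l) @[x --> F] --> (0 : R).

Section AnyFilter.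
Variables (T : topologicalType) (F : set_system T).
Context {FF : ProperFilter F}.
Implicit Types (z w : T -> R[i]) (l m : R[i]) (e : T -> R).

Lemma squeeze0 (f e : T -> R) :
  (\forall x \near F, 0 <= f x <= e x) -> e x @[x --> F] --> (0 : R) ->
  f x @[x --> F] --> (0 : R).
Proof.
move=> h he; apply: (squeeze_cvgr h) he; exact: (cvg_cst (0 : R)).
Qed.

Lemma cvg_sumr (I : Type) (s : seq I) (f : I -> T -> R) (l : I -> R) :
  (forall i, f i x @[x --> F] --> l i) ->
  \sum_(i <- s) f i x @[x --> F] --> \sum_(i <- s) l i.
Proof.
move=> h; elim: s => [|a s IH].
  by under eq_fun do rewrite big_nil; rewrite big_nil; exact: cvg_cst.
by under eq_fun do rewrite big_cons; rewrite big_cons; exact: cvgD.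
Qed.

Lemma ccvg_squeeze z l e :
  (\forall x \near F, nc (z x - l) <= e x) -> e x @[x --> F] --> (0 : R) ->
  ccvg F z l.
Proof.
move=> h; apply: squeeze0; apply: filterS h => x ->; by rewrite nc_ge0.
Qed.

Lemma eq_ccvg z w l : z =1 w -> ccvg F z l -> ccvg F w l.
Proof. by move=> /funext ->. Qed.

Lemma ccvg_cst l : ccvg F (fun=> l) l.
Proof. by rewrite /ccvg; under eq_cvg do rewrite subrr nc0; exact: cvg_cst. Qed.

Lemma ccvgD z w l m : ccvg F z l -> ccvg F w m ->
  ccvg F (fun x => z x + w x) (l + m).
Proof.
move=> zl wm; apply: (@ccvg_squeeze _ _ (fun x => nc (z x - l) + nc (w x - m))).
  by apply: nearW => x; rewrite opprD addrACA ncD.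
by rewrite -[0]addr0; exact: cvgD.
Qed.

Lemma ccvgZ a z l : ccvg F z l -> ccvg F (fun x => a * z x) (a * l).
Proof.
move=> zl; apply: (@ccvg_squeeze _ _ (fun x => nc a * nc (z x - l))).
  by apply: nearW => x; rewrite -mulrBr ncM.
by rewrite -[0](mulr0 (nc a)); apply: cvgM => //; exact: cvg_cst.
Qed.

Lemma ccvgN z l : ccvg F z l -> ccvg F (fun x => - z x) (- l).
Proof.
move=> zl; apply: ccvg_squeeze zl; apply: nearW => x.
by rewrite -opprD ncN.
Qed.

Lemma ccvg_conj z l : ccvg F z l -> ccvg F (fun x => cj (z x)) (cj l).
Proof.
move=> zl; apply: ccvg_squeeze zl; apply: nearW => x.
by rewrite -conjcB nc_conj.
Qed.

Lemma ccvg_nc z l : ccvg F z l -> nc (z x) @[x --> F] --> nc l.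
Proof.
move=> zl; apply/cvgrPdist_lt => e e0; move/cvgrPdist_lt : zl => /(_ _ e0).
apply: filterS => x; rewrite sub0r normrN ger0_norm ?nc_ge0//.
by apply: le_lt_trans; rewrite distrC nc_dist.
Qed.

Lemma ccvgM z w l m : ccvg F z l -> ccvg F w m ->
  ccvg F (fun x => z x * w x) (l * m).
Proof.
move=> zl wm.
apply: (@ccvg_squeeze _ _ (fun x => nc (z x) * nc (w x - m) + nc m * nc (z x - l))).
  apply: nearW => x; rewrite -!ncM.
  have -> : z x * w x - l * m = z x * (w x - m) + m * (z x - l) by ring.
  exact: ncD.
have -> : (0 : R) = nc l * 0 + nc m * 0 by rewrite !mulr0 addr0.
apply: cvgD; apply: cvgM => //; [exact: ccvg_nc|exact: cvg_cst].
Qed.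

Lemma ccvg_sum (I : Type) (s : seq I) (z : I -> T -> R[i]) (l : I -> R[i]) :
  (forall i, ccvg F (z i) (l i)) ->
  ccvg F (fun x => \sum_(i <- s) z i x) (\sum_(i <- s) l i).
Proof.
move=> h; elim: s => [|a s IH].
  by rewrite big_nil; apply: eq_ccvg (ccvg_cst 0) => x; rewrite big_nil.
by rewrite big_cons; apply: eq_ccvg (ccvgD (h a) IH) => x; rewrite big_cons.
Qed.

Lemma ccvg_le z l e (b : R) : ccvg F z l -> e x @[x --> F] --> b ->
  (\forall x \near F, nc (z x) <= e x) -> nc l <= b.
Proof. by move=> /ccvg_nc zl eb; exact: ler_cvg_to. Qed.

Lemma ccvg_unique z l m : ccvg F z l -> ccvg F z m -> l = m.
Proof.
move=> /ccvgN zl zm.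
have : nc (- l + m) <= 0.
  apply: (ccvg_le (ccvgD zl zm)); first exact: (cvg_cst (0:R)).
  by apply: nearW => x; rewrite addNr nc0.
move=> h; have /nc_eq0/eqP : nc (- l + m) = 0.
  by apply/eqP; rewrite eq_le h nc_ge0.
by rewrite addrC subr_eq0 => /eqP ->.
Qed.

Lemma ccvg_ReIm z l : Rez (z x) @[x --> F] --> Rez l ->
  Imz (z x) @[x --> F] --> Imz l -> ccvg F z l.
Proof.
move=> h1 h2.
apply: (@ccvg_squeeze _ _ (fun x => `|Rez (z x) - Rez l| + `|Imz (z x) - Imz l|)).
  by apply: nearW => x; rewrite -RezN -ImzN -RezD -ImzD nc_leReIm.
rewrite -[0]addr0; apply: cvgD.
  rewrite -(normr0 R) -(subrr (Rez l)); apply: cvg_norm; apply: cvgB => //.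
  exact: cvg_cst.
rewrite -(normr0 R) -(subrr (Imz l)); apply: cvg_norm; apply: cvgB => //.
exact: cvg_cst.
Qed.

Lemma ccvg_Re z l : ccvg F z l -> Rez (z x) @[x --> F] --> Rez l.
Proof.
move=> zl; apply/cvgrPdist_lt => e e0; move/cvgrPdist_lt : zl => /(_ _ e0).
apply: filterS => x; rewrite sub0r normrN ger0_norm ?nc_ge0//.
by apply: le_lt_trans; rewrite distrC -RezN -RezD normRe_le.
Qed.

Lemma ccvg_Im z l : ccvg F z l -> Imz (z x) @[x --> F] --> Imz l.
Proof.
move=> zl; apply/cvgrPdist_lt => e e0; move/cvgrPdist_lt : zl => /(_ _ e0).
apply: filterS => x; rewrite sub0r normrN ger0_norm ?nc_ge0//.
by apply: le_lt_trans; rewrite distrC -ImzN -ImzD normIm_le.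
Qed.

End AnyFilter.

Implicit Types (f g : int -> R[i]) (l m : R[i]).

Lemma zsumE f l : zsum f l <-> ccvg \oo (fun N => \sum_(k <- box N) f k) l.
Proof.
have -> : (fun N => \sum_(k <- box N) f k) =
    (fun N => \sum_(0 <= j < (2 * N).+1) f (j%:Z - N%:Z)).
  by apply/funext => N; rewrite big_map.
by [].
Qed.

Lemma zsum_unique f l m : zsum f l -> zsum f m -> l = m.
Proof. by move=> /zsumE + /zsumE; exact: ccvg_unique. Qed.

Lemma eq_zsum f g l : f =1 g -> zsum f l -> zsum g l.
Proof.
by move=> /funext ->.
Qed.

Lemma sumle_cvg (x : int -> R) A : (forall k, 0 <= x k) -> sumle x A ->
  cvgn (fun N => \sum_(k <- box N) x k).
Proof.
move=> x0 xA; apply: nondecreasing_is_cvgn.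
  by move=> n m nm; apply: le_sum_sub => //; [exact: uniq_box|exact: box_sub].
by exists A => _ [N _ <-]; exact: xA.
Qed.

Lemma abs_sum_cvg (x y : int -> R) A : (forall k, `|x k| <= y k) -> sumle y A ->
  cvgn (fun N => \sum_(k <- box N) x k).
Proof.
move=> xy yA.
have -> : (fun N => \sum_(k <- box N) x k) =
    (fun N => \sum_(k <- box N) (x k + y k)) \- (fun N => \sum_(k <- box N) y k).
  by apply/funext => N /=; rewrite big_split/= addrK.
have y0 k : 0 <= y k by apply: le_trans (xy k).
apply: is_cvgB; last exact: sumle_cvg yA.
apply: (@sumle_cvg _ (A + A)).
  by move=> k; have := xy k; rewrite ler_norml => /andP[h _]; rewrite -lerBlDr sub0r.
apply: sumleD => //; apply: le_sumle yA => k.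
exact: le_trans (ler_norm _) (xy k).
Qed.

Definition zlim f : R[i] := xget 0 [set l | zsum f l].

Lemma zlim_zsum f A : sumle (fun k => nc (f k)) A -> zsum f (zlim f).
Proof.
move=> fA; rewrite /zlim; case: xgetP => [l -> //|/=].
have /cvg_ex[a ha] := abs_sum_cvg (fun k => normRe_le (f k)) fA.
have /cvg_ex[b hb] := abs_sum_cvg (fun k => normIm_le (f k)) fA.
move=> /(_ (a +i* b)); case; apply/zsumE; apply: ccvg_ReIm => /=.
  by under eq_fun do rewrite Rez_sum.
by under eq_fun do rewrite Imz_sum.
Qed.

Lemma zsum_le f l (A : R) : zsum f l -> sumle (fun k => nc (f k)) A -> nc l <= A.
Proof.
move=> /zsumE fl fA; apply: (ccvg_le fl); first exact: (cvg_cst A).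
by apply: nearW => N; exact: le_trans (nc_sum _ _) (fA N).
Qed.

Lemma zsumD f g l m : zsum f l -> zsum g m -> zsum (fun k => f k + g k) (l + m).
Proof.
move=> /zsumE fl /zsumE gm; apply/zsumE.
by apply: eq_ccvg (ccvgD fl gm) => N; rewrite big_split.
Qed.

Lemma zsumZ f l a : zsum f l -> zsum (fun k => a * f k) (a * l).
Proof.
move=> /zsumE fl; apply/zsumE.
by apply: eq_ccvg (ccvgZ a fl) => N; rewrite mulr_sumr.
Qed.

(** Replaces an infinite sum by a finite one with an explicit error. *)
Lemma zsum_tail f l L (A : R) : zsum f l ->
  (forall M, (L <= M)%N ->
     \sum_(k <- box M) (if k \in box L then 0 else nc (f k)) <= A) ->
  nc (l - \sum_(k <- box L) f k) <= A.
Proof.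
move=> /zsumE fl h.
have h1 : ccvg \oo (fun M => \sum_(k <- box M) f k - \sum_(k <- box L) f k)
    (l - \sum_(k <- box L) f k) by apply: ccvgD => //; exact: ccvg_cst.
apply: (ccvg_le h1); first exact: (cvg_cst A).
exists L => // M /= LM; apply: le_trans (h M LM).
rewrite (sum_box_restr f LM) -sumrB.
apply: le_trans (nc_sum _ _) _; apply: ler_sum => k _.
by case: ifP => _; rewrite ?subrr ?nc0 ?subr0.
Qed.

End ComplexLimits.

Section Psum.
Variable R : realType.
Implicit Types x : int -> R.

Definition psum x : R := sup [set \sum_(k <- box N) x k | N in [set: nat]].

Lemma psum_sumle x A : sumle x A -> sumle x (psum x).
Proof.
move=> xA N; apply: ub_le_sup; last by exists N.
by exists A => _ [M _ <-]; exact: xA.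
Qed.

End Psum.

(** * Sobolev weights *)

Section Derivable.
Variable R : realType.

Lemma is_derive_continuous (f : R -> R) (x d : R) : is_derive x 1 f d ->
  {for x, continuous f}.
Proof.
move=> h; apply: differentiable_continuous; apply/derivable1_diffP.
exact: ex_derive.
Qed.

End Derivable.

Section Weights.
Variable R : realType.
Implicit Types (s r p q : R) (k m n : int).

Definition W s k : R := `|k|%:~R `^ s.

Lemma W_ge0 s k : 0 <= W s k. Proof. exact: powR_ge0. Qed.

Lemma WN s k : W s (- k) = W s k. Proof. by rewrite /W normrN. Qed.

Lemma W0 s : s != 0 -> W s 0 = 0.
Proof. by move=> s0; rewrite /W normr0 powR0. Qed.

Lemma int_ge1 k : k != 0 -> 1 <= `|k|%:~R :> R.
Proof. by move=> k0; rewrite ler1z; lia. Qed.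

Lemma W_ge1 s k : k != 0 -> 0 <= s -> 1 <= W s k.
Proof. by move=> k0 s0; rewrite -(powRr0 (`|k|%:~R)) ler_powR ?int_ge1. Qed.

Lemma WD s r k : k != 0 -> W (s + r) k = W s k * W r k.
Proof.
move=> k0; rewrite /W powRD//; apply/implyP => _.
by rewrite intr_eq0 normr_eq0.
Qed.

Lemma W1 k : W 1 k = `|k|%:~R.
Proof. by rewrite /W powRr1// ler0z. Qed.

Lemma W2 s k : W (2 * s) k = W s k ^+ 2.
Proof. by rewrite /W mulrC powRrM powR_mulrn// powR_ge0. Qed.

Lemma le_W s r k : k != 0 -> s <= r -> W s k <= W r k.
Proof. by move=> k0 sr; rewrite /W ler_powR ?int_ge1. Qed.

(** One of the frequencies [k - n] and [n] is at least half of [k]: the weight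
    can always be carried by one of two interacting frequencies. *)
Lemma W_add s k n : 0 <= s -> W s k <= 2 `^ s * (W s (k - n) + W s n).
Proof.
move=> s0; have h (m : int) : (`|k| <= 2 * `|m|)%R -> W s k <= 2 `^ s * W s m.
  move=> km; rewrite /W -powRM ?ler0z// ge0_ler_powR ?nnegrE ?mulr_ge0 ?ler0z//.
  by rewrite -[2]/(2%:~R) -intrM ler_int.
have [le|lt] := leP `|k - n| `|n|.
  apply: le_trans (h n _) _; first by lia.
  by rewrite ler_wpM2l ?powR_ge0// lerDr W_ge0.
apply: le_trans (h (k - n) _) _; first by lia.
by rewrite ler_wpM2l ?powR_ge0// lerDl W_ge0.
Qed.

Lemma is_derive_powRN q (x : R) : 0 < x ->
  is_derive x 1 (fun y => y `^ (- q)) (- q * x `^ (- q - 1)).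
Proof.
move=> x0; have xi : x \in `]0, +oo[ by rewrite in_itv/= x0.
have := powR_derive1 (- q) xi; rewrite derive1E => <-.
by apply: DeriveDef => //; exact: derivable_powR.
Qed.

(** Mean value theorem. The right-hand sides telescope when summed over [n],
    which gives the convergence of the series in [Mconst]. *)
Lemma powR_telescope q (n : nat) : 0 < q -> (0 < n)%N ->
  n.+1%:R `^ (- (q + 1)) <= q^-1 * (n%:R `^ (- q) - n.+1%:R `^ (- q)) :> R.
Proof.
move=> q0 n0; have nR : 0 < n%:R :> R by rewrite ltr0n.
have lt : n%:R < n.+1%:R :> R by rewrite ltr_nat.
have hd (x : R) : x \in `]n%:R, n.+1%:R[ ->
    is_derive x 1 (fun y => y `^ (- q)) (- q * x `^ (- q - 1)).
  by rewrite in_itv/= => /andP[h _]; apply: is_derive_powRN; exact: lt_trans h.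
have hc : {within `[n%:R : R, n.+1%:R], continuous (fun y => y `^ (- q))}.
  apply: continuous_in_subspaceT => x; rewrite inE/= in_itv/= => /andP[h _].
  exact: is_derive_continuous (is_derive_powRN q (lt_le_trans nR h)).
have [c] := MVT lt hd hc.
rewrite in_itv/= => /andP[nc cn] h.
have c0 : 0 < c by apply: lt_trans nc.
rewrite -opprB h -natr1 addrAC subrr add0r mulr1 mulNr opprK mulrA mulVf ?gt_eqF// mul1r.
rewrite -opprD !powRN lef_pV2 ?posrE ?powR_gt0//.
by rewrite ge0_ler_powR ?nnegrE ?ler0n ?addr_ge0 ?(ltW q0) ?(ltW c0)// natr1 ltW.
Qed.

Lemma zeta_partial p (N : nat) : 1 < p ->
  \sum_(1 <= n < N.+1) n%:R `^ (- p) <= 1 + (p - 1)^-1 :> R.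
Proof.
move=> p1; have q0 : 0 < p - 1 by rewrite subr_gt0.
case: N => [|N]; first by rewrite big_geq// addr_ge0// invr_ge0 ltW.
suff: \sum_(1 <= n < N.+2) n%:R `^ (- p) <=
    1 + (p - 1)^-1 * (1 - N.+1%:R `^ (- (p - 1))) :> R.
  by move/le_trans; apply; rewrite lerD2l ger_pMr ?invr_gt0// gerBl powR_ge0.
elim: N => [|N IH]; first by rewrite big_nat1 !powR1 subrr mulr0 addr0.
rewrite big_nat_recr//=; apply: le_trans (lerD IH (lexx _)) _.
have := @powR_telescope (p - 1) N.+1 q0 isT; rewrite subrK => h.
by rewrite -addrA lerD2l -lerBrDl -mulrBr; apply: le_trans h _; apply: le_of_eq; ring.
Qed.

Lemma box_S N : perm_eq (box N.+1) ([:: N.+1%:Z; (- N.+1%:Z : int)] ++ box N).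
Proof.
apply: uniq_perm; first exact: uniq_box.
  rewrite cat_uniq uniq_box andbT; apply/andP; split => //.
  by apply/hasPn => k; rewrite mem_box !inE; lia.
by move=> k; rewrite mem_cat !mem_box !inE; lia.
Qed.

Lemma sum_box_even (x : int -> R) N : (forall k, x (- k) = x k) ->
  \sum_(k <- box N) x k = x 0 + 2 * \sum_(1 <= n < N.+1) x n%:Z.
Proof.
move=> xe; elim: N => [|N IH].
  by rewrite [X in 2 * X]big_geq// mulr0 addr0 /box /= big_seq1.
rewrite (perm_big _ (box_S N)) big_cat big_cons big_seq1 IH [in RHS]big_nat_recr//= xe.
ring.
Qed.

Lemma Mconst_ge0 r : 0 <= Mconst r.
Proof. exact: sqrtr_ge0. Qed.

Lemma Mconst_sumle r : 1 / 2 < r -> sumle (W (- (2 * r))) (Mconst r ^+ 2).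
Proof.
move=> r2; have p1 : 1 < 2 * r by lra.
have h0 (n : nat) : (1 <= n)%N -> xpredT n -> (0 <= (n%:R `^ (- (2 * r)) : R)%:E)%E.
  by move=> _ _; rewrite lee_fin powR_ge0.
set S := (\sum_(1 <= n <oo) (n%:R `^ (- (2 * r)) : R)%:E)%E.
have S0 : (0 <= S)%E by apply: nneseries_ge0.
have Sfin : S \is a fin_num.
  rewrite ge0_fin_numE//; apply: (@le_lt_trans _ _ (1 + (2 * r - 1)^-1)%:E); last exact: ltry.
  apply: lime_le; first exact: is_cvg_nneseries.
  apply: nearW => -[|N]; first by rewrite big_geq// lee_fin addr_ge0// invr_ge0; lra.
  by rewrite sumEFin lee_fin zeta_partial.
have -> : Mconst r ^+ 2 = 2 * fine S.
  by rewrite /Mconst sqr_sqrtr// mulr_ge0// fine_ge0.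
move=> N; rewrite sum_box_even; last by move=> k; rewrite WN.
rewrite W0 ?add0r; last by rewrite oppr_eq0 gt_eqF// (lt_trans _ p1).
rewrite ler_pM2l//.
rewrite -lee_fin fineK// -sumEFin; exact: (nneseries_lim_ge N.+1 h0).
Qed.

(** Cauchy--Schwarz against the weight [W (r - s)]: the source of the constant
    [Mconst] in the lifespan. *)
Lemma sumle_l1 (a : int -> R) s r B : (forall k, 0 <= a k) -> a 0 = 0 ->
  0 <= B -> 1 / 2 < s - r -> sumle (fun k => (W s k * a k) ^+ 2) (B ^+ 2) ->
  sumle (fun k => W r k * a k) (Mconst (s - r) * B).
Proof.
move=> a0 a00 B0 sr aB N.
have hle : 0 <= \sum_(k <- box N) W r k * a k.
  by apply: sumr_ge0 => k _; rewrite mulr_ge0// W_ge0.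
rewrite -(ler_pXn2r (n := 2)) ?nnegrE ?mulr_ge0 ?Mconst_ge0//.
apply: (le_trans (@cauchy_schwarz R _ _ _ (W (- (2 * (s - r))))
   (fun k => (W s k * a k) ^+ 2) _ _ _)).
- by move=> k; exact: W_ge0.
- by move=> k; exact: sqr_ge0.
- move=> k; have [->|k0] := eqVneq k 0; first by rewrite a00 !mulr0 expr0n mulr0.
  rewrite !exprMn -!W2 [leRHS]mulrA -WD//.
  by have -> : - (2 * (s - r)) + 2 * s = 2 * r by ring.
rewrite exprMn ler_pM//; try by apply: sumr_ge0 => k _; rewrite ?W_ge0 ?sqr_ge0.
exact: Mconst_sumle.
Qed.

End Weights.

(** * Rearrangement of absolutely convergent series *)

Section Rearrangement.
Variable R : realType.

Lemma sumle_tail (x : int -> R) A (e : R) : (forall k, 0 <= x k) -> sumle x A -> 0 < e ->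
  exists L, forall t : seq int, uniq t ->
    (forall k, k \in t -> k \notin box L) -> \sum_(k <- t) x k <= e.
Proof.
move=> x0 xA e0.
have hs : has_sup [set \sum_(k <- box N) x k | N in [set: nat]].
  by split; [exists (\sum_(k <- box 0) x k), 0%N|exists A => _ [M _ <-]; exact: xA].
have [_ [L _ <-] hL] := sup_adherent e0 hs.
exists L => t ut tL.
have ucat : uniq (box L ++ t).
  by rewrite cat_uniq uniq_box ut andbT/=; apply/hasPn => k /tL.
have := sumle_seq (psum_sumle xA) x0 ucat.
rewrite big_cat => h; rewrite -(lerD2l (\sum_(k <- box L) x k)).
apply: le_trans h _; rewrite -lerBlDr; exact: ltW.
Qed.

Lemma sum_split_box (V : nmodType) (f : int -> V) (t : seq int) L :
  uniq t -> {subset box L <= t} ->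
  \sum_(k <- t) f k = \sum_(k <- box L) f k + \sum_(k <- [seq j <- t | j \notin box L]) f k.
Proof.
move=> ut Lt; rewrite (bigID (fun k => k \in box L)) /=.
rewrite -big_filter -[X in _ + X = _]big_filter; congr (_ + _).
apply: perm_big; apply: uniq_perm; rewrite ?filter_uniq ?uniq_box// => k.
by rewrite mem_filter; case: (boolP (k \in box L)) => //= /Lt ->.
Qed.

(** A reindexing does not preserve the boxes, but absolute convergence makes all
    large finite sums close to the limit, whatever their shape. *)
Lemma zsum_reindex (f : int -> R[i]) l A (h h' : int -> int) :
  sumle (fun k => nc (f k)) A -> cancel h h' -> cancel h' h ->
  zsum f l -> zsum (f \o h) l.
Proof.
move=> fA hK h'K /zsumE fl; apply/zsumE.
rewrite /ccvg; apply/cvgrPdist_le => e e0.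
have f0 k : 0 <= nc (f k) by exact: nc_ge0.
have e2 : 0 < e / 2 by rewrite divr_gt0.
have [L hL] := sumle_tail f0 fA e2.
have tailL t : uniq t -> {subset box L <= t} ->
    nc (\sum_(k <- t) f k - \sum_(k <- box L) f k) <= e / 2.
  move=> ut Lt; rewrite (sum_split_box f ut Lt) addrAC subrr add0r.
  apply: le_trans (nc_sum _ _) _; apply: hL; first by rewrite filter_uniq.
  by move=> k; rewrite mem_filter => /andP[].
have lL : nc (l - \sum_(k <- box L) f k) <= e / 2.
  have h1 : ccvg \oo (fun M => \sum_(k <- box M) f k - \sum_(k <- box L) f k)
      (l - \sum_(k <- box L) f k) by apply: ccvgD => //; exact: ccvg_cst.
  apply: (ccvg_le h1); first exact: cvg_cst.
  by exists L => // M /= LM; apply: tailL; [exact: uniq_box|exact: box_sub].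
have [N hN] := sub_box_of (map h' (box L)).
exists N => // M /= NM; rewrite sub0r normrN ger0_norm ?nc_ge0//.
have -> : \sum_(k <- box M) (f \o h) k = \sum_(k <- map h (box M)) f k.
  by rewrite [RHS]big_map.
have -> : \sum_(k <- map h (box M)) f k - l =
   (\sum_(k <- map h (box M)) f k - \sum_(k <- box L) f k) -
   (l - \sum_(k <- box L) f k) by ring.
apply: le_trans (ncD _ _) _; rewrite ncN.
have -> : e = e / 2 + e / 2 by field.
apply: lerD => //; apply: tailL.
  by rewrite map_inj_uniq ?uniq_box//; exact: can_inj hK.
move=> k kL; apply/mapP; exists (h' k); last by rewrite h'K.
by apply: (box_sub NM); apply: hN; apply: map_f.
Qed.

Lemma zlimE (f : int -> R[i]) l : zsum f l -> zlim f = l.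
Proof.
move=> fl; rewrite /zlim; case: xgetP => [m -> /=|/(_ l)//].
by move=> /(zsum_unique fl).
Qed.

Lemma zlim_fin (f : int -> R[i]) N : (forall k, k \notin box N -> f k = 0) ->
  zlim f = \sum_(k <- box N) f k.
Proof.
move=> f0; apply: zlimE; apply/zsumE.
apply: (@ccvg_squeeze _ _ _ _ _ _ (fun=> 0)); last exact: cvg_cst.
exists N => // M /= NM; rewrite (sum_box_restr f NM) -sumrB big1 ?nc0// => k _.
by case: ifPn => [|/f0 ->]; rewrite subrr.
Qed.

End Rearrangement.

(** * Sobolev balls of coefficients and convolution *)

Section Sequences.
Variable R : realType.
Implicit Types (c y z : int -> R[i]) (s r B : R).

(** The Sobolev ball in terms of coefficients. The radius is an argument, so
    that estimates can be stated before any norm is known to be finite. *)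
Definition hseq s c B : Prop :=
  [/\ 0 <= B, c 0 = 0 & sumle (fun k => (W s k * nc (c k)) ^+ 2) (B ^+ 2)].

Definition herm c : Prop := forall k, c (- k) = cj (c k).

Lemma hseq_l1 s r c B : 1 / 2 < s - r -> hseq s c B ->
  sumle (fun k => W r k * nc (c k)) (Mconst (s - r) * B).
Proof.
move=> sr [B0 c0 cB]; apply: (@sumle_l1 R (fun k => nc (c k))) => //.
  by move=> k; exact: nc_ge0.
by rewrite c0 nc0.
Qed.

Lemma hseq_term s c B k : 0 <= s -> hseq s c B -> W s k * nc (c k) <= B.
Proof.
move=> s0 [B0 c0 cB].
rewrite -(ler_pXn2r (n := 2)) ?nnegrE ?mulr_ge0 ?W_ge0 ?nc_ge0//.
by apply: (@sumle_term R _ _ k cB) => m; exact: sqr_ge0.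
Qed.

Lemma hseq_sup s c B k : 0 <= s -> hseq s c B -> nc (c k) <= B.
Proof.
move=> s0 h; have [->|k0] := eqVneq k 0; first by case: h => B0 -> _; rewrite nc0.
by apply: le_trans (hseq_term k s0 h); rewrite ler_peMl ?nc_ge0// W_ge1.
Qed.

Lemma hseqW s r c B : r <= s -> hseq s c B -> hseq r c B.
Proof.
move=> rs [B0 c0 cB]; split=> //; apply: le_sumle cB => k.
have [->|k0] := eqVneq k 0; first by rewrite c0 nc0 !mulr0.
by rewrite ler_pXn2r ?nnegrE ?mulr_ge0 ?W_ge0 ?nc_ge0// ler_wpM2r ?nc_ge0// le_W.
Qed.

Lemma hseq_l2 s c B : 0 <= s -> hseq s c B -> sumle (fun k => nc (c k) ^+ 2) (B ^+ 2).
Proof.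
move=> s0 [B0 c0 cB]; apply: le_sumle cB => k.
have [->|k0] := eqVneq k 0; first by rewrite c0 nc0 !mulr0.
by rewrite ler_pXn2r ?nnegrE ?mulr_ge0 ?W_ge0 ?nc_ge0// ler_peMl ?nc_ge0// W_ge1.
Qed.

Lemma hseq_le s c A B : A <= B -> hseq s c A -> hseq s c B.
Proof.
move=> AB [A0 c0 cA]; split=> //; first exact: le_trans AB.
by apply: sumle_le cA; rewrite ler_pXn2r ?nnegrE// (le_trans A0).
Qed.

Lemma hseqD s y z A B : hseq s y A -> hseq s z B ->
  hseq s (fun k => y k + z k) (A + B).
Proof.
move=> [A0 y0 yA] [B0 z0 zB]; split; rewrite ?addr_ge0 ?y0 ?z0 ?addr0//.
move=> N.
pose p k := W s k * nc (y k); pose q k := W s k * nc (z k).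
have p0 k : 0 <= p k by rewrite mulr_ge0 ?W_ge0 ?nc_ge0.
have q0 k : 0 <= q k by rewrite mulr_ge0 ?W_ge0 ?nc_ge0.
have hpq : \sum_(k <- box N) p k * q k <= A * B.
  have h0 : 0 <= \sum_(k <- box N) p k * q k by apply: sumr_ge0 => k _; rewrite mulr_ge0.
  rewrite -(ler_pXn2r (n := 2)) ?nnegrE ?mulr_ge0//.
  apply: (le_trans (@cauchy_schwarz R _ _ _ (fun k => p k ^+ 2) (fun k => q k ^+ 2) _ _ _)).
  - by move=> k; exact: sqr_ge0.
  - by move=> k; exact: sqr_ge0.
  - by move=> k; rewrite exprMn.
  by rewrite exprMn ler_pM ?yA ?zB//; apply: sumr_ge0 => k _; exact: sqr_ge0.
apply: (@le_trans _ _ (\sum_(k <- box N) (p k ^+ 2 + q k ^+ 2 + 2 * (p k * q k)))).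
  apply: ler_sum => k _.
  have -> : p k ^+ 2 + q k ^+ 2 + 2 * (p k * q k) = (p k + q k) ^+ 2 by ring.
  rewrite ler_pXn2r ?nnegrE ?addr_ge0 ?mulr_ge0 ?W_ge0 ?nc_ge0//.
  by rewrite -mulrDr ler_wpM2l ?W_ge0// ncD.
rewrite !big_split/= -mulr_sumr.
have -> : (A + B) ^+ 2 = A ^+ 2 + B ^+ 2 + 2 * (A * B) by ring.
by rewrite !lerD ?yA ?zB// ler_pM2l.
Qed.

Lemma hseqZ s y A (a : R[i]) : hseq s y A -> hseq s (fun k => a * y k) (nc a * A).
Proof.
move=> [A0 y0 yA]; split; rewrite ?mulr_ge0 ?nc_ge0 ?y0 ?mulr0//.
move=> N; rewrite exprMn.
have -> : \sum_(k <- box N) (W s k * nc (a * y k)) ^+ 2 =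
   nc a ^+ 2 * \sum_(k <- box N) (W s k * nc (y k)) ^+ 2.
  by rewrite mulr_sumr; apply: eq_bigr => k _; rewrite ncM; ring.
by rewrite ler_wpM2l// sqr_ge0.
Qed.

Lemma hseqN s y A : hseq s y A -> hseq s (fun k => - y k) A.
Proof.
move=> [A0 y0 yA]; split; rewrite ?y0 ?oppr0//; apply: le_sumle yA => k.
by rewrite ncN.
Qed.

Lemma hseqB s y z A B : hseq s y A -> hseq s z B ->
  hseq s (fun k => y k - z k) (A + B).
Proof. by move=> hy /hseqN hz; exact: hseqD. Qed.

Lemma sumle_conv (y z : int -> R) A B k : 0 <= A -> 0 <= B ->
  (forall k, 0 <= y k) -> (forall k, 0 <= z k) ->
  sumle (fun k => y k ^+ 2) (A ^+ 2) -> sumle (fun k => z k ^+ 2) (B ^+ 2) ->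
  sumle (fun n => y (k - n) * z n) (A * B).
Proof.
move=> A0 B0 y0 z0 yA zB N.
have h0 : 0 <= \sum_(n <- box N) y (k - n) * z n.
  by apply: sumr_ge0 => n _; rewrite mulr_ge0.
rewrite -(ler_pXn2r (n := 2)) ?nnegrE ?mulr_ge0//.
apply: (le_trans (@cauchy_schwarz R _ _ _ (fun n => y (k - n) ^+ 2) (fun n => z n ^+ 2) _ _ _)).
- by move=> n; exact: sqr_ge0.
- by move=> n; exact: sqr_ge0.
- by move=> n; rewrite exprMn.
rewrite exprMn ler_pM ?zB//; try by apply: sumr_ge0 => n _; exact: sqr_ge0.
by apply: (sumle_reflect k yA) => m; exact: sqr_ge0.
Qed.

(** Young's inequality for the convolution of [l2] and [l1]: Cauchy--Schwarz
    with the [l1] factor as a weight, then summation over [k] first. *)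
Lemma young (x y : int -> R) X Y L N :
  (forall k, 0 <= x k) -> (forall k, 0 <= y k) -> 0 <= Y ->
  sumle (fun k => x k ^+ 2) (X ^+ 2) -> sumle y Y ->
  \sum_(k <- box N) (\sum_(n <- box L) x (k - n) * y n) ^+ 2 <= (X * Y) ^+ 2.
Proof.
move=> x0 y0 Y0 xX yY.
apply: (@le_trans _ _ (\sum_(k <- box N) (\sum_(n <- box L) x (k - n) ^+ 2 * y n) * Y)).
  apply: ler_sum => k _.
  apply: (le_trans (@cauchy_schwarz R _ _ _ (fun n => x (k - n) ^+ 2 * y n) y _ _ _)).
  - by move=> n; rewrite mulr_ge0// sqr_ge0.
  - by [].
  - by move=> n; rewrite [leRHS](_ : _ = (x (k - n) * y n) ^+ 2)//; ring.
  by rewrite ler_wpM2l// sumr_ge0// => n _; rewrite mulr_ge0// sqr_ge0.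
rewrite -mulr_suml exchange_big/= exprMn [Y ^+ 2]expr2 mulrA ler_wpM2r//.
apply: (@le_trans _ _ (\sum_(n <- box L) X ^+ 2 * y n)).
  apply: ler_sum => n _; rewrite -mulr_suml ler_wpM2r//.
  apply: (@sumle_inj R (fun k => x k ^+ 2) _ (box N) (fun k => k - n)) => //.
  - by move=> m; exact: sqr_ge0.
  - exact: uniq_box.
  - by move=> a b /addIr.
by rewrite -mulr_sumr ler_wpM2l ?sqr_ge0.
Qed.

Lemma young_sym (x y : int -> R) X Y L N :
  (forall k, 0 <= x k) -> (forall k, 0 <= y k) -> 0 <= Y ->
  sumle (fun k => x k ^+ 2) (X ^+ 2) -> sumle y Y ->
  \sum_(k <- box N) (\sum_(n <- box L) y (k - n) * x n) ^+ 2 <= (X * Y) ^+ 2.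
Proof.
move=> x0 y0 Y0 xX yY.
apply: (@le_trans _ _ (\sum_(k <- box N) (\sum_(n <- box L) y (k - n) * x n ^+ 2) * Y)).
  apply: ler_sum => k _.
  apply: (le_trans (@cauchy_schwarz R _ _ _ (fun n => y (k - n) * x n ^+ 2) (fun n => y (k - n)) _ _ _)).
  - by move=> n; rewrite mulr_ge0// sqr_ge0.
  - by [].
  - by move=> n; rewrite [leRHS](_ : _ = (y (k - n) * x n) ^+ 2)//; ring.
  rewrite ler_wpM2l ?sumr_ge0// => [n _|]; first by rewrite mulr_ge0// sqr_ge0.
  exact: (sumle_reflect k yY).
rewrite -mulr_suml exchange_big/= exprMn [Y ^+ 2]expr2 mulrA ler_wpM2r//.
apply: (@le_trans _ _ (\sum_(n <- box L) Y * x n ^+ 2)).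
  apply: ler_sum => n _; rewrite -mulr_suml ler_wpM2r ?sqr_ge0//.
  apply: (@sumle_inj R y _ (box N) (fun k => k - n)) => //; first exact: uniq_box.
  by move=> a b /addIr.
by rewrite -mulr_sumr mulrC ler_wpM2r.
Qed.

End Sequences.

(** * The quadratic form on Fourier coefficients *)

Section Kernel.
Variable R : realType.
Implicit Types (S : int -> int -> int -> R[i]) (y z w c d : int -> R[i]).

(** The growth bound is recorded for the first frequency only; the
    symmetries transfer it to the two others. *)
Record kernel (mu C : R) S : Prop := Kernel {
  ker_mu : 0 <= mu;
  ker_C : 0 <= C;
  ker_zero : forall k m n : int, k * m * n = 0 -> S k m n = 0;
  ker_conj : forall k m n : int, S k m n = cj (S (- k) (- m) (- n));
  ker_swap : forall k m n : int, S k m n = S k n m;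
  ker_rot : forall k m n : int, S k m n = S m n k;
  ker_le : forall k m n : int, nc (S k m n) <= C * W mu k }.

Definition qterm S y z (k n : int) : R[i] := S (- k) (k - n) n * y (k - n) * z n.
Definition quad S y z k : R[i] := zlim (qterm S y z k).
(** The equation on the Fourier side reads [c' = burgers S c]: for a constant
    kernel it is the inviscid Burgers equation. *)
Definition burgers S y (k : int) : R[i] := - ('i * k%:~R) * quad S y y k.

Section Fixed.
Variables (mu C : R) (S : int -> int -> int -> R[i]).
Hypothesis kS : kernel mu C S.
Let mu0 := ker_mu kS.
Let C0 := ker_C kS.
Local Notation Q := (qterm S).

Lemma ker_le2 k m n : nc (S k m n) <= C * W mu m.
Proof. by rewrite (ker_rot kS); exact: (ker_le kS). Qed.
Lemma ker_le3 k m n : nc (S k m n) <= C * W mu n.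
Proof. by rewrite (ker_swap kS); exact: ker_le2. Qed.
Lemma qterm_le1 y z k n : nc (Q y z k n) <= C * W mu k * (nc (y (k - n)) * nc (z n)).
Proof.
rewrite /qterm !ncM -mulrA ler_wpM2r ?mulr_ge0 ?nc_ge0//.
by have := ker_le kS (- k) (k - n) n; rewrite WN.
Qed.
Lemma qterm_le2 y z k n : nc (Q y z k n) <= C * (W mu (k - n) * nc (y (k - n)) * nc (z n)).
Proof.
rewrite [leRHS](_ : _ = C * W mu (k - n) * (nc (y (k - n)) * nc (z n))); last by ring.
by rewrite /qterm !ncM -mulrA ler_wpM2r ?mulr_ge0 ?nc_ge0// ker_le2.
Qed.
Lemma qterm_le3 y z k n : nc (Q y z k n) <= C * (nc (y (k - n)) * (W mu n * nc (z n))).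
Proof.
rewrite [leRHS](_ : _ = C * W mu n * (nc (y (k - n)) * nc (z n))); last by ring.
by rewrite /qterm !ncM -mulrA ler_wpM2r ?mulr_ge0 ?nc_ge0// ker_le3.
Qed.

Lemma qterm_sumle s y z A B k : 0 <= s -> hseq s y A -> hseq s z B ->
  sumle (fun n => nc (Q y z k n)) (C * W mu k * (A * B)).
Proof.
move=> s0 hy hz; have [A0 _ _] := hy; have [B0 _ _] := hz.
apply: (le_sumle (fun n => qterm_le1 y z k n)).
apply: sumleZ; first by rewrite mulr_ge0// W_ge0.
apply: (@sumle_conv R (fun k => nc (y k)) (fun k => nc (z k))) => //;
  try by move=> ?; exact: nc_ge0.
- exact: hseq_l2 hy.
- exact: hseq_l2 hz.
Qed.

Lemma quad_zsum s y z A B k : 0 <= s -> hseq s y A -> hseq s z B ->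
  zsum (Q y z k) (quad S y z k).
Proof. by move=> s0 hy hz; apply: zlim_zsum; apply: qterm_sumle hy hz. Qed.

Lemma qtermC y z k n : Q y z k (k - n) = Q z y k n.
Proof. by rewrite /qterm opprB addrC subrK (ker_swap kS) -mulrA [y n * _]mulrC mulrA. Qed.

Lemma quad_zsumC s y z A B k : 0 <= s -> hseq s y A -> hseq s z B ->
  zsum (Q z y k) (quad S y z k).
Proof.
move=> s0 hy hz.
have hK : cancel (fun n : int => k - n) (fun n : int => k - n).
  by move=> n; rewrite opprB addrC subrK.
have h := zsum_reindex (qterm_sumle k s0 hy hz) hK hK (quad_zsum k s0 hy hz).
by apply: eq_zsum h => n /=; rewrite qtermC.
Qed.

Lemma quadC s y z A B k : 0 <= s -> hseq s y A -> hseq s z B ->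
  quad S y z k = quad S z y k.
Proof. by move=> s0 hy hz; rewrite {2}/quad (zlimE (quad_zsumC k s0 hy hz)). Qed.

(** A difference of squares: since [S] is symmetric in its last two arguments,
    the two mixed terms cancel. *)
Lemma quadBD s y z A B k : 0 <= s -> hseq s y A -> hseq s z B ->
  quad S y y k - quad S z z k = quad S (fun k => y k - z k) (fun k => y k + z k) k.
Proof.
move=> s0 hy hz; symmetry; apply: zlimE.
have h := zsumD (quad_zsum k s0 hy hy) (quad_zsum k s0 hy hz).
have := zsumD h (zsumZ (-1) (zsumD (quad_zsum k s0 hz hy) (quad_zsum k s0 hz hz))).
rewrite (quadC k s0 hy hz) !mulN1r opprD addrA addrK.
by apply: eq_zsum => n; rewrite /qterm; ring.
Qed.

Lemma quad_conj s y z A B k : 0 <= s -> hseq s y A -> hseq s z B ->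
  herm y -> herm z -> quad S y z (- k) = cj (quad S y z k).
Proof.
move=> s0 hy hz Hy Hz; apply: zlimE.
have hK : cancel (fun n : int => - n) (fun n : int => - n) by exact: opprK.
have := zsum_reindex (qterm_sumle k s0 hy hz) hK hK (quad_zsum k s0 hy hz).
move=> /zsumE h; apply/zsumE; apply: eq_ccvg (ccvg_conj h) => N.
rewrite conjc_sum; apply: eq_bigr => n _ /=.
by rewrite /qterm !conjcM -Hy -Hz (ker_conj kS) !opprD !opprK conjcK'.
Qed.

Lemma burgers_herm s y A : 0 <= s -> hseq s y A -> herm y -> herm (burgers S y).
Proof.
move=> s0 hy Hy k; rewrite /burgers (quad_conj k s0 hy hy Hy Hy) conjcM.
congr (_ * _); rewrite -!(rmorph_int (real_complex R)) rmorphN.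
by apply: complex_ext => /=; rewrite !(mul0r, mulr0, mul1r, oppr0, subr0, add0r, opprK).
Qed.

Lemma burgers0 y : burgers S y 0 = 0.
Proof. by rewrite /burgers mulr0 oppr0 mul0r. Qed.

Lemma nc_ik (k : int) : nc (- ('i * k%:~R) : R[i]) = W 1 k.
Proof. by rewrite ncN ncM nc_i nc_int mul1r W1. Qed.

End Fixed.
End Kernel.

(** * Energy, product and Lipschitz estimates *)

Section TripleSums.

(** In the form of a sum over triples of total frequency zero, the three
    frequencies play the same part and can be permuted cyclically. *)
Definition tsum (V : nmodType) N (G : int -> int -> int -> V) : V :=
  \sum_(k <- box N) \sum_(m <- box N) \sum_(n <- box N)
    (if k + m + n == 0 then G k m n else 0).

Lemma tsum_rot (V : nmodType) N (G : int -> int -> int -> V) :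
  tsum N (fun k m n => G m n k) = tsum N G.
Proof.
rewrite /tsum exchange_big/=; apply: eq_bigr => m _.
rewrite exchange_big/=; apply: eq_bigr => n _; apply: eq_bigr => k _.
by rewrite -addrA addrC.
Qed.

Lemma tsumD (V : nmodType) N (G H : int -> int -> int -> V) :
  tsum N (fun k m n => G k m n + H k m n) = tsum N G + tsum N H.
Proof.
rewrite /tsum -big_split; apply: eq_bigr => k _.
rewrite -big_split; apply: eq_bigr => m _.
rewrite -big_split; apply: eq_bigr => n _.
by case: (k + m + n == 0) => /=; rewrite ?addr0.
Qed.

(** The convolution ties the third frequency to the two others. Where it leaves
    the box the summand vanishes, so the truncation of a sequence supported in
    the box costs nothing. *)
Lemma tsum_double (V : nmodType) N (G : int -> int -> int -> V) :
  (forall k m n, m \notin box N -> G k m n = 0) ->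
  \sum_(k <- box N) \sum_(n <- box N) G k (- k - n) n = tsum N G.
Proof.
move=> G0; apply: eq_bigr => k _; rewrite [RHS]exchange_big/=.
apply: eq_bigr => n _.
rewrite (eq_bigr (fun m => if m == - k - n then G k m n else 0)); last first.
  by move=> m _; congr (if _ then _ else _); lia.
by rewrite (sum_box_delta _ _ (uniq_box N)); case: ifPn => // /G0.
Qed.

Variable R : realType.

Lemma le_tsum N (G H : int -> int -> int -> R) :
  (forall k m n, k + m + n = 0 -> G k m n <= H k m n) -> tsum N G <= tsum N H.
Proof.
move=> GH; apply: ler_sum => k _; apply: ler_sum => m _; apply: ler_sum => n _.
by case: ifP => // /eqP /GH.
Qed.

Lemma tsumZ N (a : R) (G : int -> int -> int -> R) :
  tsum N (fun k m n => a * G k m n) = a * tsum N G.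
Proof.
rewrite /tsum mulr_sumr; apply: eq_bigr => k _.
rewrite mulr_sumr; apply: eq_bigr => m _; rewrite mulr_sumr.
by apply: eq_bigr => n _; case: ifP => _; rewrite ?mulr0.
Qed.

Lemma nc_tsum N (G : int -> int -> int -> R[i]) :
  nc (tsum N G) <= tsum N (fun k m n => nc (G k m n)).
Proof.
apply: le_trans (nc_sum _ _) _; apply: ler_sum => k _.
apply: le_trans (nc_sum _ _) _; apply: ler_sum => m _.
apply: le_trans (nc_sum _ _) _; apply: ler_sum => n _.
by case: ifP => _ //; rewrite nc0.
Qed.

Lemma tsum_le (x g : int -> R) N B A : 0 <= B ->
  (forall k, 0 <= x k) -> (forall k, 0 <= g k) ->
  sumle (fun k => x k ^+ 2) (B ^+ 2) -> sumle g A ->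
  tsum N (fun k m n => x k * x m * g n) <= A * B ^+ 2.
Proof.
move=> B0 x0 g0 xB gA; rewrite -tsum_rot.
apply: (@le_trans _ _ (\sum_(n <- box N) g n * B ^+ 2)); last first.
  by rewrite -mulr_suml ler_wpM2r// sqr_ge0.
apply: ler_sum => n _.
apply: (@le_trans _ _ (g n * \sum_(k <- box N) x (- n - k) * x k)); last first.
  rewrite ler_wpM2l// expr2.
  exact: (@sumle_conv R x x B B (- n)).
rewrite mulr_sumr; apply: ler_sum => k _.
rewrite (eq_bigr (fun m => if m == - n - k then x k * x m * g n else 0)); last first.
  by move=> m _; congr (if _ then _ else _); lia.
rewrite (sum_box_delta _ _ (uniq_box N)).
have h : 0 <= g n * (x (- n - k) * x k) by rewrite !mulr_ge0.
by case: ifP => _ //; apply: le_of_eq; ring.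
Qed.

End TripleSums.

Section Estimates.
Variable R : realType.
Variables (mu C : R) (S : int -> int -> int -> R[i]).
Hypothesis kS : kernel mu C S.
Let mu0 := ker_mu kS.
Let C0 := ker_C kS.
Implicit Types (y z w c d : int -> R[i]) (s A B : R).

Lemma symbol_bound_ge0 s Cs : symbol_bound s Cs -> 0 <= Cs.
Proof.
move=> h; have := h 1 1 (- (1 + 1)); rewrite subrr => /(_ erefl).
move=> /(le_trans (normr_ge0 _)).
rewrite normr1 normrN [`|1 + 1|]ger0_norm ?addr_ge0//.
by rewrite pmulr_lge0// !addr_gt0// !mulr_gt0// powR_gt0.
Qed.

Lemma W1mu k : W (R := R) (1 + mu) k = `|k|%:~R * W mu k.
Proof.
have [->|k0] := eqVneq k 0; last by rewrite WD// W1.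
by rewrite normr0 mul0r W0// gt_eqF// ltr_wpDr.
Qed.

(** The energy estimate, with the sharp constant. The sum is invariant under
    cyclic permutation of the frequencies, hence equals the average of its three
    rotations; the averaged symbol [k * W s k ^+ 2 + m * W s m ^+ 2 +
    n * W s n ^+ 2] is bounded by a sum of three products in which no frequency
    carries more than [s] derivatives. In each product the kernel is charged to
    the frequency that carries a single derivative, whose factor is summable; the
    three resulting sums are equal, which cancels the factor 3 of the average. *)
Lemma energy_estimate s Cs y N B :
  symbol_bound s Cs -> 1 / 2 < s - mu - 1 -> hseq s y B -> herm y ->
  (forall k, k \notin box N -> y k = 0) ->
  `|\sum_(k <- box N) W s k ^+ 2 * Rez (cj (y k) * burgers S y k)|
    <= C * Cs * Mconst (s - mu - 1) * B ^+ 3.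
Proof.
move=> hCs sr hy Hy y0; have Cs0 := symbol_bound_ge0 hCs.
have [B0 y00 yB] := hy.
pose G (k m n : int) := ((W s k ^+ 2)%:C * ('i * k%:~R)) * (S k m n * (y k * y m * y n)).
pose Z := \sum_(k <- box N) (W s k ^+ 2)%:C * (cj (y k) * burgers S y k).
have ZE : Z = tsum N G.
  rewrite /Z -sum_boxN -tsum_double; last by move=> k m n /y0 ym; rewrite /G ym !(mulr0, mul0r).
  apply: eq_bigr => k _.
  rewrite /burgers /quad (@zlim_fin _ _ N); last by move=> n /y0 yn; rewrite /qterm yn mulr0.
  rewrite WN Hy conjcK' !mulr_sumr; apply: eq_bigr => n _.
  rewrite /G /qterm opprK [(- k)%:~R]rmorphN/=.
  ring.
pose g k := W (1 + mu) k * nc (y k); pose x k := W s k * nc (y k).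
have gE k : g k = `|k|%:~R * W mu k * nc (y k) by rewrite /g W1mu.
pose H (k m n : int) := x k * x m * g n.
have x0 k : 0 <= x k by rewrite mulr_ge0 ?W_ge0 ?nc_ge0.
have g0 k : 0 <= g k by rewrite mulr_ge0 ?W_ge0 ?nc_ge0.
have HB : tsum N H <= Mconst (s - mu - 1) * B * B ^+ 2.
  apply: tsum_le => //.
  have -> : s - mu - 1 = s - (1 + mu) by ring.
  apply: (@hseq_l1 R s (1 + mu) y B _ hy); lra.
have Z3 : 3 * nc Z <= C * Cs * (tsum N H + tsum N H + tsum N H).
  have -> : 3 * nc Z = nc (tsum N (fun k m n => G k m n + G m n k + G n k m)).
    rewrite !tsumD.
    have -> : tsum N (fun k m n => G n k m) = Z.
      by rewrite ZE -(tsum_rot N G); exact: (tsum_rot N (fun k m n => G m n k)).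
    have -> : tsum N (fun k m n => G m n k) = Z by rewrite ZE; exact: tsum_rot.
    have -> : tsum N (fun k m n => G k m n) = Z by rewrite ZE.
    have -> : Z + Z + Z = 3%:R * Z by ring.
    by rewrite ncM; have /= := nc_int R 3 => ->.
  apply: le_trans (nc_tsum _ _) _.
  have -> : tsum N H + tsum N H + tsum N H =
      tsum N (fun k m n => H k m n + H n k m + H m n k).
    rewrite !tsumD; congr (_ + _ + _); last by rewrite -(tsum_rot N H).
    by rewrite -(tsum_rot N H); exact/esym/(tsum_rot N (fun k m n => H m n k)).
  rewrite -tsumZ.
  apply: le_tsum => k m n kmn.
  have -> : G k m n + G m n k + G n k m =
      ((k%:~R * W s k ^+ 2 + m%:~R * W s m ^+ 2 + n%:~R * W s n ^+ 2 : R)%:C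
        * 'i) * (S k m n * (y k * y m * y n)).
    rewrite /G -(ker_rot kS k m n) (ker_rot kS n k m).
    rewrite !rmorphD !rmorphM !(rmorph_int (real_complex R)); ring.
  rewrite !ncM nc_i mulr1 nc_real.
  have := hCs k%:~R m%:~R n%:~R; rewrite -!intrD kmn => /(_ erefl).
  rewrite -!intr_norm -!/(W _ _) !W2.
  set P := `|_ + _ + _|; move=> hP.
  apply: (le_trans (ler_wpM2r _ hP)); first by rewrite !mulr_ge0 ?nc_ge0.
  have hh (a b e : int) T : T <= C * W mu e ->
      W s a * W s b * `|e|%:~R * (T * (nc (y a) * nc (y b) * nc (y e))) <= C * H a b e.
    move=> hT; rewrite /H gE /x.
    rewrite [leLHS](_ : _ = T * (W s a * W s b * `|e|%:~R * (nc (y a) * nc (y b) * nc (y e)))); last by ring.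
    rewrite [leRHS](_ : _ = C * W mu e * (W s a * W s b * `|e|%:~R * (nc (y a) * nc (y b) * nc (y e)))); last by ring.
    by rewrite ler_wpM2r// !mulr_ge0 ?W_ge0 ?nc_ge0// ler0z.
  have h1 := hh k m n _ (ker_le3 kS k m n).
  have h2 := hh n k m _ (ker_le2 kS k m n).
  have h3 := hh m n k _ (ker_le kS k m n).
  rewrite [leLHS](_ : _ = Cs * (
     W s k * W s m * `|n|%:~R * (nc (S k m n) * (nc (y k) * nc (y m) * nc (y n))) +
     W s n * W s k * `|m|%:~R * (nc (S k m n) * (nc (y n) * nc (y k) * nc (y m))) +
     W s m * W s n * `|k|%:~R * (nc (S k m n) * (nc (y m) * nc (y n) * nc (y k)))));
    last by ring.
  rewrite [leRHS](_ : _ = Cs * (C * H k m n + C * H n k m + C * H m n k)); last by ring.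
  by rewrite ler_wpM2l// !lerD.
have -> : \sum_(k <- box N) W s k ^+ 2 * Rez (cj (y k) * burgers S y k) = Rez Z.
  by rewrite Rez_sum; apply: eq_bigr => k _; rewrite [RHS]RezM/= mul0r subr0.
apply: le_trans (normRe_le _) _.
have hZ : nc Z <= C * Cs * tsum N H.
  by rewrite -(ler_pM2l (x := 3))//; apply: le_trans Z3 _; apply: le_of_eq; ring.
apply: le_trans hZ _.
rewrite [leRHS](_ : _ = C * Cs * (Mconst (s - mu - 1) * B * B ^+ 2)); last by ring.
by rewrite ler_wpM2l// mulr_ge0.
Qed.

Definition quad_const s : R := C * 2 `^ s * 2 * Mconst (s - mu).

Lemma quad_const_ge0 s : 0 <= quad_const s.
Proof. by rewrite /quad_const !mulr_ge0 ?powR_ge0 ?Mconst_ge0. Qed.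

(** The Sobolev space is an algebra for the bilinear form. By [W_add] the weight
    falls on one of the two interacting frequencies; the kernel is charged to the
    other one, which is then summable, and Young's inequality applies. The bound
    is proved for the partial sums of the convolution and passed to the limit. *)
Lemma hseq_quad s y z A B : 0 <= s -> 1 / 2 < s - mu -> hseq s y A -> hseq s z B ->
  hseq s (quad S y z) (quad_const s * A * B).
Proof.
move=> s0 sr hy hz; have [A0 _ _] := hy; have [B0 _ _] := hz.
split; first exact: mulr_ge0 (mulr_ge0 (quad_const_ge0 s) A0) B0.
  rewrite /quad (@zlim_fin _ _ 0%N) ?big1//.
    by move=> n _; rewrite /qterm (ker_zero kS) ?mul0r// oppr0 !mul0r.
  by move=> n _; rewrite /qterm (ker_zero kS) ?mul0r// oppr0 !mul0r.
set M := Mconst (s - mu).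
have M0 : 0 <= M := Mconst_ge0 _.
pose a s y n := W (R := R) s n * nc (y n).
have a0 r (u : int -> R[i]) n : 0 <= a r u n by rewrite mulr_ge0 ?W_ge0 ?nc_ge0.
pose X y z L k := \sum_(n <- box L) a s y (k - n) * a mu z n.
pose Y y z L k := \sum_(n <- box L) a mu y (k - n) * a s z n.
have X0 u v L k : 0 <= X u v L k by apply: sumr_ge0 => n _; rewrite mulr_ge0.
have Y0 u v L k : 0 <= Y u v L k by apply: sumr_ge0 => n _; rewrite mulr_ge0.
have pt L k : W s k * nc (\sum_(n <- box L) qterm S y z k n) <=
    C * 2 `^ s * (X y z L k + Y y z L k).
  apply: (@le_trans _ _ (W s k * \sum_(n <- box L) nc (qterm S y z k n))).
    by rewrite ler_wpM2l ?W_ge0// nc_sum.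
  rewrite -big_split/= !mulr_sumr; apply: ler_sum => n _.
  apply: (le_trans (ler_wpM2r (nc_ge0 _) (W_add k n s0))).
  rewrite [leLHS](_ : _ = (W s (k - n) * nc (qterm S y z k n) +
     W s n * nc (qterm S y z k n)) * 2 `^ s); last by ring.
  rewrite [leRHS](_ : _ =
     (W s (k - n) * (C * (nc (y (k - n)) * (W mu n * nc (z n)))) +
      W s n * (C * (W mu (k - n) * nc (y (k - n)) * nc (z n)))) * 2 `^ s);
    last by rewrite /a; ring.
  rewrite ler_wpM2r ?powR_ge0// lerD// ler_wpM2l ?W_ge0//.
    exact: (qterm_le3 kS).
  exact: (qterm_le2 kS).
have bd N L : \sum_(k <- box N) (W s k * nc (\sum_(n <- box L) qterm S y z k n)) ^+ 2
    <= (quad_const s * A * B) ^+ 2.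
  apply: (@le_trans _ _ (\sum_(k <- box N) (C * 2 `^ s) ^+ 2 *
      (2 * X y z L k ^+ 2 + 2 * Y y z L k ^+ 2))).
    apply: ler_sum => k _.
    apply: (@le_trans _ _ ((C * 2 `^ s * (X y z L k + Y y z L k)) ^+ 2)).
      by rewrite ler_pXn2r ?nnegrE ?mulr_ge0 ?W_ge0 ?nc_ge0 ?powR_ge0 ?addr_ge0.
    rewrite exprMn ler_wpM2l ?sqr_ge0//.
    by have := sqr_ge0 (X y z L k - Y y z L k); nra.
  rewrite -mulr_sumr big_split/= -!mulr_sumr.
  have hX : \sum_(k <- box N) X y z L k ^+ 2 <= (A * (M * B)) ^+ 2.
    apply: young => //; first by rewrite mulr_ge0.
      by case: hy.
    exact: hseq_l1.
  have hY : \sum_(k <- box N) Y y z L k ^+ 2 <= (B * (M * A)) ^+ 2.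
    apply: young_sym => //; first by rewrite mulr_ge0.
      by case: hz.
    exact: hseq_l1.
  rewrite [leRHS](_ : _ = (C * 2 `^ s) ^+ 2 *
     (2 * (A * (M * B)) ^+ 2 + 2 * (B * (M * A)) ^+ 2)); last by rewrite /quad_const -/M; ring.
  by rewrite ler_wpM2l ?sqr_ge0// lerD// ler_wpM2l.
move=> N.
have hc k : nc (\sum_(n <- box L) qterm S y z k n) @[L --> \oo] --> nc (quad S y z k).
  by apply: ccvg_nc; apply/zsumE; exact: (quad_zsum kS k s0 hy hz).
have hs : \sum_(k <- box N) (W s k * nc (\sum_(n <- box L) qterm S y z k n)) ^+ 2
    @[L --> \oo] --> \sum_(k <- box N) (W s k * nc (quad S y z k)) ^+ 2.
  apply: cvg_sumr => k; rewrite expr2.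
  under eq_fun do rewrite expr2.
  by apply: cvgM; apply: cvgM => //; exact: cvg_cst.
apply: (ler_cvg_to hs (cvg_cst _)).
by apply: nearW => L; exact: bd.
Qed.

Lemma hseq_burgers s y A : 0 <= s -> 1 / 2 < s - mu -> hseq s y A ->
  hseq (s - 1) (burgers S y) (quad_const s * A * A).
Proof.
move=> s0 sr hy; have [h0 hq0 hq] := hseq_quad s0 sr hy hy.
split => //; first exact: burgers0.
apply: le_sumle hq => k.
have [->|k0] := eqVneq k 0; first by rewrite burgers0 nc0 mulr0 expr0n sqr_ge0.
by rewrite /burgers ncM nc_ik mulrA -WD// subrK.
Qed.

(** At a fixed output frequency the right-hand side depends on the coefficients
    in a Lipschitz way for the supremum norm: no derivative is lost, only a factor
    that depends on [k]. *)
Lemma burgers_lip s y z A B (d a b : R) k : 0 <= s -> hseq s y A -> hseq s z B ->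
  (forall n, nc (y n - z n) <= d) ->
  sumle (fun n => nc (y n)) a -> sumle (fun n => nc (z n)) b ->
  nc (burgers S y k - burgers S z k) <= C * W (1 + mu) k * (d * (a + b)).
Proof.
move=> s0 hy hz hd ya zb.
have d0 : 0 <= d by apply: le_trans (hd 0); exact: nc_ge0.
rewrite /burgers -mulrBr ncM nc_ik.
have h := zsumD (quad_zsum kS k s0 hy hy) (zsumZ (-1) (quad_zsum kS k s0 hz hz)).
rewrite mulN1r in h.
have hb : nc (quad S y y k - quad S z z k) <= C * W mu k * (d * (a + b)).
  apply: (zsum_le h).
  apply: (@le_sumle _ _ (fun n => C * W mu k * (d * (nc (y n) + nc (z (k - n)))))).
    move=> n; rewrite [X in nc X](_ : _ =
      S (- k) (k - n) n * ((y (k - n) - z (k - n)) * y n + z (k - n) * (y n - z n)));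
      last by rewrite /qterm; ring.
    rewrite ncM ler_pM ?nc_ge0//; first by have := ker_le kS (- k) (k - n) n; rewrite WN.
    apply: le_trans (ncD _ _) _; rewrite !ncM mulrDr lerD// ?[_ * nc (y n - _)]mulrC;
      by rewrite ler_wpM2r ?nc_ge0.
  apply: sumleZ; first by rewrite mulr_ge0 ?W_ge0.
  apply: sumleZ => //; apply: sumleD => // N.
  by apply: (sumle_reflect k zb) => n; exact: nc_ge0.
rewrite W1mu W1 [leRHS](_ : _ = `|k|%:~R * (C * W mu k * (d * (a + b)))); last by ring.
by rewrite ler_wpM2l// ler0z.
Qed.
End Estimates.

(** * The estimate of a difference *)

Section Difference.
Variable R : realType.
Variables (mu C : R) (S : int -> int -> int -> R[i]).
Hypothesis kS : kernel mu C S.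
Let mu0 := ker_mu kS.
Let C0 := ker_C kS.
Implicit Types (y z w v : int -> R[i]) (s A : R).

(** Exchanging the two frequencies carried by [w] turns the factors [k] and [m]
    into [k + m], minus the frequency of [v]: the derivative moves onto [v]. *)
Lemma swap_estimate w v N (L : R) : herm w ->
  sumle (fun k => W (1 + mu) k * nc (v k)) L ->
  2 * nc (\sum_(k <- box N) \sum_(m <- box N)
        cj (w k) * (- ('i * k%:~R) * qterm S v w k m))
  <= C * L * \sum_(k <- box N) nc (w k) ^+ 2.
Proof.
move=> Hw vL.
(* [- k - m] is the frequency of [v]; replacing [k] by its opposite makes the
   expression symmetric. *)
pose D (k m : int) := w k * ('i * k%:~R) * (S k (- k - m) m * v (- k - m) * w m).
pose g k := W (1 + mu) k * nc (v k).
have g0 k : 0 <= g k by rewrite mulr_ge0 ?W_ge0 ?nc_ge0.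
set Z := \sum_(k <- _) _.
have ZE : Z = \sum_(k <- box N) \sum_(m <- box N) D k m.
  rewrite /Z -sum_boxN; apply: eq_bigr => k _; apply: eq_bigr => m _.
  by rewrite Hw conjcK' /D /qterm opprK [(- k)%:~R]rmorphN/=; ring.
have Z2 : 2 * nc Z = nc (\sum_(k <- box N) \sum_(m <- box N) (D k m + D m k)).
  under eq_bigr do rewrite big_split/=.
  rewrite big_split/= [X in nc (_ + X)]exchange_big/= -ZE.
  have -> : Z + Z = 2%:R * Z by ring.
  by rewrite ncM; have /= := nc_int R 2 => ->.
rewrite Z2; set E := \sum_(k <- _) nc (w k) ^+ 2.
have row k : \sum_(m <- box N) g (- k - m) <= L.
  exact: (sumle_reflect (- k) vL).
apply: (@le_trans _ _ (\sum_(k <- box N) \sum_(m <- box N)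
    (C / 2 * (nc (w k) ^+ 2 * g (- k - m)) + C / 2 * (nc (w m) ^+ 2 * g (- m - k))))).
  apply: le_trans (nc_sum _ _) _; apply: ler_sum => k _.
  apply: le_trans (nc_sum _ _) _; apply: ler_sum => m _.
  have -> : D k m + D m k =
      ('i * (k + m)%:~R) * (S k m (- k - m) * v (- k - m) * (w k * w m)).
    rewrite /D (ker_swap kS k) [- m - k]addrC -(ker_rot kS k m) rmorphD/=; ring.
  rewrite !ncM nc_i mul1r nc_int [- m - k]addrC -mulrDr.
  have hS := ker_le3 kS k m (- k - m).
  have ab : nc (w k) * nc (w m) <= (nc (w k) ^+ 2 + nc (w m) ^+ 2) / 2.
    by have := sqr_ge0 (nc (w k) - nc (w m)); nra.
  rewrite [leRHS](_ : _ = C * g (- k - m) * ((nc (w k) ^+ 2 + nc (w m) ^+ 2) / 2)); last by field.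
  rewrite [leLHS](_ : _ = (`|k + m|%:~R * nc (S k m (- k - m)) * nc (v (- k - m)))
      * (nc (w k) * nc (w m))); last by ring.
  rewrite ler_pM ?mulr_ge0 ?nc_ge0 ?ler0z//.
  rewrite /g (W1mu kS) mulrA ler_wpM2r ?nc_ge0//.
  rewrite (_ : `|- k - m| = `|k + m|); last by rewrite -normrN opprD !opprK.
  by rewrite mulrCA ler_wpM2l ?ler0z.
under eq_bigr do rewrite big_split/=.
rewrite big_split/= [X in _ + X]exchange_big/=.
have bnd : \sum_(k <- box N) \sum_(m <- box N) C / 2 * (nc (w k) ^+ 2 * g (- k - m)) <= C / 2 * L * E.
  rewrite /E mulr_sumr; apply: ler_sum => k _.
  rewrite -!mulr_sumr [leRHS](_ : _ = C / 2 * (nc (w k) ^+ 2 * L)); last by ring.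
  by rewrite ler_wpM2l ?divr_ge0// ler_wpM2l ?sqr_ge0.
apply: (le_trans (lerD bnd bnd)).
apply: le_of_eq; by field.
Qed.

(** The [l2] estimate of a difference, on finitely many modes. By [quadBD] the
    nonlinearity sees the difference [y - z] and the sum [y + z]. Inside the box
    [swap_estimate] applies; the modes of the difference outside the box enter
    through the bound [dl] alone. *)
Lemma difference_estimate s y z A N (dl : R) :
  1 / 2 < s - mu - 1 -> hseq s y A -> hseq s z A -> herm y -> herm z ->
  (forall m, m \notin box N -> nc (y m - z m) <= dl) -> 0 <= dl ->
  `|\sum_(k <- box N) 2 * Rez (cj (y k - z k) * (burgers S y k - burgers S z k))|
  <= C * (Mconst (s - (1 + mu)) * (A + A)) * \sum_(k <- box N) nc (y k - z k) ^+ 2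
     + 2 * C * dl * (Mconst (s - mu) * (A + A)) * (Mconst (s - 1) * (A + A)).
Proof.
move=> sr hy hz Hy Hz hdl dl0.
have m0 : 0 <= mu := mu0.
have s0 : 0 <= s by lra.
pose w k := y k - z k; pose v k := y k + z k.
have hw : hseq s w (A + A) by exact: hseqB.
have hv : hseq s v (A + A) by exact: hseqD.
have Hw : herm w by move=> k; rewrite /w Hy Hz conjcB.
have hL1 : sumle (fun k => W (1 + mu) k * nc (v k)) (Mconst (s - (1 + mu)) * (A + A)).
  by apply: hseq_l1 hv; lra.
have hL2 : sumle (fun k => W mu k * nc (v k)) (Mconst (s - mu) * (A + A)).
  by apply: hseq_l1 hv; lra.
have hL3 : sumle (fun k => W 1 k * nc (w k)) (Mconst (s - 1) * (A + A)).
  by apply: hseq_l1 hw; lra.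
set L1 := Mconst (s - (1 + mu)) * _ in hL1 *.
set L2 := Mconst (s - mu) * _ in hL2 *.
set L3 := Mconst (s - 1) * _ in hL3 *.
have L20 : 0 <= L2 by apply: (sumle_ge0 hL2) => k; rewrite mulr_ge0 ?W_ge0 ?nc_ge0.
clearbody L1 L2 L3.
pose P k := \sum_(m <- box N) qterm S v w k m.
have tail k : nc (quad S w v k - P k) <= C * dl * L2.
  apply: (zsum_tail (quad_zsumC kS k s0 hw hv)) => M NM.
  apply: (@le_trans _ _ (\sum_(m <- box M) C * dl * (W mu (k - m) * nc (v (k - m))))).
    apply: ler_sum => m _; case: ifPn => [_|/hdl hm].
      by rewrite !mulr_ge0 ?W_ge0 ?nc_ge0.
    apply: (le_trans (qterm_le2 kS _ _ _ _)).
    rewrite [leRHS](_ : _ = C * (W mu (k - m) * nc (v (k - m)) * dl)); last by ring.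
    by rewrite ler_wpM2l// ler_wpM2l// mulr_ge0 ?W_ge0 ?nc_ge0.
  rewrite -mulr_sumr ler_wpM2l ?mulr_ge0//.
  by apply: (sumle_reflect k hL2) => n; rewrite mulr_ge0 ?W_ge0 ?nc_ge0.
pose Z1 := \sum_(k <- box N) \sum_(m <- box N)
        cj (w k) * (- ('i * k%:~R) * qterm S v w k m).
pose Z2 := \sum_(k <- box N) cj (w k) * (- ('i * k%:~R) * (quad S w v k - P k)).
have -> : \sum_(k <- box N) 2 * Rez (cj (y k - z k) * (burgers S y k - burgers S z k))
    = 2 * Rez (Z1 + Z2).
  rewrite -mulr_sumr -Rez_sum -big_split/=; congr (2 * Rez _).
  apply: eq_bigr => k _.
  rewrite /burgers -mulrBr (quadBD kS k s0 hy hz) -/w -/v.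
  by rewrite -!mulr_sumr -/(P k) -/(w k); ring.
have hZ1 : 2 * nc Z1 <= C * L1 * \sum_(k <- box N) nc (w k) ^+ 2.
  exact: (swap_estimate N Hw hL1).
have hZ2 : nc Z2 <= L3 * (C * dl * L2).
  apply: le_trans (nc_sum _ _) _.
  apply: (@le_trans _ _ (\sum_(k <- box N) W 1 k * nc (w k) * (C * dl * L2))).
    apply: ler_sum => k _; rewrite !ncM nc_conj nc_ik mulrCA mulrA.
    by rewrite ler_wpM2l ?mulr_ge0 ?W_ge0 ?nc_ge0.
  by rewrite -mulr_suml; apply: ler_wpM2r; [rewrite !mulr_ge0|exact: hL3].
rewrite normrM [`|2|]ger0_norm//.
apply: (@le_trans _ _ (2 * (nc Z1 + nc Z2))).
  by rewrite ler_pM2l//; apply: le_trans (normRe_le _) (ncD _ _).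
rewrite mulrDr lerD// [leRHS](_ : _ = 2 * (L3 * (C * dl * L2))); last by ring.
by rewrite ler_pM2l.
Qed.

End Difference.

(** * Uniqueness for the coefficients *)

Section Gronwall.
Variable R : realType.

(** The function [expR (- L * t) * (f t + e / L)] is nonincreasing. *)
Lemma gronwall (f df : R -> R) (b L e : R) : 0 <= b -> 0 < L ->
  (forall t, 0 <= t <= b -> is_derive t 1 f (df t)) ->
  (forall t, 0 <= t <= b -> df t <= L * f t + e) ->
  f 0 = 0 -> forall t, 0 <= t <= b -> f t + e / L <= e / L * expR (L * t).
Proof.
move=> b0 L0 fd dfle f0 t /andP[t0 tb].
pose g t := expR (- L * t) * (f t + e / L).
have gd u : 0 <= u <= b -> is_derive u 1 g
    (expR (- L * u) * (df u - L * f u - e)).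
  move=> ub; have fu := fd u ub.
  have h1 : is_derive u 1 (fun t : R => expR (- L * t)) (expR (- L * u) * (- L)).
    have hl : is_derive u (1:R) (fun t : R => - L * t) (- L).
      have := @is_deriveZ R R R id (- L) u 1 1 (is_derive_id _ _).
      by rewrite /GRing.scale/= mulr1.
    have := @is_derive1_comp R expR (fun t => - L * t) u (expR (- L * u)) (- L) (is_derive_expR _) hl.
    by rewrite mulrC.
  have h2 : is_derive u 1 (fun t => f t + e / L) (df u).
    by rewrite -[df u]addr0; apply: is_deriveD.
  have h3 := @is_deriveM R R _ _ u 1 _ _ h1 h2.
  apply: (is_derive_eq h3); rewrite /GRing.scale/=.
  by field; rewrite gt_eqF.
have gd' u : u \in `]0, b[ -> 0 <= u <= b.
  by rewrite in_itv/= => /andP[/ltW -> /ltW ->].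
have gcont : {within `[0, b], continuous g}.
  apply: continuous_in_subspaceT => u; rewrite inE/= in_itv/= => ub.
  exact: is_derive_continuous (gd u ub).
have gdec : g t <= g 0.
  apply: (@ler0_derive1_le R g 0 b _ _ true false gcont) => //.
  - by move=> u /gd'/gd /@ex_derive.
  - move=> u /gd' ub; have := gd u ub; rewrite derive1E => /@derive_val ->.
    rewrite pmulr_rle0 ?expR_gt0//.
    by have := dfle u ub; lra.
  - by rewrite in_itv/=; apply/andP; split.
  - by rewrite in_itv/=; apply/andP; split.
move: gdec; rewrite /g mulr0 expR0 mul1r f0 add0r mulNr expRN.
by rewrite mulrC ler_pdivrMr ?expR_gt0.
Qed.

End Gronwall.

Section ComplexDerivative.
Variable R : realType.
Implicit Types (y z : R -> R[i]) (t : R).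

Definition cderiv y t (d : R[i]) : Prop :=
  is_derive t 1 (fun u => Rez (y u)) (Rez d) /\
  is_derive t 1 (fun u => Imz (y u)) (Imz d).

Lemma is_derive_lim (f : R -> R) t d :
  h^-1 * (f (t + h) - f t) @[h --> (0:R)^'] --> d -> is_derive t 1 f d.
Proof.
move=> h.
have E : (fun h : R => h^-1 *: ((f \o shift t) (h *: 1) - f t)) =
         (fun h : R => h^-1 * (f (t + h) - f t)).
  by apply/funext => u /=; rewrite /GRing.scale/= mulr1 [t + u]addrC.
have c : cvg (h^-1 *: ((f \o shift t) (h *: 1) - f t) @[h --> (0:R)^']).
  by rewrite E; apply/cvg_ex; exists d.
apply: DeriveDef => //.
by rewrite /derive E; apply/cvg_lim.
Qed.

Lemma cderiv_ccvg y t d :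
  ccvg ((0:R)^') (fun h => (h^-1)%:C * (y (t + h) - y t) - d) 0 -> cderiv y t d.
Proof.
move=> h.
have h' : ccvg ((0:R)^') (fun h => (h^-1)%:C * (y (t + h) - y t)) d.
  apply: ccvg_squeeze h; apply: nearW => u /=; by rewrite subr0.
split; apply: is_derive_lim.
  have := ccvg_Re h'; under eq_fun do rewrite RezM/= mul0r subr0 RezD RezN.
  exact.
have := ccvg_Im h'; under eq_fun do rewrite ImzM/= mul0r addr0 ImzD ImzN.
exact.
Qed.

(** A limit of Euler polygons satisfies a Taylor inequality of order two, which
    is what passes to the limit; differentiability is recovered from it. *)
Lemma cderiv_quadratic y t d (D e : R) : 0 < e ->
  (forall h, `|h| < e -> nc (y (t + h) - y t - h%:C * d) <= D * h ^+ 2) ->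
  cderiv y t d.
Proof.
move=> e0 hD; apply: cderiv_ccvg.
apply: (@ccvg_squeeze _ _ _ _ _ _ (fun h => D * `|h|)).
  have : \forall h \near (0:R)^', `|h| < e.
    apply: nbhs_dnbhs; exists e => //= h /=; by rewrite sub0r normrN.
  have : \forall h \near (0:R)^', h != 0 by exact: nbhs_dnbhs_neq.
  apply: filterS2 => h h0 he.
  have hc : (h^-1)%:C * h%:C = 1 :> R[i] by rewrite -rmorphM mulVf.
  rewrite subr0 [X in nc X](_ : _ = (h^-1)%:C * (y (t + h) - y t - h%:C * d));
    last by rewrite [RHS]mulrBr mulrA hc mul1r.
  rewrite ncM nc_real normrV ?unitfE//.
  have := hD h he; rewrite -[h ^+ 2]real_normK ?num_real// => h1.
  apply: (@le_trans _ _ (`|h|^-1 * (D * `|h| ^+ 2))); first by rewrite ler_wpM2l ?invr_ge0.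
  by apply: le_of_eq; field; rewrite normr_eq0.
have h0 : `|h| @[h --> (0:R)^'] --> `|0 : R|.
  by apply: cvg_within_filter; apply: cvg_norm; exact: cvg_id.
have h1 : D * `|h| @[h --> (0:R)^'] --> D * `|0 : R|.
  by apply: cvgM => //; exact: cvg_cst.
by rewrite normr0 mulr0 in h1.
Qed.

Lemma cderivB y z t d e : cderiv y t d -> cderiv z t e ->
  cderiv (fun u => y u - z u) t (d - e).
Proof.
move=> [hy1 hy2] [hz1 hz2]; split.
  rewrite RezD RezN; under eq_fun do rewrite RezD RezN; exact: is_deriveB.
rewrite ImzD ImzN; under eq_fun do rewrite ImzD ImzN; exact: is_deriveB.
Qed.

Lemma is_derive_affine (f : R -> R) t0 (e t df : R) :
  is_derive (t0 + e * t) 1 f df -> is_derive t 1 (fun u => f (t0 + e * u)) (e * df).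
Proof.
move=> h.
have hl : is_derive t (1:R) (fun u : R => t0 + e * u) e.
  have h1 := @is_deriveZ R R R id e t 1 1 (is_derive_id _ _).
  have h2 := @is_deriveD R R R (cst t0) _ t 1 _ _ (is_derive_cst _ _ _) h1.
  by apply: (is_derive_eq h2); rewrite add0r /GRing.scale/= mulr1.
by have := @is_derive1_comp R f (fun u => t0 + e * u) t df e h hl; rewrite mulrC.
Qed.

Lemma cderiv_affine y t0 (e t : R) d : cderiv y (t0 + e * t) d ->
  cderiv (fun u => y (t0 + e * u)) t (e%:C * d).
Proof.
move=> [h1 h2]; split.
  by rewrite RezM/= mul0r subr0; exact: (@is_derive_affine (fun u => Rez (y u))).
by rewrite ImzM/= mul0r addr0; exact: (@is_derive_affine (fun u => Imz (y u))).
Qed.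

Lemma is_derive_nc2 y t d : cderiv y t d ->
  is_derive t 1 (fun u => nc (y u) ^+ 2) (2 * Rez (cj (y t) * d)).
Proof.
move=> [h1 h2]; under eq_fun do rewrite nc_sqr !expr2.
have h3 := @is_deriveD R R R _ _ t 1 _ _ (@is_deriveM R R _ _ t 1 _ _ h1 h1)
  (@is_deriveM R R _ _ t 1 _ _ h2 h2).
by apply: (is_derive_eq h3); rewrite /GRing.scale/= RezM RezC ImzC; ring.
Qed.

Lemma is_derive_sumr (I : Type) (s : seq I) (f : I -> R -> R) (df : I -> R) t :
  (forall i, is_derive t 1 (f i) (df i)) ->
  is_derive t 1 (fun u => \sum_(i <- s) f i u) (\sum_(i <- s) df i).
Proof.
move=> h; elim: s => [|a s IH].
  by under eq_fun do rewrite big_nil; rewrite big_nil; exact: is_derive_cst.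
by under eq_fun do rewrite big_cons; rewrite big_cons; exact: is_deriveD.
Qed.

End ComplexDerivative.

Section Uniqueness.
Variable R : realType.
Variables (mu C : R) (S : int -> int -> int -> R[i]).
Hypothesis kS : kernel mu C S.
Let mu0 := ker_mu kS.
Let C0 := ker_C kS.
Implicit Types (c d : R -> int -> R[i]) (s A B : R).

Lemma time_direction (h : R) : exists e : R, [/\ `|e| <= 1, h = e * `|h| &
  forall u, 0 <= u -> `|e * u| <= u].
Proof.
have H (e : R) : `|e| <= 1 -> forall u, 0 <= u -> `|e * u| <= u.
  by move=> e1 u u0; rewrite normrM (ger0_norm u0) ler_piMl.
have [h0|h0] := leP 0 h; [exists 1|exists (-1)]; split.
- by rewrite normr1.
- by rewrite mul1r ger0_norm.
- by apply: H; rewrite normr1.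
- by rewrite normrN1.
- by rewrite ltr0_norm// mulN1r opprK.
- by apply: H; rewrite normrN1.
Qed.

(** Solutions on [[0, b]], in terms of Fourier coefficients, of the equation
    run at speed [e]: the values [e = 1] and [e = -1] are the two directions of
    time. *)
Definition bounded_ode s (e b A : R) c : Prop :=
  forall t, 0 <= t <= b -> [/\ hseq s (c t) A, herm (c t) &
    forall k, cderiv (fun u => c u k) t (e%:C * burgers S (c t) k)].

(** Gronwall's lemma for the [l2] norm of the difference over [box N]. The
    coefficients of the difference outside the box are at most [2 * A / N.+1],
    as [1 <= s]; hence the error term vanishes as [N] grows. *)
Lemma bounded_ode_unique s e b A c d :
  1 / 2 < s - mu - 1 -> `|e| <= 1 -> 0 <= b ->
  bounded_ode s e b A c -> bounded_ode s e b A d ->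
  (forall k, c 0 k = d 0 k) ->
  forall t, 0 <= t <= b -> forall k, c t k = d t k.
Proof.
move=> sr e1 b0 hc hd h0 t tb k.
have m0 : 0 <= mu := mu0.
have s1 : 1 <= s by lra.
have A0 : 0 <= A by have [[]] := hc 0 (introT andP (conj (lexx 0) b0)).
set L1 := C * (Mconst (s - (1 + mu)) * (A + A)).
set K := 2 * C * (A + A) * (Mconst (s - mu) * (A + A)) * (Mconst (s - 1) * (A + A)).
have L10 : 0 <= L1 by rewrite !mulr_ge0 ?Mconst_ge0 ?addr_ge0.
have K0 : 0 <= K by rewrite !mulr_ge0 ?Mconst_ge0 ?addr_ge0.
pose L := L1 + 1.
have L0 : 0 < L by rewrite ltr_wpDl.
pose E N t := \sum_(k <- box N) nc (c t k - d t k) ^+ 2.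
pose dE N t := \sum_(k <- box N) 2 * Rez (cj (c t k - d t k) *
   (e%:C * burgers S (c t) k - e%:C * burgers S (d t) k)).
have Ed N u : 0 <= u <= b -> is_derive u 1 (E N) (dE N u).
  move=> ub; have [_ _ hcu] := hc u ub; have [_ _ hdu] := hd u ub.
  apply: is_derive_sumr => j; apply: is_derive_nc2; exact: cderivB.
have E0 N u : 0 <= E N u by apply: sumr_ge0 => j _; exact: sqr_ge0.
have dEle N u : 0 <= u <= b -> dE N u <= L * E N u + K / N.+1%:R.
  move=> ub; have [hcu Hcu _] := hc u ub; have [hdu Hdu _] := hd u ub.
  have -> : dE N u = e * \sum_(k <- box N) 2 * Rez (cj (c u k - d u k) *
     (burgers S (c u) k - burgers S (d u) k)).
    rewrite mulr_sumr; apply: eq_bigr => j _.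
    by rewrite -mulrBr [X in Rez X]mulrCA RezZ; ring.
  apply: le_trans (ler_norm _) _; rewrite normrM.
  apply: (@le_trans _ _ (`|\sum_(k <- box N) 2 * Rez (cj (c u k - d u k) *
     (burgers S (c u) k - burgers S (d u) k))|)).
    by rewrite ler_piMl.
  have dl0 : 0 <= (A + A) / N.+1%:R by rewrite divr_ge0 ?addr_ge0.
  apply: le_trans (@difference_estimate R mu C S kS s _ _ A N _ sr hcu hdu Hcu Hdu _ dl0) _.
    move=> m; rewrite mem_box -ltnNge => hm.
    have hw : hseq s (fun k => c u k - d u k) (A + A) by exact: hseqB.
    have hm2 := hseq_term m (le_trans ler01 s1) hw.
    rewrite ler_pdivlMr// mulrC; apply: le_trans hm2; rewrite ler_wpM2r ?nc_ge0//.
    have mn0 : m != 0 by apply: contraTneq hm => ->.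
    apply: le_trans (@le_W R 1 s m mn0 s1).
    by rewrite W1 -abszE -pmulrn ler_nat.
  apply: lerD; first by rewrite ler_wpM2r ?E0// lerDl.
  by rewrite /K; apply: le_of_eq; ring.
have bd N : (`|k| <= N)%N -> nc (c t k - d t k) ^+ 2 <= K / L * expR (L * t) * harmonic N.
  move=> kN.
  have EN0 : E N 0 = 0 by rewrite /E big1// => j _; rewrite h0 subrr nc0 expr0n.
  have h := gronwall b0 L0 (Ed N) (dEle N) EN0 tb.
  apply: (@le_trans _ _ (E N t)).
    have := @le_sum_sub R [:: k] (box N) (fun k => nc (c t k - d t k) ^+ 2) isT.
    rewrite big_seq1; apply; last by move=> j; exact: sqr_ge0.
    by move=> j; rewrite inE => /eqP ->; rewrite mem_box.
  apply: (@le_trans _ _ (E N t + K / N.+1%:R / L)).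
    by rewrite lerDl !divr_ge0// ltW.
  apply: le_trans h _; apply: le_of_eq.
  by rewrite /harmonic/=; ring.
have : nc (c t k - d t k) ^+ 2 <= 0.
  have lim0 : K / L * expR (L * t) * harmonic N @[N --> \oo] --> (0 : R).
    by rewrite -(mulr0 (K / L * expR (L * t))); apply: cvgM; [exact: cvg_cst|exact: cvg_harmonic].
  apply: (ler_cvg_to (cvg_cst _) lim0).
  by exists `|k|%N => // N /= /bd.
rewrite le_eqVlt ltNge sqr_ge0 orbF sqrf_eq0 => /eqP/nc_eq0/eqP.
by rewrite subr_eq0 => /eqP.
Qed.

End Uniqueness.

(** * The Euler scheme *)

Section Euler.
Variable R : realType.
Variables (mu C s Cs : R) (S : int -> int -> int -> R[i]).
Hypothesis kS : kernel mu C S.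
Hypothesis hCs : symbol_bound s Cs.
Hypothesis sr : 1 / 2 < s - mu - 1.
Let mu0 := ker_mu kS.
Let C0 := ker_C kS.
Implicit Types (y z f : int -> R[i]).

Lemma sobolev_index_ge1 : 1 <= s. Proof. have m0 : 0 <= mu := mu0; have := sr; lra. Qed.
Let s1 := sobolev_index_ge1.
Let s0 : 0 <= s := le_trans ler01 s1.

(** The rate in the inequality [r' <= growth * r ^+ 2] obeyed by the Sobolev
    norm [r]; comparison with its explicit solution gives the lifespan. *)
Definition growth : R := C * Cs * Mconst (s - mu - 1).
Let K := growth.
Lemma growth_ge0 : 0 <= K.
Proof. by rewrite /K /growth !mulr_ge0 ?Mconst_ge0//; exact: (symbol_bound_ge0 hCs). Qed.
Let K0 := growth_ge0.

Definition proj N y k : R[i] := if k \in box N then y k else 0.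

Lemma hseq_proj N y B : hseq s y B -> hseq s (proj N y) B.
Proof.
move=> [B0 y0 yB]; split => //; first by rewrite /proj; case: ifP.
apply: le_sumle yB => k; rewrite /proj; case: ifP => // _.
by rewrite nc0 mulr0 expr0n/= sqr_ge0.
Qed.

Lemma herm_proj N y : herm y -> herm (proj N y).
Proof.
move=> Hy k; rewrite /proj !mem_box abszN -mem_box Hy; case: ifP => // _.
by apply: complex_ext; rewrite ?RezC ?ImzC//= oppr0.
Qed.

Lemma proj_out N y k : k \notin box N -> proj N y k = 0.
Proof. by rewrite /proj => /negbTE ->. Qed.

Lemma supp_sumle (x : int -> R) N B : (forall k, k \notin box N -> x k = 0) ->
  (forall k, 0 <= x k) -> \sum_(k <- box N) x k <= B -> sumle x B.
Proof.
move=> xN x0 xB M; apply: le_trans xB.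
apply: (@le_trans _ _ (\sum_(k <- box (maxn M N)) x k)).
  by apply: le_sum_sub => //; [exact: uniq_box|apply: box_sub; exact: leq_maxl].
rewrite (sum_box_restr x (leq_maxr M N)).
by apply: ler_sum => k _; case: ifPn => // /xN ->.
Qed.

(** Explicit Euler scheme with step [h], for the equation truncated to [box N]. *)
Fixpoint euler N (h : R) f (j : nat) : int -> R[i] :=
  if j is j'.+1 then
    fun k => euler N h f j' k + h%:C * proj N (burgers S (euler N h f j')) k
  else proj N f.

Lemma euler_out N h f j k : k \notin box N -> euler N h f j k = 0.
Proof.
elim: j => [|j IH] /= kN; first exact: proj_out.
by rewrite IH// proj_out// mulr0 addr0.
Qed.

(** One step of the scheme: the first order term is the energy estimate, the
    second order one is absorbed by enlarging the growth constant. *)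
Lemma euler_step N y r (h eta dl : R) :
  hseq s y r -> herm y -> (forall k, k \notin box N -> y k = 0) ->
  `|h| <= eta -> 0 <= dl -> eta * (N%:R * quad_const mu C s) ^+ 2 * r <= 2 * dl ->
  hseq s (fun k => y k + h%:C * proj N (burgers S y) k) (r + eta * (K + dl) * r ^+ 2).
Proof.
move=> hy Hy yN heta dl0 hr.
have eta0 : 0 <= eta by apply: le_trans heta.
have [r0 y0 yr] := hy.
set F := proj N (burgers S y).
have FN k : k \notin box N -> F k = 0 by exact: proj_out.
pose q := quad_const mu C s.
have q0 : 0 <= q by exact: (quad_const_ge0 kS).
have hF : \sum_(k <- box N) (W s k * nc (F k)) ^+ 2 <= (N%:R * q * r ^+ 2) ^+ 2.
  have [_ _ hb] : hseq (s - 1) (burgers S y) (q * r * r).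
    by apply: (hseq_burgers kS) => //; have m0 : 0 <= mu := mu0; have := sr; lra.
  rewrite [leRHS](_ : _ = N%:R ^+ 2 * (q * r * r) ^+ 2); last by ring.
  apply: (@le_trans _ _ (N%:R ^+ 2 * \sum_(k <- box N) (W (s - 1) k * nc (burgers S y k)) ^+ 2));
    last by rewrite ler_wpM2l ?sqr_ge0.
  rewrite mulr_sumr big_seq [leRHS]big_seq; apply: ler_sum => k kN.
  rewrite /F /proj kN -exprMn ler_pXn2r ?nnegrE ?mulr_ge0 ?W_ge0 ?nc_ge0//.
  rewrite mulrA ler_wpM2r ?nc_ge0//.
  have [->|k0] := eqVneq k 0.
    by rewrite W0 ?mulr_ge0 ?W_ge0// gt_eqF// (lt_le_trans ltr01 s1).
  have -> : W s k = W 1 k * W (s - 1) k by rewrite -WD// addrC subrK.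
  rewrite ler_wpM2r ?W_ge0// W1 -abszE -pmulrn ler_nat.
  by move: kN; rewrite mem_box.
split.
- by rewrite addr_ge0// !mulr_ge0 ?addr_ge0 ?sqr_ge0.
- by rewrite y0 /F /proj burgers0; case: ifP => _; rewrite mulr0 addr0.
apply: (@supp_sumle _ N).
- by move=> k kN; rewrite yN// FN// mulr0 addr0 nc0 mulr0 expr0n.
- by move=> k; exact: sqr_ge0.
set T := \sum_(k <- box N) W s k ^+ 2 * Rez (cj (y k) * burgers S y k).
have hT : `|T| <= K * r ^+ 3 by exact: (energy_estimate kS).
have -> : \sum_(k <- box N) (W s k * nc (y k + h%:C * F k)) ^+ 2 =
   \sum_(k <- box N) (W s k * nc (y k)) ^+ 2 + 2 * h * T +
   h ^+ 2 * \sum_(k <- box N) (W s k * nc (F k)) ^+ 2.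
  rewrite /T !mulr_sumr -!big_split/= big_seq [RHS]big_seq; apply: eq_bigr => k kN.
  rewrite exprMn nc_sqrD [X in Rez X]mulrCA RezZ ncM nc_real [(`|h| * _) ^+ 2]exprMn real_normK ?num_real//.
  by rewrite /F /proj kN; ring.
have h1 : 2 * h * T <= 2 * eta * (K * r ^+ 3).
  apply: le_trans (ler_norm _) _; rewrite normrM [`|2 * h|]normrM [`|2|]ger0_norm//.
  by apply: ler_pM => //; rewrite ?mulr_ge0// ler_pM2l.
have h2 : h ^+ 2 * \sum_(k <- box N) (W s k * nc (F k)) ^+ 2 <=
    eta ^+ 2 * (N%:R * q * r ^+ 2) ^+ 2.
  rewrite ler_pM ?sqr_ge0 ?sumr_ge0// => [k _|]; first exact: sqr_ge0.
  by rewrite -[h ^+ 2]real_normK ?num_real// ler_pXn2r ?nnegrE.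
apply: (le_trans (lerD (lerD (yr N) h1) h2)).
have h3 : eta ^+ 2 * (N%:R * q * r ^+ 2) ^+ 2 <= eta * r ^+ 3 * (2 * dl).
  rewrite [leLHS](_ : _ = eta * r ^+ 3 * (eta * (N%:R * q) ^+ 2 * r)); last by ring.
  by rewrite ler_wpM2l// mulr_ge0// exprn_ge0.
have h4 : 0 <= (eta * (K + dl) * r ^+ 2) ^+ 2 by exact: sqr_ge0.
move: h3 h4; lra.
Qed.

Lemma herm_euler N h f j : herm f -> (exists r, hseq s (euler N h f j) r) ->
  herm (euler N h f j) -> herm (euler N h f j.+1).
Proof.
move=> Hf [r hr] He k /=; rewrite He.
have HF := herm_proj N (burgers_herm kS s0 hr He).
rewrite HF conjcD conjcM; congr (_ + _ * _).
by apply: complex_ext; rewrite ?RezC ?ImzC//= oppr0.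
Qed.

(** The index [n] is at once the frequency cutoff and the cap on the norms.
    The step is so small that, below the cap, the second order term of a step is
    absorbed by an increase of [growth] by [n.+1%:R^-1]. *)
Definition mesh (n : nat) : R :=
  (n.+1%:R ^+ 2 * ((n%:R * quad_const mu C s) ^+ 2 + 1))^-1.

Lemma mesh_gt0 n : 0 < mesh n.
Proof. by rewrite invr_gt0 mulr_gt0 ?exprn_gt0// ltr_wpDl ?sqr_ge0. Qed.

Lemma mesh_le n : mesh n <= n.+1%:R^-1.
Proof.
rewrite /mesh lef_pV2 ?posrE ?mulr_gt0 ?exprn_gt0//; last by rewrite ltr_wpDl ?sqr_ge0.
apply: (@le_trans _ _ (n.+1%:R ^+ 2)); first by rewrite expr2 ler_peMl// ler1n.
by rewrite ler_peMr ?sqr_ge0// lerDr sqr_ge0.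
Qed.

Lemma mesh_cap n r : 0 <= r -> r <= n%:R ->
  mesh n * (n%:R * quad_const mu C s) ^+ 2 * r <= 2 * n.+1%:R^-1.
Proof.
move=> r0 rn; set D := (_ * quad_const _ _ _) ^+ 2.
have D0 : 0 <= D by exact: sqr_ge0.
have n1 : 0 < n.+1%:R :> R by [].
have h : D * r <= (D + 1) * n.+1%:R.
  apply: ler_pM => //; first by rewrite lerDl.
  by apply: le_trans rn _; rewrite ler_nat.
rewrite [leLHS](_ : _ = D * r / (n.+1%:R ^+ 2 * (D + 1))); last by rewrite /mesh -/D; ring.
rewrite ler_pdivrMr; last by rewrite mulr_gt0 ?exprn_gt0 ?ltr_wpDl.
rewrite [leRHS](_ : _ = 2 * ((D + 1) * n.+1%:R)); last by field; rewrite gt_eqF.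
apply: le_trans h _.
by rewrite ler_peMl ?mulr_ge0 ?addr_ge0// ler1n.
Qed.

Definition growth_n (n : nat) : R := K + n.+1%:R^-1.

(** The bound is the solution of [r' = growth_n n * r ^+ 2] with [r 0 = rho].
    As this solution is convex, an Euler step started below it stays below it. *)
Lemma euler_bound n (e rho : R) f j : hseq s f rho -> herm f -> `|e| <= 1 ->
  j%:R * mesh n * growth_n n * rho < 1 ->
  rho / (1 - j%:R * mesh n * growth_n n * rho) <= n%:R ->
  hseq s (euler n (e * mesh n) f j) (rho / (1 - j%:R * mesh n * growth_n n * rho))
  /\ herm (euler n (e * mesh n) f j).
Proof.
move=> hf Hf e1; have [rho0 _ _] := hf.
set x := mesh n * growth_n n * rho.
have g0 : 0 <= growth_n n by rewrite addr_ge0 ?invr_ge0.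
have x0 : 0 <= x by rewrite !mulr_ge0// ltW// mesh_gt0.
have xE (i : nat) : i%:R * mesh n * growth_n n * rho = i%:R * x by rewrite /x; ring.
rewrite xE.
elim: j => [|j IH].
  by move=> _ _; rewrite mul0r subr0 divr1; split; [exact: hseq_proj|exact: herm_proj].
rewrite -natr1 mulrDl mul1r => lt1 cap.
have a1 : 0 < 1 - (j%:R * x + x) by rewrite subr_gt0.
have a0 : 0 < 1 - j%:R * x by apply: lt_le_trans a1 _; rewrite lerD2l lerN2 lerDl.
have le_r : rho / (1 - j%:R * x) <= rho / (1 - (j%:R * x + x)).
  by rewrite ler_wpM2l// lef_pV2 ?posrE// lerD2l lerN2 lerDl.
have [|hj Hj] := IH _ (le_trans le_r cap); first by rewrite -subr_gt0.
have r0 : 0 <= rho / (1 - j%:R * x) by rewrite divr_ge0// ltW.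
split; last by apply: herm_euler => //; eexists; exact: hj.
have heta : `|e * mesh n| <= mesh n.
  by rewrite normrM (ger0_norm (ltW (mesh_gt0 n))) ler_piMl// ltW// mesh_gt0.
have nge : 0 <= n.+1%:R^-1 :> R by rewrite invr_ge0.
have := euler_step hj Hj (fun k => @euler_out n (e * mesh n) f j k) heta nge
  (mesh_cap r0 (le_trans le_r cap)).
apply: hseq_le.
rewrite -/(growth_n n).
have -> : rho / (1 - j%:R * x) + mesh n * growth_n n * (rho / (1 - j%:R * x)) ^+ 2 =
    rho * ((1 - j%:R * x) + x) / (1 - j%:R * x) ^+ 2.
  by rewrite /x; field; rewrite gt_eqF.
rewrite ler_pdivrMr ?exprn_gt0//.
rewrite [leRHS](_ : _ = rho * ((1 - j%:R * x) ^+ 2 / (1 - (j%:R * x + x)))); last by ring.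
rewrite ler_wpM2l// ler_pdivlMr//.
by have := sqr_ge0 x; nra.
Qed.

(** On a time interval compatible with the lifespan the cap of [mesh] is
    eventually above the bound itself, so it is never reached. *)
Lemma euler_bound_eventually (rho T : R) f : hseq s f rho -> herm f -> 0 <= T ->
  K * rho * T < 1 ->
  exists n0 : nat, forall n, (n0 <= n)%N -> growth_n n * rho * T < 1 /\
    rho / (1 - growth_n n * rho * T) <= 2 * rho / (1 - K * rho * T) /\
    forall e j, `|e| <= 1 -> j%:R * mesh n <= T ->
    hseq s (euler n (e * mesh n) f j) (rho / (1 - growth_n n * rho * T)) /\
    herm (euler n (e * mesh n) f j).
Proof.
move=> hf Hf T0 KT; have [rho0 _ _] := hf.
set a := 1 - K * rho * T; have a0 : 0 < a by rewrite subr_gt0.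
(* The first term makes [n] exceed the bound on the norms, the second one
   makes the excess of [growth_n n] over [growth] halve the margin [a] at most. *)
pose X := 2 * rho / a + 2 * rho * T / a.
have X1 : 0 <= 2 * rho / a by rewrite !mulr_ge0// invr_ge0 ltW.
have X2 : 0 <= 2 * rho * T / a by rewrite !mulr_ge0// invr_ge0 ltW.
have [n0 hn0] : exists n0 : nat, X <= n0%:R.
  by exists (Num.bound X); apply/ltW; apply: le_lt_trans (archi_boundP _); rewrite ?ler_norm ?addr_ge0.
exists n0 => n n0n.
have Xn : X <= n%:R by apply: le_trans hn0 _; rewrite ler_nat.
have n1 : 0 < n.+1%:R :> R by [].
have small : rho * T / n.+1%:R <= a / 2.
  rewrite ler_pdivrMr//.
  have : 2 * rho * T / a <= n.+1%:R.
    apply: (@le_trans _ _ n%:R); last by rewrite ler_nat.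
    by apply: le_trans Xn; rewrite lerDr.
  by rewrite ler_pdivrMr// => h; lra.
have b_ge : a / 2 <= 1 - growth_n n * rho * T.
  have -> : 1 - growth_n n * rho * T = a - rho * T / n.+1%:R by rewrite /growth_n /a; ring.
  by rewrite lerBrDl -lerBrDr (_ : a - a / 2 = a / 2)//; field.
have b0 : 0 < 1 - growth_n n * rho * T by apply: lt_le_trans b_ge; rewrite divr_gt0.
have le2 : rho / (1 - growth_n n * rho * T) <= 2 * rho / a.
  rewrite ler_pdivrMr// [leRHS](_ : _ = rho * (2 / a * (1 - growth_n n * rho * T))); last by ring.
  rewrite ler_peMr// [leRHS](_ : _ = 2 * (1 - growth_n n * rho * T) / a); last by ring.
  by rewrite ler_pdivlMr// mul1r mulrC -ler_pdivrMr.
split; first by rewrite -subr_gt0.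
split => // e j e1 jT.
have g0 : 0 <= growth_n n by rewrite addr_ge0 ?invr_ge0.
have le3 : j%:R * mesh n * growth_n n * rho <= growth_n n * rho * T.
  rewrite [leRHS](_ : _ = T * growth_n n * rho); last by ring.
  by rewrite ler_wpM2r// ler_wpM2r.
have lt1 : j%:R * mesh n * growth_n n * rho < 1 by apply: le_lt_trans le3 _; rewrite -subr_gt0.
have le4 : rho / (1 - j%:R * mesh n * growth_n n * rho) <= rho / (1 - growth_n n * rho * T).
  have c0 : 0 < 1 - j%:R * mesh n * growth_n n * rho by rewrite subr_gt0.
  by rewrite ler_wpM2l// lef_pV2 ?posrE// lerD2l lerN2.
have [|h1 h2] := euler_bound hf Hf e1 lt1.
  apply: le_trans le4 (le_trans le2 (le_trans _ Xn)); by rewrite lerDl.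
by split => //; apply: hseq_le h1.
Qed.

End Euler.

(** * Limits of the scheme and existence for the coefficients *)

Section UltraLimits.
Variable R : realType.
Variable U : set_system nat.
Context {UU : UltraFilter U}.

(** Convergence along an ultrafilter replaces the extraction of a diagonal
    subsequence: all times and all frequencies are treated at once. *)
Lemma ultra_cvg_real (x : nat -> R) (B : R) :
  (\forall n \near U, `|x n| <= B) -> exists l : R, x n @[n --> U] --> l.
Proof.
move=> xB.
have [|p [_ pcl]] := @segment_compact R (- B) B (x @ U) _.
  by apply: filterS xB => n /=; rewrite in_itv/= ler_norml.
exists p => V pV; rewrite /nbhs/=.
have [//|h] := in_ultra_setVsetC (x @^-1` V) UU.
have [q [/= nVq Vq]] := pcl (~` V) V h pV.
by [].
Qed.

Lemma ultra_ccvg (z : nat -> R[i]) (B : R) :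
  (\forall n \near U, nc (z n) <= B) -> exists l, ccvg U z l.
Proof.
move=> zB.
have [a ha] : exists a : R, Rez (z n) @[n --> U] --> a.
  apply: (@ultra_cvg_real (fun n => Rez (z n)) B).
  by apply: filterS zB => n; apply: le_trans; exact: normRe_le.
have [b hb] : exists b : R, Imz (z n) @[n --> U] --> b.
  apply: (@ultra_cvg_real (fun n => Imz (z n)) B).
  by apply: filterS zB => n; apply: le_trans; exact: normIm_le.
by exists (a +i* b); exact: (@ccvg_ReIm R nat U _ z (a +i* b)).
Qed.

Definition ulim (z : nat -> R[i]) : R[i] := xget 0 [set l | ccvg U z l].

Lemma ulimP (z : nat -> R[i]) (B : R) :
  (\forall n \near U, nc (z n) <= B) -> ccvg U z (ulim z).
Proof.
move=> /ultra_ccvg[l hl]; rewrite /ulim; case: xgetP => [m -> //|/(_ l)//].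
Qed.

End UltraLimits.

Section SequenceLimits.
Variable R : realType.
Variables (mu C s : R) (S : int -> int -> int -> R[i]).
Hypothesis kS : kernel mu C S.
Hypothesis s1 : 1 <= s.
Let mu0 := ker_mu kS.
Let C0 := ker_C kS.
Let s0 : 0 <= s := le_trans ler01 s1.
Variable F : set_system nat.
Context {FF : ProperFilter F}.
Implicit Types (y c : int -> R[i]) (Y : nat -> int -> R[i]).

(** Lower semicontinuity of the Sobolev norm: each of the box sums that define
    the bound involves finitely many coefficients. *)
Lemma hseq_lim Y c (B : nat -> R) (b : R) :
  (forall k, ccvg F (fun n => Y n k) (c k)) ->
  (\forall n \near F, hseq s (Y n) (B n)) -> B n @[n --> F] --> b ->
  hseq s c b.
Proof.
move=> Yc YB Bb; split.
- by apply: (ler_cvg_to (cvg_cst 0) Bb); apply: filterS YB => n [].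
- have h := Yc 0; apply: (ccvg_unique h).
  apply: (@ccvg_squeeze _ _ _ _ _ _ (fun=> 0)); last exact: cvg_cst.
  by apply: filterS YB => n [_ -> _]; rewrite subrr nc0.
move=> N.
have hs : \sum_(k <- box N) (W s k * nc (Y n k)) ^+ 2
    @[n --> F] --> \sum_(k <- box N) (W s k * nc (c k)) ^+ 2.
  apply: cvg_sumr => k; rewrite expr2.
  under eq_fun do rewrite expr2.
  by apply: cvgM; apply: cvgM; [exact: cvg_cst|exact: ccvg_nc|exact: cvg_cst|exact: ccvg_nc].
have hb : B n ^+ 2 @[n --> F] --> b ^+ 2.
  by rewrite expr2; under eq_fun do rewrite expr2; exact: cvgM.
apply: (ler_cvg_to hs hb).
by apply: filterS YB => n [_ _]; apply.
Qed.

Lemma herm_lim Y c : (forall k, ccvg F (fun n => Y n k) (c k)) ->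
  (\forall n \near F, herm (Y n)) -> herm c.
Proof.
move=> Yc YH k; apply: (ccvg_unique (Yc (- k))).
apply: (@ccvg_squeeze _ _ _ _ _ _ (fun n => nc (Y n k - c k))); last exact: Yc.
by apply: filterS YH => n ->; rewrite -conjcB nc_conj.
Qed.

(** The error depends on [y] through [B] only; hence coefficientwise limits of a
    bounded family may be taken inside the infinite sum. *)
Lemma quad_tail y B k L : hseq s y B -> 1 / 2 < s ->
  nc (quad S y y k - \sum_(n <- box L) qterm S y y k n) <=
  C * W mu k * (Mconst (s - 0) * B) * B / L.+1%:R.
Proof.
move=> hy s2; have [B0 _ _] := hy.
have l1 : sumle (fun n => W 0 n * nc (y n)) (Mconst (s - 0) * B).
  by apply: hseq_l1 hy; rewrite subr0.
have E n : W 0 n * nc (y n) = nc (y n) by rewrite /W powRr0 mul1r.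
apply: (zsum_tail (quad_zsum kS k s0 hy hy)) => M LM.
apply: (@le_trans _ _ (\sum_(n <- box M) C * W mu k * (B / L.+1%:R) * (W 0 (k - n) * nc (y (k - n))))).
  apply: ler_sum => n _; case: ifPn => [_|]; first by rewrite !mulr_ge0 ?W_ge0 ?nc_ge0 ?invr_ge0.
  rewrite mem_box -ltnNge => nL.
  apply: (le_trans (qterm_le1 kS _ _ _ _)); rewrite E.
  rewrite [leRHS](_ : _ = C * W mu k * (nc (y (k - n)) * (B / L.+1%:R))); last by ring.
  rewrite ler_wpM2l ?mulr_ge0 ?W_ge0// ler_wpM2l ?nc_ge0// ler_pdivlMr//.
  have n0 : n != 0 by apply: contraTneq nL => ->.
  apply: le_trans (hseq_term n s0 hy); rewrite mulrC ler_wpM2r ?nc_ge0//.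
  by apply: le_trans (@le_W R 1 s n n0 s1); rewrite W1 -abszE -pmulrn ler_nat.
rewrite -mulr_sumr.
rewrite [leRHS](_ : _ = C * W mu k * (B / L.+1%:R) * (Mconst (s - 0) * B)); last by ring.
rewrite ler_wpM2l ?mulr_ge0 ?W_ge0 ?invr_ge0//.
by apply: (sumle_reflect k l1) => n; rewrite mulr_ge0 ?W_ge0 ?nc_ge0.
Qed.

Lemma burgers_lim Y c (B : R) k :
  (forall k, ccvg F (fun n => Y n k) (c k)) ->
  (\forall n \near F, hseq s (Y n) B) ->
  ccvg F (fun n => burgers S (Y n) k) (burgers S c k).
Proof.
move=> Yc YB; apply: ccvgZ.
have hc : hseq s c B by apply: (hseq_lim Yc YB); exact: cvg_cst.
have [B0 _ _] := hc.
have s2 : 1 / 2 < s by have := s1; lra.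
rewrite /ccvg; apply/cvgrPdist_le => e e0.
set A := C * W mu k * (Mconst (s - 0) * B) * B.
have A0 : 0 <= A by rewrite !mulr_ge0 ?W_ge0 ?Mconst_ge0.
have [L hL] : exists L : nat, A / L.+1%:R <= e / 3.
  exists (Num.bound (3 * A / e)).
  rewrite ler_pdivrMr// mulrC -ler_pdivrMr ?divr_gt0//.
  have -> : A / (e / 3) = 3 * A / e by field; rewrite gt_eqF.
  have h : 0 <= 3 * A / e := divr_ge0 (mulr_ge0 (ler0n R 3) A0) (ltW e0).
  by apply/ltW; apply: lt_le_trans (archi_boundP h) _; rewrite ler_nat.
have hfin : ccvg F (fun n => \sum_(m <- box L) qterm S (Y n) (Y n) k m)
    (\sum_(m <- box L) qterm S c c k m).
  apply: ccvg_sum => m; rewrite /qterm; apply: ccvgM; last exact: Yc.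
  by apply: ccvgZ; exact: Yc.
have e3 : 0 < e / 3 by rewrite divr_gt0.
move/cvgrPdist_le : hfin => /(_ _ e3) hfin.
apply: filterS2 YB hfin => n hY; rewrite !sub0r !normrN !(ger0_norm (nc_ge0 _)) => hf.
have t1 := quad_tail k L hY s2; have t2 := quad_tail k L hc s2.
have -> : quad S (Y n) (Y n) k - quad S c c k =
  (quad S (Y n) (Y n) k - \sum_(m <- box L) qterm S (Y n) (Y n) k m) +
  (\sum_(m <- box L) qterm S (Y n) (Y n) k m - \sum_(m <- box L) qterm S c c k m) +
  (\sum_(m <- box L) qterm S c c k m - quad S c c k) by ring.
have -> : e = e / 3 + e / 3 + e / 3 by field.
apply: le_trans (ncD _ _) _; apply: lerD.
  by apply: le_trans (ncD _ _) _; apply: lerD => //; apply: le_trans hL.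
by rewrite ncB; apply: le_trans hL.
Qed.

End SequenceLimits.

Section Existence.
Variable R : realType.
Variables (mu C s Cs : R) (S : int -> int -> int -> R[i]).
Hypothesis kS : kernel mu C S.
Hypothesis hCs : symbol_bound s Cs.
Hypothesis sr : 1 / 2 < s - mu - 1.
Let mu0 := ker_mu kS.
Let C0 := ker_C kS.
Let s1 : 1 <= s := sobolev_index_ge1 kS sr.
Let s0 : 0 <= s := le_trans ler01 s1.
Let K := growth mu C s Cs.
Let K0 : 0 <= K := growth_ge0 kS hCs.
Implicit Types (y z f : int -> R[i]).
Local Notation mesh := (mesh mu C s).
Local Notation q := (quad_const mu C s).

(** Constant of the second order remainder of the trajectories, on the ball of
    radius [B]. It depends on the frequency, which is harmless: differentiability
    is needed for one coefficient at a time. *)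
Definition remainder_const (B : R) (k : int) : R :=
  C * W (1 + mu) k * (q * B * B * (Mconst (s - 0) * B + Mconst (s - 0) * B)).

Section Trajectory.
Variables (n : nat) (e T B : R) (f : int -> R[i]).
Hypothesis e1 : `|e| <= 1.
Let h := mesh n.
Let h0 : 0 <= h := ltW (mesh_gt0 mu C s n).
Let y j := euler S n (e * h) f j.
Hypothesis yB : forall j, j%:R * h <= T -> hseq s (y j) B.

Lemma euler_increment j p m : (j + p)%:R * h <= T ->
  nc (y (j + p) m - y j m) <= p%:R * h * (q * B * B).
Proof.
elim: p => [|p IH]; first by rewrite addn0 subrr nc0 !mul0r.
rewrite addnS => hT.
have hT' : (j + p)%:R * h <= T.
  by apply: le_trans hT; rewrite ler_wpM2r// ler_nat.
have hb : nc (burgers S (y (j + p)) m) <= q * B * B.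
  apply: (@hseq_sup _ (s - 1)); first by rewrite subr_ge0.
  apply: (hseq_burgers kS) (yB hT') => //; have m0 : 0 <= mu := mu0; have := sr; lra.
have -> : y (j + p).+1 m - y j m = (y (j + p) m - y j m) +
    (e * h)%:C * proj n (burgers S (y (j + p))) m by rewrite /y/=; ring.
apply: le_trans (ncD _ _) _.
rewrite -natr1 !mulrDl mul1r lerD ?IH// ncM nc_real.
rewrite normrM (ger0_norm h0) ler_pM ?nc_ge0 ?mulr_ge0//.
  by rewrite ler_piMl.
rewrite /proj; case: ifP => // _; rewrite nc0; apply: le_trans hb; exact: nc_ge0.
Qed.

(** Each of the [p] steps uses the right-hand side at a node at most [r] steps
    away from [l], where it differs by a multiple of [r%:R * h]. The base node [l]
    is arbitrary in the range, so that one induction covers both [l = j] and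
    [l = j + r]. *)
Lemma euler_remainder p r j l k : (p <= r)%N -> (j <= l <= j + r)%N ->
  (j + r)%:R * h <= T -> k \in box n ->
  nc (y (j + p) k - y j k - (p%:R * (e * h))%:C * burgers S (y l) k)
   <= p%:R * h * (r%:R * h * remainder_const B k).
Proof.
move=> + /andP[jl lr] hT kn.
have tm i : (i <= j + r)%N -> i%:R * h <= T.
  by move=> ir; apply: le_trans hT; rewrite ler_wpM2r// ler_nat.
have B0 : 0 <= B by have [] := yB (tm _ (leq_addr r j)).
have d0 : 0 <= r%:R * h * (q * B * B).
  by rewrite mulr_ge0 ?(mulr_ge0 _ h0)// (mulr_ge0 (mulr_ge0 (quad_const_ge0 kS s) B0) B0).
elim: p => [|p IH] pr.
  have E0 : (0%:R * (e * h))%:C = 0 :> R[i] by rewrite mul0r.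
  by rewrite addn0 subrr E0 !mul0r subr0 nc0.
rewrite addnS; have jp : (j + p <= j + r)%N by rewrite leq_add2l ltnW.
have -> : y (j + p).+1 k - y j k - (p.+1%:R * (e * h))%:C * burgers S (y l) k =
   (y (j + p) k - y j k - (p%:R * (e * h))%:C * burgers S (y l) k) +
   (e * h)%:C * (burgers S (y (j + p)) k - burgers S (y l) k).
  rewrite /y/= /proj kn -natr1 mulrDl mul1r rmorphD/=; ring.
apply: le_trans (ncD _ _) _.
rewrite -natr1 !mulrDl mul1r lerD//; first by apply: IH; exact: ltnW.
rewrite ncM nc_real normrM (ger0_norm h0).
have l1 i : (i <= j + r)%N -> sumle (fun m => nc (y i m)) (Mconst (s - 0) * B).
  move=> ir; have := hseq_l1 (r := 0) _ (yB (tm _ ir)).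
  under eq_fun do rewrite /W powRr0 mul1r.
  by apply; rewrite subr0; have := s1; lra.
have lip := burgers_lip kS k s0 (yB (tm _ jp)) (yB (tm _ lr)) _ (l1 _ jp) (l1 _ lr).
apply: ler_pM; rewrite ?mulr_ge0 ?nc_ge0//.
  by rewrite ler_piMl.
rewrite [leRHS](_ : _ = C * W (1 + mu) k *
    (r%:R * h * (q * B * B) * (Mconst (s - 0) * B + Mconst (s - 0) * B)));
  last by rewrite /remainder_const; ring.
apply: lip => m.
have inc i i' : (i <= i')%N -> (i' <= j + r)%N -> (i' - i <= r)%N ->
    nc (y i' m - y i m) <= r%:R * h * (q * B * B).
  move=> ii' i'r dr.
  have := @euler_increment i (i' - i) m; rewrite subnKC// => /(_ (tm _ i'r)).
  move/le_trans; apply.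
  rewrite ler_wpM2r ?(mulr_ge0 (mulr_ge0 (quad_const_ge0 kS s) B0) B0)//.
  by rewrite ler_wpM2r// ler_nat.
have [lp|pl] := leqP l (j + p).
  by apply: inc => //; rewrite leq_subLR; apply: leq_trans jp _; rewrite leq_add2r.
rewrite ncB; apply: inc => //; first exact: ltnW.
by rewrite leq_subLR; apply: leq_trans lr _; rewrite leq_add2r leq_addr.
Qed.

(** The nodes come in both orders, as two-sided derivatives are sought. *)
Lemma euler_taylor j j' k : j%:R * h <= T -> j'%:R * h <= T -> k \in box n ->
  nc (y j' k - y j k - ((j'%:R - j%:R) * (e * h))%:C * burgers S (y j) k)
   <= ((j'%:R - j%:R) * h) ^+ 2 * remainder_const B k.
Proof.
move=> jT j'T kn; have [jj'|/ltnW j'j] := leqP j j'.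
  have := @euler_remainder (j' - j) (j' - j) j j k (leqnn _).
  rewrite leqnn leq_addr subnKC// => /(_ isT j'T kn).
  by rewrite natrB// => /le_trans; apply; rewrite expr2 mulrA.
have := @euler_remainder (j - j') (j - j') j' j k (leqnn _).
rewrite subnKC// j'j leqnn => /(_ isT jT kn).
rewrite natrB// -ncN => /le_trans hh.
rewrite (_ : _ - _ - _ = - (y j k - y j' k - ((j%:R - j'%:R) * (e * h))%:C * burgers S (y j) k)).
  by apply: hh; apply: le_of_eq; ring.
rewrite -[j%:R - j'%:R]opprB mulNr rmorphN/=; ring.
Qed.

End Trajectory.

Section Limit.
Variable U : set_system nat.
Context {UU : UltraFilter U}.
Hypothesis oU : \oo `<=` U.
Variables (e rho : R) (f : int -> R[i]).
Hypothesis e1 : `|e| <= 1.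
Hypothesis hf : hseq s f rho.
Hypothesis Hf : herm f.

Definition node (n : nat) (t : R) : nat := Num.truncn (t / mesh n).
Definition approx (n : nat) (t : R) : int -> R[i] :=
  euler S n (e * mesh n) f (node n t).
Definition limsol (t : R) (k : int) : R[i] := ulim U (fun n => approx n t k).

Lemma node_le n t : 0 <= t -> (node n t)%:R * mesh n <= t.
Proof.
move=> t0; rewrite -ler_pdivlMr ?mesh_gt0//.
by have /andP[] := truncn_itv (divr_ge0 t0 (ltW (mesh_gt0 mu C s n))).
Qed.

Lemma node_cvg t : 0 <= t -> (node n t)%:R * mesh n @[n --> U] --> t.
Proof.
move=> t0; apply: (@cvg_trans _ ((node n t)%:R * mesh n @[n --> \oo])).
  exact: cvg_app.
have h0 : t - n.+1%:R^-1 @[n --> \oo] --> t.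
  by rewrite -[X in _ --> X]subr0; apply: cvgB; [exact: cvg_cst|exact: cvg_harmonic].
apply: (squeeze_cvgr _ h0 (cvg_cst t)).
apply: nearW => n; rewrite node_le// andbT lerBlDr.
have /andP[_] := truncn_itv (divr_ge0 t0 (ltW (mesh_gt0 mu C s n))).
rewrite ltr_pdivrMr ?mesh_gt0// -natr1 mulrDl mul1r => /ltW /le_trans; apply.
by rewrite lerD2l mesh_le.
Qed.

Lemma approx_bound T : 0 <= T -> K * rho * T < 1 ->
  exists n0 : nat, forall n, (n0 <= n)%N -> forall j, j%:R * mesh n <= T ->
    hseq s (euler S n (e * mesh n) f j) (2 * rho / (1 - K * rho * T)).
Proof.
move=> T0 KT; have [n0 hn0] := euler_bound_eventually kS hCs sr hf Hf T0 KT.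
exists n0 => n /hn0[_ [le2 h]] j jT; have [h1 _] := h e j e1 jT.
exact: hseq_le h1.
Qed.

Lemma limsol_cvg t k : 0 <= t -> K * rho * t < 1 ->
  ccvg U (fun n => approx n t k) (limsol t k).
Proof.
move=> t0 Kt; have [n0 hn0] := approx_bound t0 Kt.
apply: (@ulimP R U UU _ (2 * rho / (1 - K * rho * t))).
apply: oU; exists n0 => // n /= n0n.
apply: (hseq_sup k s0); apply: hn0 => //; exact: node_le.
Qed.

Lemma limsol_hseq t : 0 <= t -> K * rho * t < 1 ->
  hseq s (limsol t) (rho / (1 - K * rho * t)) /\ herm (limsol t).
Proof.
move=> t0 Kt; have [n0 hn0] := euler_bound_eventually kS hCs sr hf Hf t0 Kt.
split.
  apply: (@hseq_lim R s U _ (fun n => approx n t) _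
    (fun n => rho / (1 - growth_n mu C s Cs n * rho * t))).
  - by move=> k; exact: limsol_cvg.
  - apply: oU; exists n0 => // n /= /hn0[_ [_ h]].
    by have [] := h e _ e1 (node_le n t0).
  apply: cvgM; first exact: cvg_cst.
  apply: cvgV; first by rewrite gt_eqF// subr_gt0.
  apply: cvgB; first exact: cvg_cst.
  apply: cvgM; last exact: cvg_cst.
  apply: cvgM; last exact: cvg_cst.
  rewrite -[X in _ --> X]addr0; apply: cvgD; first exact: cvg_cst.
  apply: (@cvg_trans _ (n.+1%:R^-1 @[n --> \oo])); first exact: cvg_app.
  exact: cvg_harmonic.
apply: (@herm_lim R U _ (fun n => approx n t)); first by move=> k; exact: limsol_cvg.
apply: oU; exists n0 => // n /= /hn0[_ [_ h]].
by have [] := h e _ e1 (node_le n t0).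
Qed.

Lemma limsol0 k : limsol 0 k = f k.
Proof.
have K1 : K * rho * 0 < 1 by rewrite mulr0.
apply: (ccvg_unique (limsol_cvg k (lexx 0) K1)).
apply: (@ccvg_squeeze _ _ _ _ _ _ (fun=> 0)); last exact: cvg_cst.
apply: oU; exists `|k|%N => // n /= kn.
rewrite /approx /node mul0r truncn0/= /proj mem_box kn subrr nc0//.
Qed.

Lemma limsol_taylor T t t' k : K * rho * T < 1 -> 0 <= t <= T -> 0 <= t' <= T ->
  nc (limsol t' k - limsol t k - ((t' - t) * e)%:C * burgers S (limsol t) k)
   <= (t' - t) ^+ 2 * remainder_const (2 * rho / (1 - K * rho * T)) k.
Proof.
move=> KT /andP[t0 tT] /andP[t'0 t'T].
have T0 : 0 <= T by apply: le_trans tT.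
have [rho0 _ _] := hf.
have Ku u : u <= T -> K * rho * u < 1.
  by move=> uT; apply: le_lt_trans KT; rewrite ler_wpM2l// mulr_ge0.
have [n0 hn0] := approx_bound T0 KT.
set B := 2 * rho / _ in hn0 *.
have nodeT n u : 0 <= u -> u <= T -> (node n u)%:R * mesh n <= T.
  by move=> u0; apply: le_trans; exact: node_le.
have dcvg : ((node n t')%:R - (node n t)%:R) * mesh n @[n --> U] --> t' - t.
  under eq_fun do rewrite mulrBl.
  by apply: cvgB; exact: node_cvg.
have bcvg : ccvg U (fun n => burgers S (approx n t) k) (burgers S (limsol t) k).
  apply: (@burgers_lim R mu C s S kS s1 U _ (fun n => approx n t) _ B).
    by move=> m; apply: limsol_cvg => //; exact: Ku.
  by apply: oU; exists n0 => // n /= n0n; apply: hn0 => //; exact: nodeT.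
have lcvg : ccvg U (fun n => approx n t' k - approx n t k -
    (((node n t')%:R - (node n t)%:R) * (e * mesh n))%:C * burgers S (approx n t) k)
   (limsol t' k - limsol t k - ((t' - t) * e)%:C * burgers S (limsol t) k).
  apply: ccvgD.
    by apply: ccvgD; [|apply: ccvgN]; apply: limsol_cvg => //; exact: Ku.
  apply: ccvgN; apply: ccvgM => //.
  apply: (@ccvg_squeeze _ _ _ _ _ _ (fun n =>
     `|(((node n t')%:R - (node n t)%:R) * (e * mesh n)) - (t' - t) * e|)).
    by apply: nearW => n; rewrite -rmorphB nc_real.
  have h : ((node n t')%:R - (node n t)%:R) * (e * mesh n) - (t' - t) * e
      @[n --> U] --> (t' - t) * e - (t' - t) * e.
    apply: cvgB; last exact: cvg_cst.
    under eq_fun do rewrite [e * _]mulrC mulrA.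
    by apply: cvgM => //; exact: cvg_cst.
  by have h2 := cvg_norm h; rewrite [X in `|X|]subrr normr0 in h2; exact: h2.
apply: (ccvg_le lcvg (e := fun n => (((node n t')%:R - (node n t)%:R) * mesh n) ^+ 2 * remainder_const B k)).
  apply: cvgM; last exact: cvg_cst.
  by rewrite expr2; under eq_fun do rewrite expr2; exact: cvgM.
apply: oU; exists (maxn n0 `|k|)%N => // n /=; rewrite geq_max => /andP[n0n kn].
apply: (euler_taylor (T := T)) => //; first by move=> j jT; exact: hn0.
- exact: nodeT.
- exact: nodeT.
by rewrite mem_box.
Qed.

End Limit.

Lemma lifespan_open (a t : R) : 0 <= a -> a * `|t| < 1 ->
  exists dl : R, 0 < dl /\ a * (`|t| + dl) < 1.
Proof.
move=> a0 at1; exists ((1 - a * `|t|) / (2 * (a + 1))).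
split; first by rewrite divr_gt0 ?subr_gt0// mulr_gt0// ltr_wpDl.
rewrite mulrDr -ltrBrDl mulrA ltr_pdivrMr ?mulr_gt0 ?ltr_wpDl//.
have : 0 < 1 - a * `|t| by rewrite subr_gt0.
move: (1 - _) => b b0; rewrite mulrC ltr_pM2l//; lra.
Qed.

(** The solutions in the two directions of time are glued at the origin, where
    the Taylor inequalities on the two sides have the same first order term. The
    other times have a neighbourhood on which a single branch is used. *)
Lemma coef_existence f rho : hseq s f rho -> herm f ->
  exists c : R -> int -> R[i], (forall k, c 0 k = f k) /\
   forall t, K * rho * `|t| < 1 ->
    [/\ hseq s (c t) (rho / (1 - K * rho * `|t|)), herm (c t) &
        forall k, cderiv (fun u => c u k) t (burgers S (c t) k)].
Proof.
move=> hf Hf; have [rho0 _ _] := hf.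
have [U [UU oU]] := @ultraFilterLemma nat \oo _.
have e1 : `|1 : R| <= 1 by rewrite normr1.
have e1' : `|-1 : R| <= 1 by rewrite normrN1.
pose c t : int -> R[i] := if 0 <= t then limsol U 1 f t else limsol U (-1) f (- t).
have cpos t : 0 <= t -> c t = limsol U 1 f t by move=> t0; rewrite /c t0.
have cneg t : t <= 0 -> c t = limsol U (-1) f (- t).
  rewrite le_eqVlt => /orP[/eqP->|t0]; last by rewrite /c leNgt t0.
  apply/funext => k.
  by rewrite /c lexx oppr0 (limsol0 oU e1 hf Hf) (limsol0 oU e1' hf Hf).
exists c; split; first by move=> k; rewrite cpos// (limsol0 oU e1 hf Hf).
move=> t Kt.
have [hct Hct] : hseq s (c t) (rho / (1 - K * rho * `|t|)) /\ herm (c t).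
  have [t0|/ltW t0] := leP 0 t.
    by rewrite cpos// ger0_norm//; apply: limsol_hseq => //; rewrite -(ger0_norm t0).
  rewrite cneg// ler0_norm//; apply: limsol_hseq => //; first by rewrite oppr_ge0.
  by rewrite -(ler0_norm t0).
split => // k.
have [dl [dl0 KT]] := lifespan_open (mulr_ge0 K0 rho0) Kt.
pose T := `|t| + dl; rewrite -/T in KT.
pose D := remainder_const (2 * rho / (1 - K * rho * T)) k.
have pos u u' : 0 <= u <= T -> 0 <= u' <= T ->
    nc (c u' k - c u k - (u' - u)%:C * burgers S (c u) k) <= D * (u' - u) ^+ 2.
  move=> /[dup] uT /andP[u0 _] /[dup] u'T /andP[u'0 _].
  have := @limsol_taylor U UU oU 1 rho f e1 hf Hf T u u' k KT uT u'T.
  by rewrite -!cpos// mulr1 => hh; rewrite [leRHS]mulrC.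
have neg u u' : - T <= u <= 0 -> - T <= u' <= 0 ->
    nc (c u' k - c u k - (u' - u)%:C * burgers S (c u) k) <= D * (u' - u) ^+ 2.
  move=> /andP[uT u0] /andP[u'T u'0].
  have := @limsol_taylor U UU oU (-1) rho f e1' hf Hf T (- u) (- u') k KT.
  rewrite -!cneg// !oppr_ge0 u0 u'0 lerNl uT lerNl u'T => /(_ isT isT).
  have -> : (- u' - - u) * -1 = u' - u by ring.
  have -> : (- u' - - u) ^+ 2 = (u' - u) ^+ 2 by ring.
  by move=> hh; rewrite [leRHS]mulrC.
have T0 : 0 < T by apply: ltr_wpDl.
have tT : `|t| < T by rewrite /T ltrDl.
have [t0|t0|t0] := ltgtP 0 t.
- apply: (@cderiv_quadratic _ _ _ _ D (Num.min t (T - `|t|))).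
    by rewrite lt_min t0 subr_gt0.
  move=> h; rewrite lt_min => /andP[h1 h2].
  move: h1 h2; rewrite (gtr0_norm t0) in tT * => h1 h2.
  have := pos t (t + h); rewrite [t + h - t]addrAC subrr add0r; apply.
    by rewrite !ltW.
  by move: h1 h2; rewrite !ltr_norml => /andP[? ?] /andP[? ?]; apply/andP; split; lra.
- apply: (@cderiv_quadratic _ _ _ _ D (Num.min (- t) (T - `|t|))).
    by rewrite lt_min oppr_gt0 t0 subr_gt0.
  move=> h; rewrite lt_min => /andP[h1 h2].
  move: h1 h2; rewrite (ltr0_norm t0) in tT * => h1 h2.
  have := neg t (t + h); rewrite [t + h - t]addrAC subrr add0r; apply.
    by apply/andP; split; lra.
  by move: h1 h2; rewrite !ltr_norml => /andP[? ?] /andP[? ?]; apply/andP; split; lra.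
- apply: (@cderiv_quadratic _ _ _ _ D T) => // h hT.
  rewrite -t0 in tT *.
  have [h0|/ltW h0] := leP 0 h.
    have := pos 0 (0 + h); rewrite add0r subr0; apply; first by rewrite lexx ltW.
    by rewrite h0 -(ger0_norm h0) ltW.
  have := neg 0 (0 + h); rewrite add0r subr0; apply; first by rewrite lexx lerNl oppr0 ltW.
  by rewrite h0 andbT lerNl -(ler0_norm h0) ltW.
Qed.

End Existence.

(** * Continuity and differentiability in Sobolev norms *)

Section NormConvergence.
Variable R : realType.
Implicit Types (y c d : int -> R[i]) (s A B : R).

Definition snorm s c : R := Num.sqrt (psum (fun k => (W s k * nc (c k)) ^+ 2)).

Lemma snorm_ge0 s c : 0 <= snorm s c. Proof. exact: sqrtr_ge0. Qed.

Lemma psum_ge0 (x : int -> R) A : (forall k, 0 <= x k) -> sumle x A -> 0 <= psum x.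
Proof.
move=> x0 xA; apply: le_trans (psum_sumle xA 0%N); exact: sumr_ge0.
Qed.

Lemma hseq_snorm s c B : hseq s c B -> hseq s c (snorm s c).
Proof.
move=> [B0 c0 cB]; split; [exact: snorm_ge0|by []|].
rewrite sqr_sqrtr; first exact: psum_sumle cB.
by apply: (psum_ge0 _ cB) => k; exact: sqr_ge0.
Qed.

(** A box that carries almost all of the norm of the limit carries almost all of
    the norm of [Y x] too, because the bounds [b x] do not exceed the norm of the
    limit asymptotically: both tails are small. *)
Lemma strong_convergence s (T : topologicalType) (F : set_system T)
  {FF : ProperFilter F} (Y : T -> int -> R[i]) c (b : T -> R) A :
  hseq s c A ->
  (forall k, ccvg F (fun x => Y x k) (c k)) ->
  (\forall x \near F, hseq s (Y x) (b x)) ->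
  b x @[x --> F] --> snorm s c ->
  forall e, 0 < e -> \forall x \near F, hseq s (fun k => Y x k - c k) e.
Proof.
move=> hA Yc Yb bn e e0.
have [r0 c0 cr] := hseq_snorm hA.
set r := snorm s c in r0 cr bn *.
pose w y k := (W s k * nc (y k)) ^+ 2.
have w0 y k : 0 <= w y k by exact: sqr_ge0.
(* The box contributes [n] to the squared norm, the two tails at most
   [2 * (3 * n) + 2 * n]: in total [9 * n]. *)
pose n := e ^+ 2 / 9.
have n0 : 0 < n by rewrite divr_gt0 ?exprn_gt0.
have [L hL] : exists L, r ^+ 2 - n < \sum_(k <- box L) w c k.
  have [_ _ cA] := hA.
  have hs : has_sup [set \sum_(k <- box N) w c k | N in [set: nat]].
    by split; [exists (\sum_(k <- box 0) w c k), 0%N|exists (A ^+ 2) => _ [M _ <-]; exact: cA].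
  have [_ [L _ <-] h] := sup_adherent n0 hs; exists L.
  rewrite /r /snorm sqr_sqrtr//; apply: psum_ge0 cA => k; exact: sqr_ge0.
have Wcvg (y : T -> int -> R[i]) (l : int -> R[i]) : (forall k, ccvg F (fun x => y x k) (l k)) ->
    \sum_(k <- box L) w (y x) k @[x --> F] --> \sum_(k <- box L) w l k.
  move=> yl; apply: cvg_sumr => k; rewrite /w expr2.
  under eq_fun do rewrite expr2.
  by apply: cvgM; apply: cvgM; [exact: cvg_cst|exact: ccvg_nc|exact: cvg_cst|exact: ccvg_nc].
have h1 := Wcvg Y c Yc.
have h2 : \sum_(k <- box L) w (fun k => Y x k - c k) k @[x --> F] --> 0.
  have z0 : \sum_(k <- box L) w (fun=> 0) k = 0.
    by rewrite big1// => k _; rewrite /w nc0 mulr0 expr0n.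
  have h : forall k, ccvg F (fun x => Y x k - c k) 0.
    by move=> k; have := ccvgD (Yc k) (ccvg_cst (F := F) (- c k)); rewrite subrr; exact.
  by have h2 := Wcvg _ _ h; rewrite z0 in h2.
have h3 : b x ^+ 2 @[x --> F] --> r ^+ 2.
  by rewrite expr2; under eq_fun do rewrite expr2; exact: cvgM.
move/cvgrPdist_lt : h1 => /(_ _ n0) h1.
move/cvgrPdist_lt : h2 => /(_ _ n0) h2.
move/cvgrPdist_lt : h3 => /(_ _ n0) h3.
near=> x.
have Y1 : `|\sum_(k <- box L) w c k - \sum_(k <- box L) w (Y x) k| < n by near: x.
have Y2 : `|0 - \sum_(k <- box L) w (fun k => Y x k - c k) k| < n by near: x.
have Y3 : `|r ^+ 2 - b x ^+ 2| < n by near: x.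
have Yx : hseq s (Y x) (b x) by near: x.
have [_ Y0 Yxb] := Yx.
split; [exact: ltW|by rewrite Y0 c0 subrr|move=> M].
pose P := maxn L M.
apply: (@le_trans _ _ (\sum_(k <- box P) w (fun k => Y x k - c k) k)).
  apply: (@le_sum_sub R _ _ (w (fun k => Y x k - c k))); first exact: uniq_box.
    by apply: box_sub; exact: leq_maxr.
  by move=> k; exact: w0.
have LP : {subset box L <= box P} by apply: box_sub; exact: leq_maxl.
have split_ (y : int -> R[i]) := sum_split_box (w y) (uniq_box P) LP.
set t := [seq j <- box P | j \notin box L] in split_.
have t1 : \sum_(k <- t) w c k <= n.
  have := cr P; rewrite (split_ c) => h.
  by rewrite -(lerD2l (\sum_(k <- box L) w c k)); apply: le_trans h _; rewrite -lerBlDr ltW.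
have t2 : \sum_(k <- t) w (Y x) k <= 3 * n.
  have := Yxb P; rewrite (split_ (Y x)) => h.
  move: Y1 Y3; rewrite !ltr_norml => /andP[? ?] /andP[? ?]; lra.
rewrite split_.
have t3 : \sum_(k <- t) w (fun k => Y x k - c k) k <=
    2 * \sum_(k <- t) w (Y x) k + 2 * \sum_(k <- t) w c k.
  rewrite !mulr_sumr -big_split/=; apply: ler_sum => k _; rewrite /w !exprMn.
  rewrite [leRHS](_ : _ = W s k ^+ 2 * (2 * nc (Y x k) ^+ 2 + 2 * nc (c k) ^+ 2)); last by ring.
  rewrite ler_wpM2l ?sqr_ge0//.
  have h : nc (Y x k - c k) <= nc (Y x k) + nc (c k) by rewrite -(ncN (c k)) ncD.
  have := sqr_ge0 (nc (Y x k) - nc (c k)).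
  have : nc (Y x k - c k) ^+ 2 <= (nc (Y x k) + nc (c k)) ^+ 2.
    by rewrite ler_pXn2r ?nnegrE ?addr_ge0 ?nc_ge0.
  nra.
have en : e ^+ 2 = 9 * n by rewrite /n; field.
move: Y2; rewrite sub0r normrN ger0_norm ?sumr_ge0// => Y2.
rewrite en; lra.
Unshelve. all: by end_near. Qed.

End NormConvergence.

Section Regularity.
Variable R : realType.
Variables (mu C s : R) (S : int -> int -> int -> R[i]).
Hypothesis kS : kernel mu C S.
Hypothesis sr : 1 / 2 < s - mu - 1.
Let s1 : 1 <= s := sobolev_index_ge1 kS sr.
Let s0 : 0 <= s := le_trans ler01 s1.

Lemma burgersB_hseq (y z : int -> R[i]) A B D :
  hseq s y A -> hseq s z A -> hseq s (fun k => y k - z k) D -> 2 * A <= B ->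
  hseq (s - 1) (fun k => burgers S y k - burgers S z k) (quad_const mu C s * D * B).
Proof.
move=> hy hz hw AB.
have sm : 1 / 2 < s - mu by have := sr; lra.
have hv : hseq s (fun k => y k + z k) B.
  by apply: hseq_le (hseqD hy hz); rewrite -mulr2n -mulr_natl.
have [h0 hq0 hq] := hseq_quad kS s0 sm hw hv.
have E k : burgers S y k - burgers S z k = - ('i * k%:~R) *
    quad S (fun k => y k - z k) (fun k => y k + z k) k.
  by rewrite /burgers -mulrBr (quadBD kS k s0 hy hz).
split => //; first by rewrite !burgers0 subrr.
apply: le_sumle hq => k; rewrite E.
have [->|k0] := eqVneq k 0; first by rewrite mulr0 oppr0 mul0r nc0 mulr0 expr0n sqr_ge0.
by rewrite ncM nc_ik mulrA -WD// subrK.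
Qed.

Lemma is_derive_pair (y : R -> R[i]) (t : R) (a d : R[i]) : cderiv y t d ->
  is_derive t 1 (fun u => Rez (a * y u)) (Rez (a * d)).
Proof.
move=> [h1 h2]; rewrite RezM; under eq_fun do rewrite RezM.
have z1 := @is_deriveZ R R R _ (Rez a) t 1 _ h1.
have z2 := @is_deriveZ R R R _ (Imz a) t 1 _ h2.
exact: (@is_deriveB R R R _ _ t 1 _ _ z1 z2).
Qed.

Lemma is_deriveZr (f : R -> R) (t a d : R) : is_derive t 1 f d ->
  is_derive t 1 (fun u => a * f u) (a * d).
Proof. by move=> h; exact: (@is_deriveZ R R R f a t 1 _ h). Qed.

(** Mean value inequality in a Sobolev norm. The mean value theorem is applied
    to the scalar function obtained by testing the path against the difference [d]
    that is to be estimated, then Cauchy--Schwarz. *)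
Lemma mean_value_hseq r (c : R -> int -> R[i]) (g : int -> R[i])
    (G : R -> int -> R[i]) (t h e : R) : h != 0 -> 0 <= e ->
  c t 0 = 0 -> c (t + h) 0 = 0 -> g 0 = 0 ->
  (forall u, 0 <= u <= 1 -> hseq r (fun k => G (t + h * u) k - g k) e /\
     forall k, cderiv (fun v => c v k) (t + h * u) (G (t + h * u) k)) ->
  hseq r (fun k => (h^-1)%:C * (c (t + h) k - c t k) - g k) e.
Proof.
move=> h0 e0 ct0 cth0 g0 H.
pose d k := (h^-1)%:C * (c (t + h) k - c t k) - g k.
have hh : h%:C * (h^-1)%:C = 1 :> R[i] by rewrite -rmorphM mulfV.
split => //; first by rewrite ct0 cth0 g0 !subr0 mulr0.
move=> N.
pose X := \sum_(k <- box N) (W r k * nc (d k)) ^+ 2.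
pose phi (u : R) := \sum_(k <- box N) W r k ^+ 2 *
  Rez (cj (d k) * (c (t + h * u) k - (h * u)%:C * g k)).
pose dphi (u : R) := \sum_(k <- box N) W r k ^+ 2 *
  Rez (cj (d k) * (h%:C * (G (t + h * u) k - g k))).
have phid (u : R) : 0 <= u <= 1 -> is_derive u 1 phi (dphi u).
  move=> u01; apply: is_derive_sumr => k; apply: is_deriveZr; apply: is_derive_pair.
  have [_ hc] := H u u01; have hk := cderiv_affine (hc k).
  rewrite mulrBr; apply: cderivB => //.
  split.
    have E : (fun v => Rez ((h * v)%:C * g k)) = (fun v => Rez (g k) * h * v).
      by apply/funext => v; rewrite RezZ; ring.
    rewrite E RezZ [h * _]mulrC -[X in is_derive _ _ _ X]mulr1.
    by apply: is_deriveZr; exact: is_derive_id.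
  have E : (fun v => Imz ((h * v)%:C * g k)) = (fun v => Imz (g k) * h * v).
    by apply/funext => v; rewrite ImzZ; ring.
  rewrite E ImzZ [h * _]mulrC -[X in is_derive _ _ _ X]mulr1.
  by apply: is_deriveZr; exact: is_derive_id.
have lt01 : (0 : R) < 1 by [].
have [xi xi01 mvt] : exists2 x, x \in `]0, 1[%R & phi 1 - phi 0 = dphi x * (1 - 0).
  apply: (MVT lt01).
    by move=> x; rewrite in_itv/= => /andP[? ?]; apply: phid; rewrite !ltW.
  apply: continuous_in_subspaceT => u; rewrite inE/= in_itv/= => ub.
  exact: is_derive_continuous (phid u ub).
have xi_01 : 0 <= xi <= 1.
  by move: xi01; rewrite in_itv/= => /andP[? ?]; rewrite !ltW.
have phiE : phi 1 - phi 0 = h * X.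
  rewrite /phi /X -sumrB mulr_sumr; apply: eq_bigr => k _.
  rewrite !mulr1 !mulr0 addr0 rmorph0 mul0r subr0 -mulrBr -RezN -RezD -mulrBr.
  have -> : c (t + h) k - h%:C * g k - c t k = h%:C * d k.
    by rewrite /d mulrBr mulrA hh mul1r; ring.
  rewrite [X in Rez X]mulrCA RezZ exprMn.
  have -> : Rez (cj (d k) * d k) = nc (d k) ^+ 2.
    by rewrite nc_sqr RezM RezC ImzC; ring.
  ring.
pose Y := \sum_(k <- box N) W r k ^+ 2 * Rez (cj (d k) * (G (t + h * xi) k - g k)).
have dphiE : dphi xi = h * Y.
  rewrite /dphi /Y mulr_sumr; apply: eq_bigr => k _.
  by rewrite [X in Rez X]mulrCA RezZ; ring.
have XY : X = Y.
  by move: mvt; rewrite phiE dphiE subr0 mulr1 => /(mulfI h0).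
have X0 : 0 <= X by apply: sumr_ge0 => k _; exact: sqr_ge0.
have CS : X ^+ 2 <= X * e ^+ 2.
  rewrite {1}XY; apply: (@le_trans _ _ (X * \sum_(k <- box N) (W r k * nc (G (t + h * xi) k - g k)) ^+ 2)).
    apply: cauchy_schwarz; try by move=> k; exact: sqr_ge0.
    move=> k; rewrite -exprMn.
    rewrite -[leLHS]real_normK ?num_real// ler_pXn2r ?nnegrE ?mulr_ge0 ?W_ge0 ?nc_ge0//.
    rewrite normrM ger0_norm ?sqr_ge0//.
    rewrite [leRHS](_ : _ = W r k ^+ 2 * (nc (d k) * nc (G (t + h * xi) k - g k))); last by ring.
    rewrite ler_wpM2l ?sqr_ge0//; apply: le_trans (normRe_le _) _.
    by rewrite ncM nc_conj.
  by rewrite ler_wpM2l//; have [[_ _ hx] _] := H xi xi_01; exact: hx.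
change (X <= e ^+ 2).
have [Xp|Xn] := ltP 0 X; last exact: le_trans Xn (sqr_ge0 e).
by move: CS; rewrite expr2 ler_pM2l.
Qed.

End Regularity.

Section WellPosed.
Variable R : realType.
Variables (mu C s Cs : R) (S : int -> int -> int -> R[i]).
Hypothesis kS : kernel mu C S.
Hypothesis hCs : symbol_bound s Cs.
Hypothesis sr : 1 / 2 < s - mu - 1.
Let s1 : 1 <= s := sobolev_index_ge1 kS sr.
Let K := growth mu C s Cs.
Let K0 : 0 <= K := growth_ge0 kS hCs.

Lemma cderiv_continuous (y : R -> R[i]) (t : R) d : cderiv y t d ->
  ccvg (nbhs (0 : R)) (fun h => y (t + h)) (y t).
Proof.
move=> [h1 h2].
have cont (f : R -> R) df : is_derive t 1 f df -> f (t + h) @[h --> (0:R)] --> f t.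
  move=> hf.
  have c : {for t, continuous f} by exact: is_derive_continuous hf.
  have sh : t + h @[h --> (0:R)] --> t + 0.
    by apply: cvgD; [exact: cvg_cst|exact: cvg_id].
  rewrite addr0 in sh; exact: (cvg_comp _ _ sh c).
by apply: ccvg_ReIm; [exact: cont h1|exact: cont h2].
Qed.

Definition coef_flow (rho : R) (c : R -> int -> R[i]) : Prop :=
  forall t, K * rho * `|t| < 1 ->
    [/\ hseq s (c t) (rho / (1 - K * rho * `|t|)), herm (c t) &
        forall k, cderiv (fun u => c u k) t (burgers S (c t) k)].

Lemma flow_bound (rho T t : R) : 0 <= rho -> K * rho * T < 1 -> `|t| <= T ->
  K * rho * `|t| < 1 /\ rho / (1 - K * rho * `|t|) <= rho / (1 - K * rho * T).
Proof.
move=> rho0 KT tT.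
have le : K * rho * `|t| <= K * rho * T by rewrite ler_wpM2l// mulr_ge0.
have lt : K * rho * `|t| < 1 by apply: le_lt_trans le KT.
split => //; have h1 : 0 < 1 - K * rho * T by rewrite subr_gt0.
have h2 : 0 < 1 - K * rho * `|t| by rewrite subr_gt0.
by rewrite ler_wpM2l// lef_pV2 ?posrE// lerD2l lerN2.
Qed.

(** Restarting the flow at time [t0] and invoking uniqueness, the growth bound
    holds with [t0] as initial time; hence the norm is upper semicontinuous. *)
Lemma flow_restart rho c t0 : 0 <= rho -> coef_flow rho c -> K * rho * `|t0| < 1 ->
  exists dl : R, 0 < dl /\ forall h, `|h| < dl ->
    hseq s (c (t0 + h)) (snorm s (c t0) / (1 - K * snorm s (c t0) * `|h|)).
Proof.
move=> rho0 hc Kt.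
have [hc0 Hc0 _] := hc t0 Kt.
have hr := hseq_snorm hc0; set r0 := snorm s (c t0) in hr *.
have [r00 _ _] := hr.
have [dl [dl0 KT]] := lifespan_open (mulr_ge0 K0 rho0) Kt.
have K1 : K * r0 * `|0 : R| < 1 by rewrite normr0 mulr0.
have [b1 [b10 Kb1]] := lifespan_open (mulr_ge0 K0 r00) K1.
rewrite normr0 add0r in Kb1.
have [d [d0 hd]] := coef_existence kS hCs sr hr Hc0.
pose b := Num.min dl b1.
have b0 : 0 < b by rewrite lt_min dl0 b10.
exists b; split => // h hb.
have [e [e1 he eu]] := time_direction h.
(* A common bound for the flow and for its restart, as uniqueness requires. *)
pose A := rho / (1 - K * rho * (`|t0| + dl)) + r0 / (1 - K * r0 * b1).
have A1 : 0 <= rho / (1 - K * rho * (`|t0| + dl)) by rewrite divr_ge0// ltW// subr_gt0.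
have A2 : 0 <= r0 / (1 - K * r0 * b1) by rewrite divr_ge0// ltW// subr_gt0.
have oc : bounded_ode S s e b A (fun u => c (t0 + e * u)).
  move=> u /andP[u0 ub].
  have tu : `|t0 + e * u| <= `|t0| + dl.
    apply: le_trans (ler_normD _ _) _; rewrite lerD2l; apply: le_trans (eu u u0) _.
    by apply: le_trans ub _; rewrite ge_min lexx.
  have [Ku le] := flow_bound rho0 KT tu.
  have [h1 h2 h3] := hc _ Ku.
  split => //; last by move=> k; apply: (@cderiv_affine _ (fun u => c u k)).
  by apply: hseq_le h1; apply: le_trans le _; rewrite lerDl.
have od : bounded_ode S s e b A (fun u => d (0 + e * u)).
  move=> u /andP[u0 ub].
  have tu : `|0 + e * u| <= b1.
    rewrite add0r; apply: le_trans (eu u u0) _.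
    by apply: le_trans ub _; rewrite ge_min lexx orbT.
  have [Ku le] := flow_bound r00 Kb1 tu.
  have [h1 h2 h3] := hd _ Ku.
  split => //; last by move=> k; apply: (@cderiv_affine _ (fun u => d u k)).
  by apply: hseq_le h1; apply: le_trans le _; rewrite lerDr.
have hh : 0 <= `|h| <= b by rewrite normr_ge0 ltW.
have start k : c (t0 + e * 0) k = d (0 + e * 0) k by rewrite mulr0 !addr0 d0.
have E := bounded_ode_unique kS sr e1 (ltW b0) oc od start hh.
have -> : c (t0 + h) = d h by apply/funext => k; have := E k; rewrite -he add0r.
have hb1 : `|h| <= b1 by apply: le_trans (ltW hb) _; rewrite ge_min lexx orbT.
have [Kh _] := flow_bound r00 Kb1 hb1.
by have [] := hd _ Kh.
Qed.

Lemma flow_near rho c t0 : 0 <= rho -> coef_flow rho c -> K * rho * `|t0| < 1 ->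
  exists A, \forall h \near (0 : R), hseq s (c (t0 + h)) A /\
    forall k, cderiv (fun u => c u k) (t0 + h) (burgers S (c (t0 + h)) k).
Proof.
move=> rho0 hc Kt; have [dl [dl0 KT]] := lifespan_open (mulr_ge0 K0 rho0) Kt.
exists (rho / (1 - K * rho * (`|t0| + dl))).
exists dl => //= h /=; rewrite sub0r normrN => hdl.
have tu : `|t0 + h| <= `|t0| + dl.
  by apply: le_trans (ler_normD _ _) _; rewrite lerD2l ltW.
have [Ku le] := flow_bound rho0 KT tu.
by have [h1 h2 h3] := hc _ Ku; split => //; apply: hseq_le h1.
Qed.

(** The coefficients are continuous, and by [flow_restart] the norm does not jump
    up; hence [strong_convergence] applies. *)
Lemma flow_continuous rho c t0 : 0 <= rho -> coef_flow rho c ->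
  K * rho * `|t0| < 1 -> forall e, 0 < e ->
  \forall h \near (0 : R), hseq s (fun k => c (t0 + h) k - c t0 k) e.
Proof.
move=> rho0 hc Kt e e0.
have [hct Hct dct] := hc t0 Kt.
have [dl [dl0 hdl]] := flow_restart rho0 hc Kt.
set r := snorm s (c t0) in hdl.
apply: (@strong_convergence R s R (nbhs (0:R)) _ (fun h => c (t0 + h)) (c t0)
   (fun h => r / (1 - K * r * `|h|)) _ hct).
- by move=> k; apply: (@cderiv_continuous (fun u => c u k)); exact: dct.
- by exists dl => //= h /=; rewrite sub0r normrN; exact: hdl.
- have : r / (1 - K * r * `|h|) @[h --> (0 : R)] --> r / (1 - K * r * `|0 : R|).
    apply: cvgM; first exact: cvg_cst.
    apply: cvgV; first by rewrite normr0 mulr0 subr0 oner_eq0.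
    apply: cvgB; first exact: cvg_cst.
    apply: cvgM; first exact: cvg_cst.
    by apply: cvg_norm; exact: cvg_id.
  by rewrite normr0 mulr0 subr0 divr1.
- by [].
Qed.

Lemma flow_rhs_continuous rho c t0 : 0 <= rho -> coef_flow rho c ->
  K * rho * `|t0| < 1 -> forall e, 0 < e ->
  \forall h \near (0 : R),
    hseq (s - 1) (fun k => burgers S (c (t0 + h)) k - burgers S (c t0) k) e.
Proof.
move=> rho0 hc Kt e e0.
have [A hA] := flow_near rho0 hc Kt.
have [h0 _] := nbhs_singleton hA; rewrite addr0 in h0.
have [A0 _ _] := h0.
pose q := quad_const mu C s.
have q0 : 0 <= q := quad_const_ge0 kS s.
pose B := 2 * A.
have qB : 0 <= q * B := mulr_ge0 q0 (mulr_ge0 (ler0n R 2) A0).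
have D0 : 0 < e / (q * B + 1) by rewrite divr_gt0// ltr_wpDl.
apply: filterS2 hA (flow_continuous rho0 hc Kt D0) => h [h1 _] h2.
have h3 := burgersB_hseq kS sr h1 h0 h2 (lexx B).
apply: hseq_le h3.
rewrite [leLHS](_ : _ = q * B * e / (q * B + 1)); last by rewrite /q; ring.
rewrite ler_pdivrMr ?ltr_wpDl//.
by rewrite [leLHS]mulrC ler_pM2l// lerDl.
Qed.

(** The derivative exists for each coefficient; the mean value inequality and the
    continuity of the right-hand side make the convergence strong. *)
Lemma flow_derivable rho c t0 : 0 <= rho -> coef_flow rho c ->
  K * rho * `|t0| < 1 -> forall e, 0 < e ->
  \forall h \near (0 : R)^',
    hseq (s - 1) (fun k => (h^-1)%:C * (c (t0 + h) k - c t0 k) - burgers S (c t0) k) e.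
Proof.
move=> rho0 hc Kt e e0.
have [A hA] := flow_near rho0 hc Kt.
have hB := flow_rhs_continuous rho0 hc Kt e0.
have [dl dl0 hdl] : \forall h \near (0:R), (hseq s (c (t0 + h)) A /\
    forall k, cderiv (fun u => c u k) (t0 + h) (burgers S (c (t0 + h)) k)) /\
    hseq (s - 1) (fun k => burgers S (c (t0 + h)) k - burgers S (c t0) k) e.
  by apply: filterS2 hA hB.
have ball h : `|h| < dl -> ball_ Num.Def.normr (0 : R) dl h.
  by rewrite /ball_/= sub0r normrN.
have h0E : \forall h \near (0:R)^', h != 0 by exact: nbhs_dnbhs_neq.
have hlt : \forall h \near (0:R)^', `|h| < dl.
  by apply: nbhs_dnbhs; exists dl => //= h /=; rewrite sub0r normrN.
apply: filterS2 h0E hlt => h hn0 hlt.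
apply: (@mean_value_hseq R _ c (burgers S (c t0)) (fun t => burgers S (c t))) => //.
- exact: ltW.
- have := hdl 0; rewrite addr0 => /(_ _)[]; first by apply: ball; rewrite normr0.
  by move=> [[]].
- by have [] := hdl h (ball h hlt); move=> [[]].
- exact: burgers0.
move=> u /andP[u0 u1].
have hu : `|h * u| < dl.
  by apply: le_lt_trans hlt; rewrite normrM (ger0_norm u0) ler_piMr.
by have [[_ h2] h3] := hdl _ (ball _ hu).
Qed.

End WellPosed.

(** * Integration and Fourier coefficients on the circle *)

Section CircleIntegral.
Variable R : realType.
Local Notation leb := (@lebesgue_measure R).
Implicit Types (f g h : R -> R) (k j : int) (a b c x : R).

Definition cint f : R := \int[leb]_(x in (@circle R)) f x.
Definition integ f : Prop := leb.-integrable (@circle R) (EFin \o f).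

Lemma measurable_circle : measurable (@circle R).
Proof. exact: measurable_itv. Qed.
Local Hint Resolve measurable_circle : core.

Lemma twopi_gt0 : 0 < 2 * pi :> R.
Proof. by rewrite mulr_gt0// pi_gt0. Qed.

Lemma integ_continuous f : continuous f -> integ f.
Proof.
move=> cf; apply: continuous_compact_integrable; first exact: segment_compact.
exact: continuous_subspaceT.
Qed.

Lemma integD f g : integ f -> integ g -> integ (fun x => f x + g x).
Proof. by move=> hf hg; have := integrableD (mu := leb) measurable_circle hf hg. Qed.

Lemma integZ a f : integ f -> integ (fun x => a * f x).
Proof. by move=> hf; have := integrableZl (mu := leb) measurable_circle a hf. Qed.

Lemma integB f g : integ f -> integ g -> integ (fun x => f x - g x).
Proof. by move=> hf hg; have := integrableB (mu := leb) measurable_circle hf hg. Qed.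

Lemma integM f g : integ f -> continuous g -> integ (fun x => f x * g x).
Proof.
move=> hf cg; apply: (@integrableMl _ _ _ leb _ measurable_circle (EFin \o f) g) => //.
  apply: subspace_continuous_measurable_fun; first exact: measurable_circle.
  exact: continuous_subspaceT.
have : compact (g @` (@circle R)).
  apply: continuous_compact; first exact: continuous_subspaceT.
  exact: segment_compact.
move/compact_bounded => [M [Mr hM]]; exists M; split => // y My x /= xc.
by apply: (hM y My); exists x.
Qed.

Lemma integ_abs f : integ f -> integ (fun x => `|f x|).
Proof. by move=> hf; have := integrable_abse (mu := leb) hf. Qed.

Lemma cintD f g : integ f -> integ g -> cint (fun x => f x + g x) = cint f + cint g.
Proof. by move=> hf hg; exact: RintegralD. Qed.

Lemma cintB f g : integ f -> integ g -> cint (fun x => f x - g x) = cint f - cint g.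
Proof. by move=> hf hg; exact: RintegralB. Qed.

Lemma cintZ a f : integ f -> cint (fun x => a * f x) = a * cint f.
Proof. by move=> hf; exact: RintegralZl. Qed.

Lemma eq_cint f g : f =1 g -> cint f = cint g.
Proof. by move=> fg; apply: eq_Rintegral => x _; exact: fg. Qed.

Lemma cintN f : integ f -> cint (fun x => - f x) = - cint f.
Proof.
move=> hf; rewrite -mulN1r -cintZ//; apply: eq_cint => x; by rewrite mulN1r.
Qed.

Lemma cint_cst a : cint (fun=> a) = a * (2 * pi).
Proof.
rewrite /cint Rintegral_cst//; congr (_ * _).
have h := lebesgue_measure_itv `[0, (2 * pi : R)].
rewrite /= lte_fin twopi_gt0 -EFinD subr0 in h.
exact: (congr1 fine h).
Qed.

Lemma cint_dominated (fn : nat -> R -> R) f g :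
  (forall n, integ (fn n)) -> (forall x, fn n x @[n --> \oo] --> f x) ->
  integ g -> (forall n x, `|fn n x| <= g x) ->
  integ f /\ cint (fn n) @[n --> \oo] --> cint f.
Proof.
move=> hfn fnf hg dom.
have mfn n : measurable_fun (@circle R) (EFin \o fn n).
  by have /integrableP[] := hfn n.
have ff : forall x, (@circle R) x -> (EFin \o fn n) x @[n --> \oo] --> (EFin \o f) x.
  by move=> x _ /=; apply: cvg_EFin; [exact: nearW|exact: fnf].
have mf : measurable_fun (@circle R) (EFin \o f).
  exact: (emeasurable_fun_cvg _ _ mfn ff).
have hg' : leb.-integrable (@circle R) (EFin \o g) := hg.
have dom' : {ae leb, forall x n, circle x -> (`|(EFin \o fn n) x| <= (EFin \o g) x)%E}.
  by apply: aeW => x n _; rewrite lee_fin.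
have [h1 _ h2] := @dominated_convergence _ _ _ leb _ measurable_circle
  (fun n => EFin \o fn n) (EFin \o f) (EFin \o g) mfn mf (aeW leb ff) hg' dom'.
split => //.
have fin : (\int[leb]_(x in (@circle R)) (f x)%:E)%E \is a fin_num.
  exact: integrable_fin_num h1.
apply: fine_cvg; rewrite fineK//.
Qed.

Lemma continuous_derivable f (df : R -> R) : (forall x : R, is_derive x 1 f (df x)) ->
  continuous f.
Proof.
by move=> h x; exact: is_derive_continuous (h x).
Qed.

Lemma derivable_circle f (df : R -> R) : (forall x : R, is_derive x 1 f (df x)) ->
  derivable_oo_LRcontinuous f 0 (2 * pi).
Proof.
move=> h; have cf := continuous_derivable h; split.
- by move=> x _; exact: ex_derive.
- by apply: cvg_at_right_filter; exact: cf.
- by apply: cvg_at_left_filter; exact: cf.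
Qed.

Lemma cint_parts f df g dg : (forall x : R, is_derive x 1 f (df x)) ->
  (forall x : R, is_derive x 1 g (dg x)) -> continuous df -> continuous dg ->
  periodic f (2 * pi) -> periodic g (2 * pi) ->
  cint (fun x => f x * dg x) = - cint (fun x => df x * g x).
Proof.
move=> hf hg cdf cdg pf pg.
rewrite /cint /circle (@Rintegration_by_parts R f g df dg 0 (2 * pi)) ?twopi_gt0//.
- by rewrite -[2 * pi]add0r pf pg subrr sub0r add0r.
- exact: continuous_subspaceT.
- exact: derivable_circle hf.
- by move=> x _; rewrite derive1E; apply: derive_val.
- exact: continuous_subspaceT.
- exact: derivable_circle hg.
- by move=> x _; rewrite derive1E; apply: derive_val.
Qed.

Definition trig (a b c x : R) : R := a * cos (c * x) + b * sin (c * x).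

Lemma is_derive_scale (f : R -> R) (c x d : R) :
  is_derive (c * x) 1 f d -> is_derive x 1 (fun u => f (c * u)) (c * d).
Proof.
rewrite -[c * x]add0r => /is_derive_affine.
by under eq_fun do rewrite add0r.
Qed.

Lemma is_derive_trig a b c x :
  is_derive x 1 (trig a b c) (trig (b * c) (- (a * c)) c x).
Proof.
have h1 := @is_deriveZ R R R _ a x 1 _ (is_derive_scale (is_derive_cos (c * x))).
have h2 := @is_deriveZ R R R _ b x 1 _ (is_derive_scale (is_derive_sin (c * x))).
have h3 := @is_deriveD R R R _ _ x 1 _ _ h1 h2.
by apply: (is_derive_eq h3); rewrite /GRing.scale/= /trig; ring.
Qed.

Lemma continuous_trig a b c : continuous (trig a b c).
Proof. exact: continuous_derivable (is_derive_trig a b c). Qed.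

Lemma integ_trig a b c : integ (trig a b c).
Proof. by apply: integ_continuous; exact: continuous_trig. Qed.

Lemma cosDint k x : cos (x + k%:~R * (2 * pi)) = cos x :> R /\
  sin (x + k%:~R * (2 * pi)) = sin x :> R.
Proof.
have pos (n : nat) y : cos (y + n%:R * (2 * pi)) = cos y :> R /\
  sin (y + n%:R * (2 * pi)) = sin y :> R.
  have -> : n%:R * (2 * pi) = (pi *+ 2) *+ n :> R by rewrite -[RHS]mulr_natl -[pi *+ 2]mulr_natl.
  by split; [exact: (periodicn (@cosD2pi R))|exact: (periodicn (@sinD2pi R))].
case: k => n; first exact: pos.
rewrite NegzE mulrNz mulNr.
have := pos n.+1 (x - n.+1%:R * (2 * pi)); rewrite subrK => -[-> ->]; by split.
Qed.

Lemma periodic_trig a b k : periodic (trig a b k%:~R) (2 * pi).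
Proof.
by move=> x; rewrite /trig mulrDr; have [-> ->] := cosDint k (k%:~R * x).
Qed.

Lemma cint_trig a b k : cint (trig a b k%:~R) = if k == 0 then 2 * pi * a else 0.
Proof.
case: eqP => [->|/eqP k0].
  rewrite (@eq_cint _ (fun=> a)) ?cint_cst 1?mulrC// => x.
  by rewrite /trig mul0r cos0 sin0 mulr0 addr0 mulr1.
have kR : (k%:~R : R) != 0 by rewrite intr_eq0.
have hd (x : R) : is_derive x 1 (trig (- b / k%:~R) (a / k%:~R) k%:~R) (trig a b k%:~R x).
  apply: (is_derive_eq (is_derive_trig _ _ _ _)).
  by rewrite mulfVK// mulfVK// opprK.
have := @cint_parts (fun=> 1) (fun=> 0) _ _ (fun x => is_derive_cst _ _ _) hd.
rewrite (@eq_cint _ (trig a b k%:~R)); last by move=> x; rewrite mul1r.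
move=> ->.
- by rewrite (@eq_cint _ (fun=> 0)) ?cint_cst ?mul0r ?oppr0// => x; rewrite mul0r.
- exact: cst_continuous.
- exact: continuous_trig.
- by [].
- exact: periodic_trig.
Qed.

Lemma trig_mul a b c a' b' c' x : trig a b c x * trig a' b' c' x =
  trig ((a * a' - b * b') / 2) ((a * b' + b * a') / 2) (c + c') x +
  trig ((a * a' + b * b') / 2) ((b * a' - a * b') / 2) (c - c') x.
Proof. rewrite /trig [(c + c') * x]mulrDl [(c - c') * x]mulrBl cosD sinD cosB sinB.
by field. Qed.

Lemma cint_trig_mul a b j a' b' k :
  cint (fun x => trig a b j%:~R x * trig a' b' k%:~R x) =
  pi * ((if j == - k then a * a' - b * b' else 0) +
        (if j == k then a * a' + b * b' else 0)).
Proof.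
rewrite (eq_cint (fun x => trig_mul a b j%:~R a' b' k%:~R x)).
rewrite cintD; [|exact: integ_trig|exact: integ_trig].
rewrite -rmorphD -rmorphB !cint_trig/= -addr_eq0 subr_eq0.
by case: ifP => _; case: ifP => _; field.
Qed.

Lemma cosE k x : cos (k%:~R * x) = trig 1 0 k%:~R x :> R.
Proof. by rewrite /trig mul1r mul0r addr0. Qed.
Lemma sinE' k x : sin (k%:~R * x) = trig 0 1 k%:~R x :> R.
Proof. by rewrite /trig mul1r mul0r add0r. Qed.

Definition ccos f k : R := cint (fun x => f x * trig 1 0 k%:~R x).
Definition csin f k : R := cint (fun x => f x * trig 0 1 k%:~R x).

Lemma fourierE f k : integ f ->
  fourier f k = ((2 * pi)^-1 * ccos f k) +i* (- ((2 * pi)^-1 * csin f k)).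
Proof.
move=> hf; rewrite /fourier /Cintegral /expi.
have -> : \int[leb]_(x in (@circle R)) complex.Re ((f x)%:C *
   (cos (- (k%:~R * x)) +i* sin (- (k%:~R * x)))) = ccos f k.
  by apply: eq_cint => x /=; rewrite mul0r subr0 cosN cosE.
have -> : \int[leb]_(x in (@circle R)) complex.Im ((f x)%:C *
   (cos (- (k%:~R * x)) +i* sin (- (k%:~R * x)))) = - csin f k.
  rewrite -[LHS]/(cint _) -cintN; last by apply: integM => //; exact: continuous_trig.
  by apply: eq_cint => x /=; rewrite mul0r addr0 sinN sinE' mulrN.
by apply: complex_ext => /=; rewrite mul0r ?subr0 ?addr0// mulrN.
Qed.

Lemma fourier_inj f g : integ f -> integ g -> (forall k, fourier f k = fourier g k) ->
  forall k, ccos f k = ccos g k /\ csin f k = csin g k.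
Proof.
move=> hf hg h k; have := h k; rewrite !fourierE//.
have p0 : (2 * pi : R)^-1 != 0 by rewrite invr_eq0 gt_eqF// twopi_gt0.
by move=> [/(mulfI p0) -> /oppr_inj/(mulfI p0) ->].
Qed.

Lemma fourierB f g k : integ f -> integ g ->
  fourier (fun x => f x - g x) k = fourier f k - fourier g k.
Proof.
move=> hf hg.
have E a b : cint (fun x => (f x - g x) * trig a b k%:~R x) =
    cint (fun x => f x * trig a b k%:~R x) - cint (fun x => g x * trig a b k%:~R x).
  rewrite -cintB; try by apply: integM => //; exact: continuous_trig.
  by apply: eq_cint => x; rewrite mulrBl.
rewrite !fourierE//; last exact: integB.
by rewrite /ccos /csin !E; apply: complex_ext => /=; ring.
Qed.

Lemma fourierZ a f k : integ f ->
  fourier (fun x => a * f x) k = a%:C * fourier f k.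
Proof.
move=> hf.
have E b c : cint (fun x => (a * f x) * trig b c k%:~R x) =
    a * cint (fun x => f x * trig b c k%:~R x).
  rewrite -cintZ; last by apply: integM => //; exact: continuous_trig.
  by apply: eq_cint => x; rewrite mulrA.
rewrite !fourierE//; last exact: integZ.
by rewrite /ccos /csin !E; apply: complex_ext => /=; ring.
Qed.

Lemma fourier_herm f : integ f -> herm (fourier f).
Proof.
move=> hf k; rewrite !fourierE//; apply: complex_ext => /=.
  congr (_ * _); apply: eq_cint => x.
  by rewrite /trig mulrNz mulNr cosN !mul0r.
rewrite opprK -mulrN -cintN; last by apply: integM => //; exact: continuous_trig.
congr (_ * _); apply: eq_cint => x.
by rewrite /trig mulrNz mulNr sinN !mul0r !add0r !mul1r mulrN opprK.
Qed.

Lemma fourier_ae f g k : integ f -> integ g -> eqT f g -> fourier f k = fourier g k.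
Proof.
move=> hf hg fg.
have E a b : cint (fun x => f x * trig a b k%:~R x) = cint (fun x => g x * trig a b k%:~R x).
  rewrite /cint /Rintegral; congr fine; apply: ae_eq_integral => //.
  - by have /integrableP[] := integM hf (@continuous_trig a b k%:~R).
  - by have /integrableP[] := integM hg (@continuous_trig a b k%:~R).
  have := fg; apply: filterS; first exact: (ae_filter_ringOfSetsType leb).
  by move=> x fgx _ /=; rewrite fgx.
by rewrite !fourierE// /ccos /csin !E.
Qed.

End CircleIntegral.

(** * Synthesis of a function from summable coefficients *)

Section Synthesis.
Variable R : realType.
Implicit Types (c d : int -> R[i]) (k j : int) (x : R).

(** Taking real parts term by term keeps the function real; for Hermitian
    coefficients it does not change the sum. *)
Definition fpart c (N : nat) x : R :=
  \sum_(k <- box N) trig (Rez (c k)) (- Imz (c k)) k%:~R x.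

Definition synth c x : R := limn (fun N => fpart c N x).

Lemma trig_le (a b : R) w x : `|trig a b w x| <= `|a| + `|b|.
Proof.
apply: le_trans (ler_normD _ _) _; rewrite !normrM.
by apply: lerD; apply: ler_piMr => //; [exact: cos_max|exact: sin_max].
Qed.

Lemma fterm_le c k x : `|trig (Rez (c k)) (- Imz (c k)) k%:~R x| <= 2 * nc (c k).
Proof.
apply: le_trans (trig_le _ _ _ _) _; rewrite normrN mulr_natl mulr2n.
by apply: lerD; [exact: normRe_le|exact: normIm_le].
Qed.

Section Summable.
Variables (c : int -> R[i]) (A : R).
Hypothesis cA : sumle (fun k => nc (c k)) A.

Let c2A : sumle (fun k => 2 * nc (c k)) (2 * A).
Proof. exact: sumleZ. Qed.

Lemma fpart_cvg x : fpart c N x @[N --> \oo] --> synth c x.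
Proof. exact: (abs_sum_cvg (fun k => fterm_le c k x) c2A). Qed.

Lemma fpart_le N x : `|fpart c N x| <= 2 * A.
Proof.
apply: le_trans (ler_norm_sum _ _ _) _; apply: le_trans (c2A N).
by apply: ler_sum => k _; exact: fterm_le.
Qed.

Lemma continuous_fpart N : continuous (fpart c N).
Proof.
move=> x; apply: (@cvg_sumr R R (nbhs x) _ _ (box N)
  (fun k => trig (Rez (c k)) (- Imz (c k)) k%:~R)) => k.
exact: continuous_trig.
Qed.

(** Dominated convergence: summable coefficients bound all partial sums by a
    constant. *)
Lemma cint_synth (w : R -> R) : integ w ->
  integ (fun x => synth c x * w x) /\
  cint (fun x => fpart c N x * w x) @[N --> \oo] --> cint (fun x => synth c x * w x).
Proof.
move=> hw.
apply: (@cint_dominated R _ _ (fun x => (2 * A) * `|w x|)).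
- move=> N; have := integM hw (@continuous_fpart N).
  by rewrite /integ; under eq_fun do rewrite mulrC.
- by move=> x; apply: cvgM; [exact: fpart_cvg|exact: cvg_cst].
- by apply: integZ; exact: integ_abs.
- by move=> N x; rewrite normrM ler_wpM2r// fpart_le.
Qed.

Lemma integ_synth : integ (synth c).
Proof.
have h1 : integ (fun=> 1 : R) by apply: integ_continuous; exact: cst_continuous.
have [h _] := cint_synth h1.
by move: h; rewrite /integ; under eq_fun do rewrite mulr1.
Qed.

Lemma integrableT_synth : integrableT (synth c).
Proof.
split; last exact: integ_synth.
move=> x; rewrite /synth; congr (lim (_ @ \oo)); apply/funext => N.
by apply: eq_bigr => k _; rewrite periodic_trig.
Qed.

End Summable.

Lemma fpart_cint c N a b k :
  cint (fun x => fpart c N x * trig a b k%:~R x) =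
  \sum_(j <- box N) pi *
   ((if j == - k then Rez (c j) * a + Imz (c j) * b else 0) +
    (if j == k then Rez (c j) * a - Imz (c j) * b else 0)).
Proof.
have E x : fpart c N x * trig a b k%:~R x =
    \sum_(j <- box N) (trig (Rez (c j)) (- Imz (c j)) j%:~R x * trig a b k%:~R x).
  by rewrite /fpart mulr_suml.
rewrite (eq_cint E).
have I j : integ (fun x => trig (Rez (c j)) (- Imz (c j)) j%:~R x * trig a b k%:~R x).
  by apply: integM; [exact: integ_trig|exact: continuous_trig].
have [_ ->] : integ (fun x => \sum_(j <- box N) (trig (Rez (c j)) (- Imz (c j)) j%:~R x * trig a b k%:~R x)) /\
  cint (fun x => \sum_(j <- box N) (trig (Rez (c j)) (- Imz (c j)) j%:~R x * trig a b k%:~R x)) =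
  \sum_(j <- box N) cint (fun x => trig (Rez (c j)) (- Imz (c j)) j%:~R x * trig a b k%:~R x).
  elim: (box N) => [|i s [IH1 IH2]].
    rewrite big_nil; split.
      apply: integ_continuous; under eq_fun do rewrite big_nil; exact: cst_continuous.
    under eq_cint do rewrite big_nil.
    by rewrite cint_cst mul0r.
  rewrite big_cons -IH2 -cintD//; split.
    by under eq_fun do rewrite big_cons; exact: integD.
  by apply: eq_cint => x; rewrite big_cons.
by apply: eq_bigr => j _; rewrite cint_trig_mul mulNr opprK.
Qed.

Lemma fourier_synth c A k : sumle (fun k => nc (c k)) A -> herm c ->
  fourier (synth c) k = c k.
Proof.
move=> cA Hc; have hI := integ_synth cA.
have val a b : cint (fun x => synth c x * trig a b k%:~R x) =
    2 * pi * (Rez (c k) * a - Imz (c k) * b).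
  have [_ h] := cint_synth cA (@integ_trig R a b k%:~R).
  suff h' : cint (fun x => fpart c N x * trig a b k%:~R x) @[N --> \oo] -->
      2 * pi * (Rez (c k) * a - Imz (c k) * b).
    exact: (cvg_unique (@Rhausdorff R) h h').
  apply: cvg_near_cst; exists `|k|%N => // N /= kN.
  rewrite fpart_cint -mulr_sumr big_split/=.
  rewrite (sum_box_delta _ (fun j => Rez (c j) * a + Imz (c j) * b) (uniq_box N)).
  rewrite (sum_box_delta _ (fun j => Rez (c j) * a - Imz (c j) * b) (uniq_box N)).
  by rewrite !mem_box abszN kN Hc RezC ImzC; ring.
have p0 : (2 * pi : R) != 0 by rewrite gt_eqF// twopi_gt0.
rewrite fourierE// /ccos /csin !val; apply: complex_ext => /=.
  by rewrite mulKf// mulr0 subr0 mulr1.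
by rewrite mulKf// mulr0 sub0r mulr1 opprK.
Qed.

Definition dcoef c k : R[i] := 'i * k%:~R * c k.

Lemma RezDcoef c k : Rez (dcoef c k) = - (Imz (c k) * k%:~R).
Proof.
rewrite /dcoef -[X in _ * X * _](rmorph_int (real_complex R)) -mulrA [_%:C * _]mulrC.
by rewrite RezM mul0r sub0r mul1r ImzM/= mulr0 add0r.
Qed.

Lemma ImzDcoef c k : Imz (dcoef c k) = Rez (c k) * k%:~R.
Proof.
rewrite /dcoef -[X in _ * X * _](rmorph_int (real_complex R)) -mulrA [_%:C * _]mulrC.
by rewrite ImzM mul0r add0r mul1r RezM/= mulr0 subr0.
Qed.

Lemma is_derive_fpart c N x : is_derive x 1 (fpart c N) (fpart (dcoef c) N x).
Proof.
rewrite /fpart; elim: (box N) => [|k s IH].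
  by under eq_fun do rewrite big_nil; rewrite big_nil; exact: is_derive_cst.
under eq_fun do rewrite big_cons; rewrite big_cons; apply: is_deriveD.
apply: (is_derive_eq (is_derive_trig _ _ _ _)).
by rewrite RezDcoef ImzDcoef mulNr.
Qed.

Lemma smooth_derive (phi : R -> R) : (forall n x, derivable (derive1n n phi) x 1) ->
  (forall x : R, is_derive x 1 phi (derive1 phi x)) /\ continuous (derive1 phi).
Proof.
move=> h; split.
  move=> x; rewrite derive1E; apply: DeriveDef => //; exact: (h 0%N x).
move=> x; apply: differentiable_continuous; apply/derivable1_diffP.
exact: (h 1%N x).
Qed.

(** Integration by parts is classical for the partial sums, and both sides
    converge. *)
Lemma weak_deriv_synth c A B : sumle (fun k => nc (c k)) A ->
  sumle (fun k => nc (dcoef c k)) B -> weak_deriv (synth c) (synth (dcoef c)).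
Proof.
move=> cA dB; split; [exact: integrableT_synth cA|exact: integrableT_synth dB|].
move=> phi pphi /smooth_derive[hphi cphi].
have cp : continuous phi by exact: continuous_derivable hphi.
have [_ h1] := cint_synth cA (integ_continuous cphi).
have [_ h2] := cint_synth dB (integ_continuous cp).
have E N : cint (fun x => fpart c N x * derive1 phi x) =
    - cint (fun x => fpart (dcoef c) N x * phi x).
  apply: cint_parts => //.
  - by move=> x; exact: is_derive_fpart.
  - exact: continuous_fpart.
  - by move=> x; apply: eq_bigr => k _; rewrite periodic_trig.
have h3 : cint (fun x => fpart c N x * derive1 phi x) @[N --> \oo] -->
    - cint (fun x => synth (dcoef c) x * phi x).
  by under eq_fun do rewrite E; exact: cvgN.
exact: (cvg_unique (@Rhausdorff R) h1 h3).
Qed.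

Lemma derive1n_trig (a b w : R) n : exists a' b', derive1n n (trig a b w) = trig a' b' w.
Proof.
elim: n => [|n [a' [b' IH]]]; first by exists a, b.
exists (b' * w), (- (a' * w)); rewrite derive1nS IH; apply/funext => x.
by rewrite derive1E; have /@derive_val := is_derive_trig a' b' w x.
Qed.

(** Trigonometric monomials serve as test functions. *)
Lemma fourier_weak_deriv (w wx : R -> R) k : weak_deriv w wx ->
  fourier wx k = 'i * k%:~R * fourier w k.
Proof.
move=> [[pw iw] [pwx iwx] h].
have test a b : cint (fun x => w x * trig (b * k%:~R) (- (a * k%:~R)) k%:~R x) =
    - cint (fun x => wx x * trig a b k%:~R x).
  have := h (trig a b k%:~R) (@periodic_trig R a b k).
  have E : derive1 (trig a b k%:~R) = trig (b * k%:~R) (- (a * k%:~R)) k%:~R :> (R -> R).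
    apply/funext => x; rewrite derive1E.
    by have /@derive_val := is_derive_trig a b k%:~R x.
  rewrite E; apply.
  move=> n x; have [a' [b' ->]] := derive1n_trig a b k%:~R n.
  by have /@ex_derive := is_derive_trig a' b' k%:~R x.
have c1 : ccos wx k = k%:~R * csin w k.
  have := test 1 0; rewrite -/(ccos wx k) => /(congr1 -%R); rewrite opprK => <-.
  rewrite /csin -cintZ; last by apply: integM => //; exact: continuous_trig.
  rewrite -cintN; last by apply: integM => //; exact: continuous_trig.
  by apply: eq_cint => x; rewrite /trig; ring.
have c2 : csin wx k = - (k%:~R * ccos w k).
  have := test 0 1; rewrite -/(csin wx k) => /(congr1 -%R); rewrite opprK => <-.
  congr (- _); rewrite /ccos -cintZ; last by apply: integM => //; exact: continuous_trig.
  by apply: eq_cint => x; rewrite /trig; ring.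
rewrite -/(dcoef (fourier w) k) !fourierE// c1 c2.
apply: complex_ext; rewrite ?RezDcoef ?ImzDcoef fourierE//=; ring.
Qed.

End Synthesis.

(** * Uniqueness of Fourier coefficients *)

Section Translation.
Variable R : realType.
Local Notation leb := (@lebesgue_measure R).

Lemma lebesgue_shift (a : R) (A : set R) : measurable (A : set (measurableTypeR R)) ->
  leb [set x | A (x + a)] = leb A.
Proof.
move=> mA.
have mf : measurable_fun (@setT (measurableTypeR R))
    (fun x : measurableTypeR R => (x + a : measurableTypeR R)).
  by apply: measurable_funD; [exact: measurable_id|exact: measurable_cst].
pose nu := measure_function_pushforward__canonical__measure_function_Measure leb mf.
have := @lebesgue_measure_unique R nu _ A mA.
rewrite /nu /= /pushforward => <- //.
move=> X /ocitvP[->|[[p q] /= pq ->]].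
  by rewrite preimage_set0 !measure0.
have -> : (fun x : R => x + a) @^-1` `]p, q]%classic = `]p - a, q - a]%classic.
  by apply/seteqP; split => x /=; rewrite !in_itv/= ltrBlDr lerBrDr.
have h1 := lebesgue_measure_itv `]p, q].
have h2 := lebesgue_measure_itv `](p - a), (q - a)].
rewrite /= lte_fin pq -EFinD in h1.
rewrite /= lte_fin ltrD2r pq -EFinD in h2.
have -> : leb `]p - a, q - a]%classic = (q - p)%:E.
  by apply: etrans h2 _; congr EFin; ring.
exact: h1.
Qed.

Lemma negligible_shift (a : R) (N : set R) :
  leb.-negligible N -> leb.-negligible [set x | N (x + a)].
Proof.
move=> [B [mB B0 NB]].
exists [set x | B (x + a)]; split.
- have mf : measurable_fun (@setT (measurableTypeR R))
      (fun x : measurableTypeR R => (x + a : measurableTypeR R)).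
    by apply: measurable_funD; [exact: measurable_id|exact: measurable_cst].
  by have := mf measurableT B mB; rewrite setTI.
- by rewrite lebesgue_shift.
- by move=> x /= /NB.
Qed.

(** The exceptional set is contained in the translates of a null set by the
    multiples of the period, a countable union. *)
Lemma ae_periodic (g : R -> R) : periodic g (2 * pi) ->
  {ae leb, forall x, 0 < x < 2 * pi -> g x = 0} -> eqT g (fun=> 0).
Proof.
move=> pg h.
have pgn (n : nat) x : g (x + n%:R * (2 * pi)) = g x.
  by elim: n x => [|n IH] x; rewrite ?mul0r ?addr0// -natr1 mulrDl mul1r addrA pg IH.
have pgz (k : int) x : g (x + k%:~R * (2 * pi)) = g x.
  case: k => n; first exact: pgn.
  rewrite NegzE mulrNz mulNr.
  by have := pgn n.+1 (x - n.+1%:R * (2 * pi)); rewrite subrK.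
pose N := [set x | ~ (0 < x < 2 * pi -> g x = 0)] `|` [set 0 : R].
have N0 : leb.-negligible N.
  apply: negligibleU; first exact: h.
  apply/negligibleP; first exact: measurable_set1.
  exact: lebesgue_measure_set1.
have NU : leb.-negligible (\bigcup_n
    ([set x | N (x + n%:R * (2 * pi))] `|` [set x | N (x + - (n%:R * (2 * pi)))])).
  by apply: negligible_bigcup => n; apply: negligibleU; exact: negligible_shift.
apply: negligibleS NU => x /= gx.
have p0 := twopi_gt0 R.
pose k := Num.floor (x / (2 * pi)).
have /andP[k1 k2] := floor_itv (x / (2 * pi)).
rewrite ler_pdivlMr// in k1; rewrite ltr_pdivrMr// in k2.
have Nx : N (x - k%:~R * (2 * pi)).
  have [e|ne] := eqVneq (x - k%:~R * (2 * pi)) 0; first by right.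
  left => /= H; apply: gx; rewrite -(pgz (- k) x) mulrNz mulNr; apply: H.
  rewrite lt_neqAle eq_sym ne subr_ge0 k1/= ltrBlDr.
  by move: k2; rewrite rmorphD/= mulrDl mul1r addrC.
exists `|k|%N => //; case: (ger0P k) => k0.
  by right => /=; rewrite pmulrn abszE (ger0_norm k0).
left => /=; rewrite pmulrn abszE (ltr0_norm k0) mulrNz mulNr; exact: Nx.
Qed.

End Translation.

Section FourierUniqueness.
Variable R : realType.
Local Notation leb := (@lebesgue_measure R).
Implicit Types (f g p q : R -> R).

Inductive trigpoly : (R -> R) -> Prop :=
| trigpoly_mono a b (k : int) : trigpoly (trig a b k%:~R)
| trigpoly_add p q : trigpoly p -> trigpoly q -> trigpoly (fun x => p x + q x).

Lemma trigpoly_cst a : trigpoly (fun=> a).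
Proof.
have -> : (fun=> a) = trig a 0 (0%:~R) :> (R -> R).
  by apply/funext => x; rewrite /trig mul0r cos0 sin0 mulr0 addr0 mulr1.
exact: trigpoly_mono.
Qed.

Lemma trigpoly_mul p q : trigpoly p -> trigpoly q -> trigpoly (fun x => p x * q x).
Proof.
move=> hp hq; elim: hp => [a b k|p1 p2 _ IH1 _ IH2]; last first.
  by under eq_fun do rewrite mulrDl; exact: trigpoly_add.
elim: hq => [a' b' k'|q1 q2 _ IH1 _ IH2]; last first.
  by under eq_fun do rewrite mulrDr; exact: trigpoly_add.
under eq_fun do rewrite trig_mul.
by rewrite -rmorphD -rmorphB; apply: trigpoly_add; exact: trigpoly_mono.
Qed.

Lemma trigpoly_exp p n : trigpoly p -> trigpoly (fun x => p x ^+ n).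
Proof.
move=> hp; elim: n => [|n IH].
  by under eq_fun do rewrite expr0; exact: trigpoly_cst.
by under eq_fun do rewrite exprS; exact: trigpoly_mul.
Qed.

Lemma trigpoly_continuous p : trigpoly p -> continuous p.
Proof.
elim=> [a b k|p1 p2 _ IH1 _ IH2]; first exact: continuous_trig.
by move=> x; apply: cvgD; [exact: IH1|exact: IH2].
Qed.

Lemma cint_trigpoly g p : integ g ->
  (forall k : int, ccos g k = 0 /\ csin g k = 0) ->
  trigpoly p -> cint (fun x => g x * p x) = 0.
Proof.
move=> ig h; elim=> [a b k|p1 p2 hp1 IH1 hp2 IH2].
  have [h1 h2] := h k.
  rewrite (@eq_cint R _ (fun x => a * (g x * trig 1 0 k%:~R x) + b * (g x * trig 0 1 k%:~R x))).
    rewrite cintD ?cintZ -/(ccos g k) -/(csin g k) ?h1 ?h2 ?mulr0 ?addr0//;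
    by rewrite ?/integ; try apply: integZ; apply: integM => //; exact: continuous_trig.
  by move=> x; rewrite /trig; ring.
rewrite (@eq_cint R _ (fun x => g x * p1 x + g x * p2 x)).
  by rewrite cintD ?IH1 ?IH2 ?addr0//; apply: integM => //; exact: trigpoly_continuous.
by move=> x; rewrite mulrDr.
Qed.

(** As [n] grows, Stone's polynomials tend on the unit interval to the indicator
    function of [1 / 2 < y], except at [1 / 2]. *)
Definition stone (n : nat) (y : R) : R := 1 - (1 - y ^+ n) ^+ (2 ^ n).

Lemma stone_itv n y : 0 <= y <= 1 -> 0 <= stone n y <= 1.
Proof.
move=> /andP[y0 y1].
have h0 : 0 <= 1 - y ^+ n by rewrite subr_ge0 exprn_ile1.
have h1 : 1 - y ^+ n <= 1 by rewrite gerBl exprn_ge0.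
by rewrite /stone subr_ge0 gerBl exprn_ge0// exprn_ile1.
Qed.

Lemma bernoulli (t : R) (m : nat) : 0 <= t <= 1 -> 1 - m%:R * t <= (1 - t) ^+ m.
Proof.
move=> /andP[t0 t1]; elim: m => [|m IH]; first by rewrite mul0r subr0 expr0.
rewrite exprS; apply: (@le_trans _ _ ((1 - t) * (1 - m%:R * t))); last first.
  by rewrite ler_wpM2l// subr_ge0.
have : 0 <= m%:R * t ^+ 2 by rewrite mulr_ge0 ?sqr_ge0.
by rewrite -natr1; nra.
Qed.

Lemma bernoulliD (t : R) (m : nat) : 0 <= t -> 1 + m%:R * t <= (1 + t) ^+ m.
Proof.
move=> t0; elim: m => [|m IH]; first by rewrite mul0r addr0 expr0.
rewrite exprS; apply: (@le_trans _ _ ((1 + t) * (1 + m%:R * t))); last first.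
  by rewrite ler_wpM2l// addr_ge0.
have : 0 <= m%:R * t ^+ 2 by rewrite mulr_ge0 ?sqr_ge0.
by rewrite -natr1; nra.
Qed.

(** By Bernoulli's inequality [stone n y <= (2 * y) ^+ n]. *)
Lemma stone_low (y : R) : 0 <= y < 1 / 2 -> stone n y @[n --> \oo] --> (0 : R).
Proof.
move=> /andP[y0 y2].
have y1 : y <= 1 by lra.
apply: (@squeeze0 R _ _ _ _ (fun n => (2 * y) ^+ n)).
  apply: nearW => n; have /andP[-> _] /= := stone_itv n (introT andP (conj y0 y1)).
  have := @bernoulli (y ^+ n) (2 ^ n) _.
  rewrite exprn_ge0// exprn_ile1// => /(_ isT).
  by rewrite natrX -exprMn /stone; lra.
apply: cvg_expr; rewrite ger0_norm; [lra|by rewrite mulr_ge0].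
Qed.

(** As [(1 - t) * (1 + t) <= 1], the power of [1 - t] is at most the inverse of the
    power of [1 + t], which Bernoulli's inequality bounds from below. *)
Lemma stone_high (y : R) : 1 / 2 < y <= 1 -> stone n y @[n --> \oo] --> (1 : R).
Proof.
move=> /andP[y2 y1].
have y0 : 0 < y by lra.
suff h : (1 - y ^+ n) ^+ (2 ^ n) @[n --> \oo] --> (0 : R).
  by rewrite -[X in _ --> X]subr0; apply: cvgB => //; exact: cvg_cst.
apply: (@squeeze0 R _ _ _ _ (fun n => ((2 * y)^-1) ^+ n)).
  apply: nearW => n.
  have yn0 : 0 <= y ^+ n by apply: exprn_ge0; exact: ltW.
  have yn1 : y ^+ n <= 1 by apply: exprn_ile1 => //; exact: ltW.
  have h0 : 0 <= 1 - y ^+ n by rewrite subr_ge0.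
  rewrite exprn_ge0//= exprVn -[leRHS]mul1r ler_pdivlMr ?exprn_gt0 ?mulr_gt0//.
  have le1 : ((1 - y ^+ n) * (1 + y ^+ n)) ^+ (2 ^ n) <= 1.
    apply: exprn_ile1; first exact: mulr_ge0 h0 (addr_ge0 ler01 yn0).
    by have := sqr_ge0 (y ^+ n); nra.
  apply: le_trans le1; rewrite [leRHS]exprMn ler_wpM2l ?exprn_ge0//.
  apply: le_trans (bernoulliD (2 ^ n) yn0).
  by rewrite natrX exprMn lerDr.
apply: cvg_expr; rewrite ger0_norm ?invr_ge0 ?mulr_ge0 ?(ltW y0)//.
by rewrite invf_lt1 ?mulr_gt0//; lra.
Qed.

(** A trigonometric polynomial with values in the unit interval that exceeds
    [1 / 2] exactly on the arc from [0] to [b]; composed with [stone] it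
    approximates the indicator function of that arc. *)
Definition arcfun (b x : R) : R := 1 / 2 + (cos (x - b / 2) - cos (b / 2)) / 4.

Lemma arcfun_itv b x : 0 <= arcfun b x <= 1.
Proof.
rewrite /arcfun; have := cos_le1 (x - b / 2); have := cos_geN1 (x - b / 2).
have := cos_le1 (b / 2); have := cos_geN1 (b / 2).
by move=> *; apply/andP; split; lra.
Qed.

Lemma trigpoly_arc b : trigpoly (arcfun b).
Proof.
have -> : arcfun b = (fun x => 1 / 2 - cos (b / 2) / 4 +
    trig (cos (b / 2) / 4) (sin (b / 2) / 4) 1%:~R x).
  by apply/funext => x; rewrite /arcfun /trig cosB [1%:~R * x]mul1r; field.
by apply: trigpoly_add; [exact: trigpoly_cst|exact: trigpoly_mono].
Qed.

Lemma trigpoly_stone b n : trigpoly (fun x => stone n (arcfun b x)).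
Proof.
rewrite /stone.
have neg p : trigpoly p -> trigpoly (fun x => 1 - p x).
  move=> hp; have -> : (fun x => 1 - p x) = (fun x => 1 + (-1) * p x).
    by apply/funext => x; rewrite mulN1r.
  apply: trigpoly_add; first exact: trigpoly_cst.
  by apply: trigpoly_mul => //; exact: trigpoly_cst.
apply: (neg (fun x => (1 - arcfun b x ^+ n) ^+ (2 ^ n))); apply: trigpoly_exp.
by apply: (neg (fun x => arcfun b x ^+ n)); apply: trigpoly_exp; exact: trigpoly_arc.
Qed.

Lemma arcfun_in b x : 0 < b < 2 * pi -> 0 < x < b -> 1 / 2 < arcfun b x.
Proof.
move=> /andP[b0 bp] /andP[x0 xb].
suff : cos (b / 2) < cos (x - b / 2) by rewrite /arcfun; lra.
rewrite -(cos_norm (x - b / 2)).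
have xn : `|x - b / 2| < b / 2 by rewrite ltr_norml; apply/andP; split; lra.
have p0 := normr_ge0 (x - b / 2).
by rewrite ltr_cos ?in_itv/=; try (apply/andP; split); lra.
Qed.

Lemma arcfun_out b x : 0 < b < 2 * pi -> b < x < 2 * pi -> arcfun b x < 1 / 2.
Proof.
move=> /andP[b0 bp] /andP[xb xp].
suff : cos (x - b / 2) < cos (b / 2) by rewrite /arcfun; lra.
have [le|lt] := leP (x - b / 2) pi.
  by rewrite ltr_cos ?in_itv/=; try (apply/andP; split); lra.
have -> : cos (x - b / 2) = cos (2 * pi - (x - b / 2)).
  have -> : 2 * pi - (x - b / 2) = - (x - b / 2) + pi *+ 2.
    by rewrite addrC -[pi *+ 2]mulr_natl.
  by rewrite cosD2pi cosN.
by rewrite ltr_cos ?in_itv/=; try (apply/andP; split); lra.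
Qed.

(** The indicator function of an arc is a bounded limit of trigonometric
    polynomials, to all of which [g] is orthogonal. *)
Lemma cint_arc g b : integ g -> (forall k : int, ccos g k = 0 /\ csin g k = 0) ->
  0 < b < 2 * pi -> \int[leb]_(x in `[0, b]%classic) g x = 0.
Proof.
move=> ig h bi; have /andP[b0 bp] := bi.
have m0b : measurable (`[0, b]%classic : set (measurableTypeR R)) by exact: measurable_itv.
pose fn n x := g x * stone n (arcfun b x).
pose f := g \_ `[0, b]%classic.
have ifn n : integ (fn n).
  by apply: integM => //; apply: trigpoly_continuous; exact: trigpoly_stone.
have mfn n : measurable_fun (@circle R) (EFin \o fn n) by have /integrableP[] := ifn n.
have mg : measurable_fun (@circle R) g by have /integrableP[/measurable_EFinP] := ig.
have mf : measurable_fun (@circle R) (EFin \o f).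
  apply/measurable_EFinP; apply: (measurable_restrict g m0b (@measurable_circle R)).1.
  apply: measurable_funS mg; [exact: measurable_circle|exact: subIsetl].
have cvg_ae : {ae leb, forall x, circle x -> (EFin \o fn n) x @[n --> \oo] --> (EFin \o f) x}.
  exists ([set 0; b] `|` [set 2 * pi]); split.
  - by apply: measurableU; [apply: measurableU|]; exact: measurable_set1.
  - have n1 (a : R) : leb.-negligible [set a].
      by apply/negligibleP; [exact: measurable_set1|exact: lebesgue_measure_set1].
    have /negligibleP := negligibleU (negligibleU (n1 0) (n1 b)) (n1 (2 * pi)).
    by apply; apply: measurableU; [apply: measurableU|]; exact: measurable_set1.
  move=> x /= nx; apply: contrapT => xN; apply: nx.
  rewrite /circle/= in_itv/= => /andP[x0 xp].
  have x0' : 0 < x by rewrite lt_neqAle x0 andbT; apply/eqP => e; apply: xN; left; left.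
  have xb : x != b by apply/eqP => e; apply: xN; left; right.
  have xp' : x < 2 * pi by rewrite lt_neqAle xp andbT; apply/eqP => e; apply: xN; right.
  apply: cvg_EFin; first exact: nearW.
  have /andP[a0 a1] := arcfun_itv b x.
  have [lt|lt|e] := ltgtP x b; last by move/eqP: xb.
    have -> : f x = g x * 1.
      by rewrite mulr1 /f patchE mem_set//= in_itv/= x0 ltW.
    apply: cvgM; first exact: cvg_cst.
    by apply: stone_high; rewrite a1 andbT; apply: arcfun_in => //; rewrite x0'.
  have -> : f x = g x * 0.
    by rewrite mulr0 /f patchE memNset//= in_itv/= x0/= leNgt lt.
  apply: cvgM; first exact: cvg_cst.
  by apply: stone_low; rewrite a0/=; apply: arcfun_out => //; rewrite lt.
pose ag x : R := `|g x|.
have hg' : leb.-integrable (@circle R) (EFin \o ag) := integ_abs ig.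
have dom : {ae leb, forall x n, circle x ->
    (`|(EFin \o fn n) x| <= (EFin \o ag) x)%E}.
  apply: aeW => x n _; rewrite lee_fin normrM ler_piMr//.
  by have /andP[h0 h1] := stone_itv n (arcfun_itv b x); rewrite ger0_norm.
have [h1 _ h2] := @dominated_convergence _ _ _ leb _ (@measurable_circle R)
  (fun n => EFin \o fn n) (EFin \o f) (EFin \o ag) mfn mf cvg_ae hg' dom.
have E : (\int[leb]_(x in @circle R) (f x)%:E)%E = 0%E.
  apply: (cvg_unique (@ereal_hausdorff R) h2).
  have -> : (fun n => \int[leb]_(x in @circle R) (EFin \o fn n) x)%E = (fun=> 0%E).
    apply/funext => n.
    have e0 : cint (fn n) = 0 by exact: cint_trigpoly ig h (trigpoly_stone b n).
    have fin := @integrable_fin_num _ _ _ leb (@circle R) (@measurable_circle R) (EFin \o fn n) (ifn n).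
    by rewrite -[LHS]fineK//; exact: (congr1 EFin e0).
  exact: cvg_cst.
have -> : `[0, b]%classic = @circle R `&` `[0, b]%classic.
  apply/esym/setIidPr => x /=; rewrite /circle /= !in_itv/= => /andP[-> xb]/=.
  by apply: le_trans xb (ltW bp).
by rewrite Rintegral_mkcondr /Rintegral E.
Qed.

(** The primitive of the function vanishes, since integrals over arcs do, and the
    function is almost everywhere the derivative of its primitive. *)
Lemma fourier_unique0 g : integrableT g ->
  (forall k : int, ccos g k = 0 /\ csin g k = 0) -> eqT g (fun=> 0).
Proof.
move=> [pg ig] h; apply: ae_periodic => //.
pose f0 := g \_ (@circle R).
have locf : locally_integrable [set: R] f0.
  exact: integrable_locally (@measurable_circle R) ig.
have intf (y : R) : leb.-integrable [set` Interval (BLeft 0) (BRight y)] (EFin \o f0).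
  have h1 : leb.-integrable setT (EFin \o f0).
    have := (@integrable_mkcond _ _ _ leb (@circle R) (EFin \o g) (@measurable_circle R)).1 ig.
    by rewrite /f0 restrict_EFin.
  by apply: (integrableS measurableT _ _ h1) => //; exact: measurable_itv.
have := FTC1 intf locf.
apply: filterS; first exact: (ae_filter_ringOfSetsType leb).
move=> x /= H /andP[x0 xp].
have [|dF F'] := H; first by rewrite lte_fin.
have : f0 x = g x by rewrite /f0 patchE mem_set// /circle/= in_itv/= !ltW.
move=> <-; rewrite -F' derive1E.
set F := (fun y : R => _).
have F0 (y : R) : 0 < y < 2 * pi -> F y = 0.
  move=> yi; rewrite -(cint_arc ig h yi) /F; apply: eq_Rintegral => t.
  rewrite inE/= in_itv/= => /andP[t0 ty].
  rewrite /f0 patchE mem_set// /circle/= in_itv/= t0/=.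
  have /andP[_ yp] := yi; exact: le_trans ty (ltW yp).
have /@derive_val -> // : is_derive x 1 F 0.
apply: (@near_eq_is_derive _ _ _ (fun=> 0)).
have px : x \in `]0, (2 * pi : R)[ by rewrite in_itv/= x0.
have := near_in_itv px; apply: filterS => y; rewrite in_itv/= => yi.
by rewrite F0.
Qed.

Lemma fourier_unique (f g : R -> R) : integrableT f -> integrableT g ->
  (forall k, fourier f k = fourier g k) -> eqT f g.
Proof.
move=> [pf hf] [pg hg] fg.
have hB : integ (fun x => f x - g x) by exact: integB.
have hZ : integ (fun x => 0 * f x) by exact: integZ.
have pB : integrableT (fun x => f x - g x) by split => // x; rewrite pf pg.
have e : forall k, fourier (fun x => f x - g x) k = fourier (fun x => 0 * f x) k.
  by move=> k; rewrite fourierB// fourierZ// fg subrr mul0r.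
have z a b (k : int) : cint (fun x => 0 * f x * trig a b k%:~R x) = 0.
  rewrite -[RHS](mul0r (2 * pi)) -cint_cst; apply: eq_cint => x.
  by rewrite !mul0r.
have h k : ccos (fun x => f x - g x) k = 0 /\ csin (fun x => f x - g x) k = 0.
  by have [-> ->] := fourier_inj hB hZ e k; rewrite /ccos /csin !z.
have := fourier_unique0 pB h; apply: filterS; first exact: (ae_filter_ringOfSetsType lebesgue_measure).
by move=> x /eqP; rewrite subr_eq0 => /eqP.
Qed.

End FourierUniqueness.

(** * Function spaces in terms of coefficients *)

Section SobolevNorm.
Variable R : realType.
Implicit Types (f g : R -> R) (s B : R).

Lemma esum_le_sumle (x : int -> R) B : (forall k, 0 <= x k) -> sumle x B ->
  (\esum_(k in [set: int]) (x k)%:E <= B%:E)%E.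
Proof.
move=> x0 xB; apply: ge_ereal_sup => _ [A [fA _] <-].
rewrite fsbig_finite//= sumEFin lee_fin; apply: sumle_seq => //.
exact: finmap.fset_uniq.
Qed.

Lemma sumle_esum (x : int -> R) B : (\esum_(k in [set: int]) (x k)%:E <= B%:E)%E ->
  sumle x B.
Proof.
move=> xB N; rewrite -lee_fin -sumEFin; apply: le_trans xB; apply: esum_ge.
exists [set` box N]; first by split => //; exact: finite_seq.
by rewrite -fsbig_seq ?uniq_box.
Qed.

Lemma sobolev_sumE s f :
  sobolev_sum s f = (\esum_(k in [set: int]) ((W s k * nc (fourier f k)) ^+ 2)%:E)%E.
Proof. by apply: eq_esum => k _; rewrite exprMn -W2. Qed.

Lemma sobolev_sum_ge0 s f : (0 <= sobolev_sum s f)%E.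
Proof. by rewrite sobolev_sumE; apply: esum_ge0 => k _; rewrite lee_fin sqr_ge0. Qed.

Lemma sobolev_norm_ge0 s f : 0 <= sobolev_norm s f.
Proof. exact: sqrtr_ge0. Qed.

Lemma Hdot_hseq s f : Hdot s f -> hseq s (fourier f) (sobolev_norm s f).
Proof.
move=> [_ f0 fs]; split=> //; first exact: sobolev_norm_ge0.
have fin : sobolev_sum s f \is a fin_num by rewrite ge0_fin_numE ?sobolev_sum_ge0.
rewrite /sobolev_norm sqr_sqrtr ?fine_ge0 ?sobolev_sum_ge0//.
by apply: sumle_esum; rewrite fineK// sobolev_sumE.
Qed.

Lemma hseq_Hdot s f B : integrableT f -> hseq s (fourier f) B -> Hdot s f.
Proof.
move=> hf [B0 f0 fB]; split=> //; rewrite sobolev_sumE.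
apply: le_lt_trans (ltry (B ^+ 2)); apply: esum_le_sumle => // k; exact: sqr_ge0.
Qed.

Lemma sobolev_norm_le s f B : hseq s (fourier f) B -> sobolev_norm s f <= B.
Proof.
move=> [B0 f0 fB]; rewrite -[B]ger0_norm// -sqrtr_sqr; apply: ler_wsqrtr.
rewrite -lee_fin; have h : (sobolev_sum s f <= (B ^+ 2)%:E)%E.
  by rewrite sobolev_sumE; apply: esum_le_sumle => // k; exact: sqr_ge0.
rewrite fineK// ge0_fin_numE ?sobolev_sum_ge0//; exact: le_lt_trans h (ltry _).
Qed.

End SobolevNorm.

Section TimeInterval.
Variable R : realType.

Lemma time_intervalE (a t : R) : 0 <= a ->
  time_interval (lifespan a) t <-> a * `|t| < 1.
Proof.
move=> a0; rewrite /time_interval/= /lifespan; have [->|an0] := eqVneq a 0.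
  by rewrite mul0r ltry ltr01.
have ap : 0 < a by rewrite lt_neqAle eq_sym an0.
by rewrite lte_fin -[a^-1]mul1r ltr_pdivlMr// mulrC.
Qed.

Lemma kernel_of_hypotheses (mu C : R) (S : int -> int -> int -> R[i]) :
  0 <= mu ->
  (forall k m n : int, k * m * n = 0 -> S k m n = 0) ->
  (forall k m n : int, S k m n = (S (- k) (- m) (- n))^*) ->
  (forall k m n : int, S k m n = S k n m) ->
  (forall k m n : int, S k m n = S m n k) ->
  (forall k m n : int,
     ComplexField.Normc.normc (S k m n)
     <= C * Num.min (`|k|%:~R `^ mu) (Num.min (`|m|%:~R `^ mu) (`|n|%:~R `^ mu))) ->
  kernel mu C S.
Proof.
move=> mu0 hz hc hs hr hb.
have C0 : 0 <= C.
  have := hb 1 1 1; rewrite normr1 powR1 !minxx mulr1.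
  by apply: le_trans; exact: nc_ge0.
split => //.
move=> k m n; apply: le_trans (hb k m n) _; rewrite ler_wpM2l//.
by rewrite ge_min lexx.
Qed.

End TimeInterval.

Section FunctionSpaces.
Variable R : realType.
Implicit Types (u v : R -> R -> R) (I : set R) (r : R).

Lemma hseq_summable r (c : int -> R[i]) A : 1 / 2 < r -> hseq r c A ->
  sumle (fun k => nc (c k)) (Mconst r * A).
Proof.
move=> hr hc; have := @hseq_l1 R r 0 c A; rewrite subr0 => /(_ hr hc).
by apply: le_sumle => k; rewrite /W powRr0 mul1r.
Qed.

Lemma synth_hseq r (c : int -> R[i]) A : 1 / 2 < r -> hseq r c A -> herm c ->
  integrableT (synth c) /\ fourier (synth c) = c.
Proof.
move=> hr hc Hc; have cA := hseq_summable hr hc; split.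
  exact: integrableT_synth cA.
by apply/funext => k; exact: fourier_synth cA Hc.
Qed.

Lemma sobolev_norm_cvg r (T : Type) (F : set_system T) (FF : Filter F) (y : T -> R -> R) :
  (forall e, 0 < e -> \forall h \near F, hseq r (fourier (y h)) e) ->
  sobolev_norm r (y h) @[h --> F] --> (0 : R).
Proof.
move=> hy; apply/cvgrPdist_le => e e0; apply: filterS (hy e e0) => h hh.
by rewrite sub0r normrN ger0_norm ?sobolev_norm_ge0// sobolev_norm_le.
Qed.

Lemma near_translate (t0 : R) (P : R -> Prop) :
  (\forall h \near (0 : R), P (t0 + h)) -> \forall t \near t0, P t.
Proof.
move=> [d d0 hd]; exists d => //= t /= td.
have := hd (t - t0); rewrite addrCA subrr addr0; apply => /=.
by rewrite sub0r normrN -normrN opprB.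
Qed.

Lemma C0_Hdot_fourier r I u : (forall t, I t -> Hdot r (u t)) ->
  (forall t0, I t0 -> forall e, 0 < e -> \forall h \near (0 : R), I (t0 + h) ->
     hseq r (fun k => fourier (u (t0 + h)) k - fourier (u t0) k) e) ->
  C0_Hdot r I u.
Proof.
move=> hu hc; split => // t0 It0; apply: sobolev_norm_cvg => e e0.
apply: near_translate; apply: filterS (hc t0 It0 e e0) => h hh Ih.
have -> // : fourier (u (t0 + h) \- u t0) =
  fun k => fourier (u (t0 + h)) k - fourier (u t0) k.
  apply/funext => k; have [[_ i1] _ _] := hu _ Ih; have [[_ i2] _ _] := hu _ It0.
  exact: fourierB.
exact: hh.
Qed.

Lemma HdotB r (f g : R -> R) : Hdot r f -> Hdot r g -> Hdot r (fun x => f x - g x).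
Proof.
move=> hf hg; have [[pf If] _ _] := hf; have [[pg Ig] _ _] := hg.
apply: (@hseq_Hdot R r _ (sobolev_norm r f + sobolev_norm r g)).
  by split; [move=> x; rewrite pf pg|exact: integB].
have := hseqB (Hdot_hseq hf) (Hdot_hseq hg).
by under eq_fun do rewrite -fourierB//.
Qed.

Lemma HdotZ r a (f : R -> R) : Hdot r f -> Hdot r (fun x => a * f x).
Proof.
move=> hf; have [[pf If] _ _] := hf.
apply: (@hseq_Hdot R r _ (nc a%:C * sobolev_norm r f)).
  by split; [move=> x; rewrite pf|exact: integZ].
have := hseqZ a%:C (Hdot_hseq hf).
by under eq_fun do rewrite -fourierZ//.
Qed.

Lemma sobolev_norm_dist r (f g : R -> R) : Hdot r f -> Hdot r g ->
  `|sobolev_norm r f - sobolev_norm r g| <= sobolev_norm r (fun x => f x - g x).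
Proof.
move=> hf hg; have [[pf If] _ _] := hf; have [[pg Ig] _ _] := hg.
have hB := Hdot_hseq (HdotB hf hg).
have le1 : sobolev_norm r f <= sobolev_norm r (fun x => f x - g x) + sobolev_norm r g.
  apply: sobolev_norm_le; have := hseqD hB (Hdot_hseq hg).
  by under eq_fun do rewrite fourierB// subrK.
have le2 : sobolev_norm r g <= sobolev_norm r f + sobolev_norm r (fun x => f x - g x).
  apply: sobolev_norm_le; have := hseqB (Hdot_hseq hf) hB.
  by under eq_fun do rewrite fourierB// opprB addrC subrK.
by rewrite ler_norml lerBlDr le1 andbT lerNl opprB lerBlDl.
Qed.

End FunctionSpaces.

(** * Existence and uniqueness of the solution *)

Section Solution.
Variable R : realType.
Variables (mu C s Cs : R) (S : int -> int -> int -> R[i]).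
Hypothesis kS : kernel mu C S.
Hypothesis hCs : symbol_bound s Cs.
Hypothesis sr : 1 / 2 < s - mu - 1.
Let mu0 := ker_mu kS.
Let s1 : 1 <= s := sobolev_index_ge1 kS sr.
Let s0 : 0 <= s := le_trans ler01 s1.
Let sq : 1 / 2 < s - mu. Proof. by have := sr; lra. Qed.
Let sl : 1 / 2 < s. Proof. by have m0 : 0 <= mu := mu0; have := sr; lra. Qed.
Let sl1 : 1 / 2 < s - 1. Proof. by have m0 : 0 <= mu := mu0; have := sr; lra. Qed.
Let K := growth mu C s Cs.
Let K0 : 0 <= K := growth_ge0 kS hCs.

Lemma dcoef_quad (c : int -> R[i]) k : dcoef (quad S c c) k = - burgers S c k.
Proof. by rewrite /dcoef /burgers mulNr opprK. Qed.

Lemma synthN (c : int -> R[i]) x A : sumle (fun k => nc (c k)) A ->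
  synth (fun k => - c k) x = - synth c x.
Proof.
move=> cA; have E N : fpart (fun k => - c k) N x = - fpart c N x.
  by rewrite /fpart -sumrN; apply: eq_bigr => k _; rewrite /trig RezN ImzN; ring.
rewrite {1}/synth; under eq_fun do rewrite E.
apply: (cvg_lim (@Rhausdorff R)); apply: cvgN; exact: (fpart_cvg cA (x := x)).
Qed.

(** With [w] synthesised from [quad S c c], the coefficients of [w] and of its
    derivative are summable because [s] and [s - 1] exceed one half. *)
Lemma synth_bilin c A : hseq s c A -> herm c -> exists w wx : R -> R,
  [/\ bilin S (synth c) (synth c) w, weak_deriv w wx &
      eqT (fun x => synth (burgers S c) x + wx x) (fun=> 0)].
Proof.
move=> hc Hc; exists (synth (quad S c c)), (synth (dcoef (quad S c c))).
have hq := hseq_quad kS s0 sq hc hc; have hb := hseq_burgers kS s0 sq hc.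
have Hq : herm (quad S c c) by move=> k; exact: (quad_conj kS k s0 hc hc Hc Hc).
have [iq fq] := synth_hseq sl hq Hq.
have [_ fc] := synth_hseq sl hc Hc.
have bA := hseq_summable sl1 hb.
split.
- split; first exact: iq.
  by move=> k; rewrite fq fc; exact: (quad_zsum kS k s0 hc hc).
- apply: weak_deriv_synth; first exact: hseq_summable sl hq.
  by apply: le_sumle bA => k; rewrite dcoef_quad ncN.
apply: aeW => x; have -> : dcoef (quad S c c) = fun k => - burgers S c k.
  by apply/funext => k; exact: dcoef_quad.
by rewrite (synthN x bA) subrr.
Qed.

Lemma solution_exists f : Hdot s f ->
  exists u, is_solution S s [set t | K * sobolev_norm s f * `|t| < 1] f u.
Proof.
move=> hf; have hfc := Hdot_hseq hf; set rho := sobolev_norm s f in hfc *.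
have [[pf If] _ _] := hf; have [rho0 _ _] := hfc.
have [c [c0 hc]] := coef_existence kS hCs sr hfc (fourier_herm If).
have fl : coef_flow mu C s Cs S rho c by [].
have hct t : K * rho * `|t| < 1 -> exists A, hseq s (c t) A /\ herm (c t).
  by move=> /hc[h1 h2 _]; eexists; split; first exact: h1.
pose u t := synth (c t); pose ut t := synth (burgers S (c t)).
have hu t : K * rho * `|t| < 1 -> Hdot s (u t) /\ fourier (u t) = c t.
  move=> /hct[A [h1 h2]]; have [i1 f1] := synth_hseq sl h1 h2; split; last exact: f1.
  by apply: hseq_Hdot i1 _; rewrite f1; exact: h1.
have hut t : K * rho * `|t| < 1 ->
    Hdot (s - 1) (ut t) /\ fourier (ut t) = burgers S (c t).
  move=> /hct[A [h1 h2]]; have hb := hseq_burgers kS s0 sq h1.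
  have [i1 f1] := synth_hseq sl1 hb (burgers_herm kS s0 h1 h2); split; last exact: f1.
  by apply: hseq_Hdot i1 _; rewrite f1; exact: hb.
exists u; split.
  apply: C0_Hdot_fourier => [t /= /hu[]//|t /= It e e0].
  have := flow_continuous kS hCs sr rho0 fl It e0; apply: filterS => h hh Ih.
  by rewrite (hu _ Ih).2 (hu _ It).2.
exists ut; split.
- split.
  + move=> t /= /hct[A [h1 h2]]; have [i1 f1] := synth_hseq sl h1 h2.
    apply: hseq_Hdot i1 _; rewrite f1.
    by apply: hseqW h1; rewrite gerBl.
  + apply: C0_Hdot_fourier => [t /= /hut[]//|t /= It e e0].
    have := flow_rhs_continuous kS hCs sr rho0 fl It e0; apply: filterS => h hh Ih.
    rewrite (hut _ Ih).2 (hut _ It).2; exact: hh.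
  + move=> t /= It; apply: sobolev_norm_cvg => e e0.
    have nI : \forall h \near (0 : R)^', K * rho * `|t + h| < 1.
      have [dl [dl0 KT]] := lifespan_open (mulr_ge0 K0 rho0) It.
      apply: nbhs_dnbhs; exists dl => //= h /=; rewrite sub0r normrN => hdl.
      apply: (flow_bound kS hCs rho0 KT _).1.
      by apply: le_trans (ler_normD _ _) _; rewrite lerD2l ltW.
    apply: filterS2 nI (flow_derivable kS hCs sr rho0 fl It e0) => h Ih.
    have [[[_ i1] _ _] f1] := hu _ Ih; have [[[_ i2] _ _] f2] := hu _ It.
    have [[[_ i3] _ _] f3] := hut _ It.
    have i4 := integB i1 i2.
    have -> // : fourier (fun x => h^-1 * (u (t + h) x - u t x) - ut t x) =
      fun k => (h^-1)%:C * (c (t + h) k - c t k) - burgers S (c t) k.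
    apply/funext => k; rewrite (@fourierB R (fun x => h^-1 * (u (t + h) x - u t x)))//.
      by rewrite (@fourierZ R _ (fun x => u (t + h) x - u t x))// fourierB// f1 f2 f3.
    exact: integZ.
- have z : K * rho * `|0 : R| < 1 by rewrite normr0 mulr0.
  have [[iu _ _] f1] := hu _ z; apply: fourier_unique => //.
  by move=> k; rewrite f1 c0.
- by move=> t /= /hct[A [h1 h2]]; exact: synth_bilin h1 h2.
Qed.

End Solution.

Section Uniqueness.
Variable R : realType.
Variables (mu C s : R) (S : int -> int -> int -> R[i]).
Hypothesis kS : kernel mu C S.
Hypothesis sr : 1 / 2 < s - mu - 1.
Let s1 : 1 <= s := sobolev_index_ge1 kS sr.
Let s0 : 0 <= s := le_trans ler01 s1.

Variables (I : set R) (f : R -> R).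
Hypothesis openI : forall t, I t -> \forall h \near (0 : R), I (t + h).

(** Each coefficient is dominated by the Sobolev norm of order [s - 1 >= 0]. *)
Lemma C1_Hdot_cderiv u ut t k : C1_Hdot (s - 1) I u ut -> I t ->
  cderiv (fun a => fourier (u a) k) t (fourier (ut t) k).
Proof.
move=> [hu [hut _] hd] It; apply: cderiv_ccvg.
pose q (h : R) x := h^-1 * (u (t + h) x - u t x) - ut t x.
apply: (@ccvg_squeeze _ _ _ _ _ _ (fun h => sobolev_norm (s - 1) (q h))); last exact: hd It.
have := openI It => /nbhs_dnbhs; apply: filterS => h Ih; rewrite subr0.
have hq1 := HdotB (hu _ Ih) (hu _ It); have hq2 := HdotZ h^-1 hq1.
have := HdotB hq2 (hut _ It); rewrite -/(q h) => hq.
have [[_ i1] _ _] := hu _ Ih; have [[_ i2] _ _] := hu _ It.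
have [[_ i3] _ _] := hut _ It.
have [[_ i4] _ _] := hq1; have [[_ i5] _ _] := hq2.
have s10 : 0 <= s - 1 by rewrite subr_ge0.
have := hseq_sup k s10 (Hdot_hseq hq).
by rewrite /q fourierB// fourierZ// fourierB.
Qed.

Lemma solution_coef v t : is_solution S s I f v -> I t ->
  [/\ hseq s (fourier (v t)) (sobolev_norm s (v t)), herm (fourier (v t)) &
      forall k, cderiv (fun a => fourier (v a) k) t (burgers S (fourier (v t)) k)].
Proof.
move=> [[hv _] [ut [hc1 _ heq]]] It.
have hvt := hv t It; have hs := Hdot_hseq hvt; have [[_ iv] _ _] := hvt.
split; [exact: hs|exact: fourier_herm|].
move=> k; have := C1_Hdot_cderiv k hc1 It.
suff -> : fourier (ut t) k = burgers S (fourier (v t)) k by [].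
have [w [wx [[iw hw] hwx utE]]] := heq t It.
have [_ [_ iwx] _] := hwx.
have [_ [hut _] _] := hc1; have [[_ iut] _ _] := hut t It.
have E : eqT (ut t) (fun x => -1 * wx x).
  have := utE; apply: filterS; first exact: (ae_filter_ringOfSetsType lebesgue_measure).
  by move=> x /eqP; rewrite addr_eq0 mulN1r => /eqP.
rewrite (fourier_ae k iut (integZ (-1) iwx) E) fourierZ// (fourier_weak_deriv k hwx).
rewrite (zsum_unique (hw k) (quad_zsum kS k s0 hs hs)) /burgers.
by rewrite rmorphN1 mulN1r mulNr.
Qed.

(** The norm is continuous in time, and a segment is compact. *)
Lemma solution_bounded v (b : R) : is_solution S s I f v -> 0 <= b ->
  (forall t, `|t| <= b -> I t) ->
  exists A, forall t, `|t| <= b -> sobolev_norm s (v t) <= A.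
Proof.
move=> [[hv cv] _] b0 bI.
have bb : - b <= b by lra.
have [|x _ hx] := @EVT_max R (fun t => sobolev_norm s (v t)) (- b) b bb.
  apply: continuous_in_subspaceT => t; rewrite inE/= in_itv/= -ler_norml => tb.
  have It := bI t tb.
  have nI : \forall t' \near t, I t' by exact: near_translate (openI It).
  apply/cvgrPdist_le => e e0.
  have := cv t It => /cvgrPdist_le /(_ e e0).
  rewrite near_withinE => h; apply: filterS2 nI h => t' It' /(_ It').
  rewrite sub0r normrN ger0_norm ?sobolev_norm_ge0// => h.
  by rewrite distrC; apply: le_trans h; exact: sobolev_norm_dist (hv _ It') (hv _ It).
by exists (sobolev_norm s (v x)) => t; rewrite ler_norml => tb; apply: hx; rewrite in_itv.
Qed.

Hypothesis symI : forall t a, I t -> `|a| <= `|t| -> I a.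

(** The coefficients of two solutions are bounded on the segment between [0] and
    [t], and solve the same system of equations there. *)
Lemma solution_unique u v t : is_solution S s I f u -> is_solution S s I f v ->
  integrableT f -> I t -> eqT (u t) (v t).
Proof.
move=> hu hv [_ If] It.
have bI a : `|a| <= `|t| -> I a by exact: symI.
have [A hA] := solution_bounded hu (normr_ge0 t) bI.
have [B hB] := solution_bounded hv (normr_ge0 t) bI.
have [e [e1 he eu1]] := time_direction t; rewrite -[e * _]add0r in he.
have eu a : 0 <= a <= `|t| -> `|0 + e * a| <= `|t|.
  by move=> /andP[a0 at_]; rewrite add0r; apply: le_trans (eu1 a a0) at_.
have ode w D : is_solution S s I f w -> D <= Num.max A B ->
    (forall a, `|a| <= `|t| -> sobolev_norm s (w a) <= D) ->
    bounded_ode S s e `|t| (Num.max A B) (fun a => fourier (w (0 + e * a))).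
  move=> hw DM hD a /eu at_; have [h1 h2 h3] := solution_coef hw (bI _ at_).
  split => //; last by move=> k; apply: (@cderiv_affine _ (fun a => fourier (w a) k)).
  by apply: hseq_le h1; apply: le_trans DM; exact: hD.
have ou := ode u A hu; rewrite le_max lexx in ou; have {}ou := ou isT hA.
have ov := ode v B hv; rewrite le_max lexx orbT in ov; have {}ov := ov isT hB.
have I0 : I 0 by apply: bI; rewrite normr0.
have start w : is_solution S s I f w -> forall k, fourier (w 0) k = fourier f k.
  move=> [[hw _] [ut [_ wf _]]] k; have [[_ iw] _ _] := hw 0 I0.
  exact: fourier_ae iw If wf.
have st k : fourier (u (0 + e * 0)) k = fourier (v (0 + e * 0)) k.
  by rewrite mulr0 addr0 (start _ hu) (start _ hv).
have tt : 0 <= `|t| <= `|t| by rewrite normr_ge0 lexx.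
have E := bounded_ode_unique kS sr e1 (normr_ge0 t) ou ov st tt.
rewrite -he in E.
have [[hu' _] _] := hu; have [[hv' _] _] := hv.
have [iu _ _] := hu' t It; have [iv _ _] := hv' t It.
exact: fourier_unique iu iv E.
Qed.

End Uniqueness.

Theorem theorem1 (R : realType) (mu : R) (S : int -> int -> int -> R[i])
  (C s Cs : R) :
  0 <= mu ->
  (forall k m n : int, k * m * n = 0 -> S k m n = 0) ->
  (forall k m n : int, S k m n = (S (- k) (- m) (- n))^*) ->
  (forall k m n : int, S k m n = S k n m) ->
  (forall k m n : int, S k m n = S m n k) ->
  (forall (eta : R) (k m n k' m' n' : int), 0 < eta ->
     k'%:~R = eta * k%:~R -> m'%:~R = eta * m%:~R -> n'%:~R = eta * n%:~R ->
     S k' m' n' = (eta `^ mu)%:C * S k m n) ->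
  (forall k m n : int,
     ComplexField.Normc.normc (S k m n)
     <= C * Num.min (`|k|%:~R `^ mu) (Num.min (`|m|%:~R `^ mu) (`|n|%:~R `^ mu))) ->
  mu + 3 / 2 < s ->
  symbol_bound s Cs ->
  forall f : R -> R, Hdot s f ->
  let K := C * Cs * Mconst (s - mu - 1) in
  let I := time_interval (lifespan (K * sobolev_norm s f)) in
  exists u : R -> R -> R,
    is_solution S s I f u /\
    (forall v : R -> R -> R, is_solution S s I f v ->
       forall t, I t -> eqT (u t) (v t)).
Proof.
move=> mu0 hz hc hs hr _ hb smu hCs f hf K I.
have kS := kernel_of_hypotheses mu0 hz hc hs hr hb.
have sr : 1 / 2 < s - mu - 1 by lra.
have K0 : 0 <= K := growth_ge0 kS hCs.
have rho0 := sobolev_norm_ge0 s f.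
have a0 : 0 <= K * sobolev_norm s f := mulr_ge0 K0 rho0.
have IE : I = [set t | K * sobolev_norm s f * `|t| < 1].
  by apply/seteqP; split => t; rewrite /I => /(time_intervalE t a0).
have [u hu] := solution_exists kS hCs sr hf.
rewrite IE; exists u; split; first exact: hu.
move=> v hv t It; apply: (solution_unique kS sr _ _ hu hv _ It).
- move=> {}t /= {}It; have [dl [dl0 KT]] := lifespan_open (mulr_ge0 K0 rho0) It.
  exists dl => //= h /=; rewrite sub0r normrN => hdl.
  apply: (flow_bound kS hCs rho0 KT _).1.
  by apply: le_trans (ler_normD _ _) _; rewrite lerD2l ltW.
- by move=> {}t a /= {}It at_; exact: (flow_bound kS hCs rho0 It at_).1.
- by have [] := hf.
Qed.
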